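(* Let $K\subseteq\mathbb{C}^d$ be a compact convex set, and let $T=(T_1,\ldots,T_d)$ be a tuple of compact operators acting on an infinite-dimensional Hilbert space $H$, with $\mathcal{W}(T)\subseteq\mathcal{W}^{\min}(K)$. Then for any $\varepsilon>0$, there exists a normal dilation $N$ of $T$ consisting of compact operators such that $N$ decomposes as a direct sum $A\oplus B$ with $\|A_i\|<\varepsilon$ for each $i$ and $\sigma(B)\subseteq(1+\varepsilon)K$.
   Context: Let $\mathcal{M}^d=\bigcup_{n\ge1}M_n^d$, where $M_n^d$ is the set of $d$-tuples of complex $n\times n$ matrices. UCP means unital completely positive. For $T\in\mathcal{B}(H)^d$, the matrix range is $\mathcal{W}(T)=\bigcup_n\mathcal{W}_n(T)$, where $\mathcal{W}_n(T)=\{(\psi(T_1),\ldots,\psi(T_d)):\psi:\mathcal{B}(H)\to M_n\text{ UCP}\}$. A tuple of operators is normal if its members are normal and commute with each other; $\sigma(N)$ denotes the joint spectrum of a normal tuple. $Y\in\mathcal{B}(L)^d$ is a dilation of $X\in\mathcal{B}(H)^d$ if there is an isometry $V:H\to L$ with $X_i=V^*Y_iV$ for all $i$. For a compact convex set $K\subseteq\mathbb{C}^d$, $\mathcal{W}^{\min}(K)$ is the set of $X\in\mathcal{M}^d$ having a normal dilation $N$ with $\sigma(N)\subseteq K$. *)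

(* Defs.v *)
From HB Require Import structures.
From mathcomp Require Import all_boot all_order all_algebra sesquilinear.
From mathcomp Require Import complex.
From mathcomp Require Import all_classical all_reals all_analysis.

Set Implicit Arguments.
Unset Strict Implicit.
Unset Printing Implicit Defensive.

Import Order.TTheory GRing.Theory Num.Theory.
Import numFieldNormedType.Exports.

Local Open Scope classical_set_scope.
Local Open Scope ring_scope.
Local Open Scope complex_scope.

(* The library only puts the norm topology on a field of the form K^o. *)
HB.instance Definition _ (R : realType) := NormedModule.copy R[i] R[i]^o.

(* The inner product is linear in its first argument. *)
HB.mixin Record NormedModule_isInnerProduct (R : realType) H
    of NormedModule R[i] H := {
  inner : {dot H for @Num.conj R[i]} ;
  inner_normE : forall x : H, inner x x = `|x| ^+ 2
}.

#[short(type="hilbertType")]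
HB.structure Definition Hilbert (R : realType) :=
  {H of CompleteNormedModule R[i] H & NormedModule_isInnerProduct R H}.

Section Operators.
Context {R : realType}.

(* B(H), as a set of functions: on normed modules, a linear map is bounded iff
   it is continuous (linear_bounded_continuous). *)
Definition bounded_op (H : hilbertType R) : set (H -> H) :=
  [set A | linear A /\ continuous A].

Definition op_norm (H : hilbertType R) (A : H -> H) : R :=
  sup [set complex.Re `|A x| | x in [set x : H | `|x| <= 1]].

Definition compact_op (H : hilbertType R) : set (H -> H) :=
  [set A | bounded_op A /\ precompact (A @` [set x : H | `|x| <= 1])].

Definition infinite_dimensional (H : hilbertType R) : Prop :=
  ~ exists n (e : 'I_n -> H),
      forall x, exists c : 'I_n -> R[i], x = \sum_i c i *: e i.

(* The inner products are arguments, so that the notion also applies to C^n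
   with dotC below: the norm which the library puts on 'cV_n is the sup norm. *)
Definition adjoint (U V : Type) (dotU : U -> U -> R[i]) (dotV : V -> V -> R[i])
    (A : U -> V) (B : V -> U) : Prop :=
  forall u v, dotV (A u) v = dotU u (B v).

Definition op_adjoint (H : hilbertType R) (A B : H -> H) : Prop :=
  adjoint (@inner R H) (@inner R H) A B.

Definition normal_op (H : hilbertType R) (A : H -> H) : Prop :=
  bounded_op A /\ exists2 B, op_adjoint A B & A \o B = B \o A.

Definition normal_tuple (H : hilbertType R) d (N : 'I_d -> H -> H) : Prop :=
  (forall i, normal_op (N i)) /\ (forall i j, N i \o N j = N j \o N i).

(* Unital C*-subalgebras of B(H). *)
Definition cstar_subalgebra (H : hilbertType R) (S : set (H -> H)) : Prop :=
  [/\ S `<=` @bounded_op H /\ S id,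
      forall (a : R[i]) A B, S A -> S B -> S (a *: A + B),
      forall A B, S A -> S B -> S (A \o B),
      forall A B, S A -> op_adjoint A B -> S B &
      forall A, bounded_op A ->
        (forall e : R, 0 < e -> exists2 B, S B & op_norm (A - B) < e) -> S A].

Definition cstar_gen (H : hilbertType R) d (N : 'I_d -> H -> H) :
    set (H -> H) :=
  smallest (@cstar_subalgebra H) (range N).

Definition character (H : hilbertType R) (S : set (H -> H))
    (chi : (H -> H) -> R[i]) : Prop :=
  [/\ chi id = 1,
      forall (a : R[i]) A B, S A -> S B -> chi (a *: A + B) = a * chi A + chi B &
      forall A B, S A -> S B -> chi (A \o B) = chi A * chi B].

(* sigma(N), as the Gelfand spectrum of the commutative C*-algebra C*(1, N)
   embedded in C^d by chi |-> (chi(N_1), ..., chi(N_d)). *)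
Definition joint_spectrum (H : hilbertType R) d (N : 'I_d -> H -> H) :
    set 'rV[R[i]]_d :=
  [set l | exists2 chi, character (cstar_gen N) chi &
                        forall i, l 0 i = chi (N i)].

Definition dotC n (u v : 'cV[R[i]]_n) : R[i] := \sum_i u i 0 * Num.conj (v i 0).

(* V is a linear isometry, W = V^* and X_i = V^* Y_i V. *)
Definition dilation (U : lmodType R[i]) (dotU : U -> U -> R[i])
    (L : hilbertType R) d (X : 'I_d -> U -> U) (Y : 'I_d -> L -> L) : Prop :=
  exists (V : U -> L) (W : L -> U),
    [/\ linear V, forall u, inner (V u) (V u) = dotU u u,
        adjoint dotU (@inner R L) V W & forall i, X i = W \o Y i \o V].

(* The k x k operator matrix A is positive on H^k. *)
Definition positive_opmx (U : Type) (dotU : U -> U -> R[i]) k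
    (A : 'I_k -> 'I_k -> U -> U) : Prop :=
  forall h : 'I_k -> U, 0 <= \sum_p \sum_q dotU (A p q (h q)) (h p).

(* Only the values of psi on B(H) matter. *)
Definition ucp (H : hilbertType R) n (psi : (H -> H) -> 'M[R[i]]_n) : Prop :=
  [/\ forall (a : R[i]) A B, bounded_op A -> bounded_op B ->
        psi (a *: A + B) = a *: psi A + psi B,
      psi id = 1%:M &
      forall k (A : 'I_k -> 'I_k -> H -> H), (forall p q, bounded_op (A p q)) ->
        positive_opmx (@inner R H) A ->
        positive_opmx (@dotC n) (fun p q u => psi (A p q) *m u)].

Definition matrix_range (H : hilbertType R) d (T : 'I_d -> H -> H) n :
    set ('I_d -> 'M[R[i]]_n) :=
  [set X | exists2 psi, ucp psi & forall i, X i = psi (T i)].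

Definition Wmin d (K : set 'rV[R[i]]_d) n : set ('I_d -> 'M[R[i]]_n) :=
  [set X | exists (L : hilbertType R) (N : 'I_d -> L -> L),
     [/\ normal_tuple N, joint_spectrum N `<=` K &
         dilation (@dotC n) (fun i u => X i *m u) N]].

(* N is A (+) B up to a unitary J from the Hilbert sum of LA and LB onto L;
   boundedness and normality of A and B follow from those of N. *)
Definition direct_sum (LA LB L : hilbertType R) d (A : 'I_d -> LA -> LA)
    (B : 'I_d -> LB -> LB) (N : 'I_d -> L -> L) : Prop :=
  exists J : LA * LB -> L,
    [/\ linear J,
        forall p q, inner (J p) (J q) = inner p.1 q.1 + inner p.2 q.2,
        forall y, exists p, J p = y &
        forall i p, N i (J p) = J (A i p.1, B i p.2)].

End Operators.

Arguments Wmin {R d} K n.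
Arguments matrix_range {R H d} T n.

(* Main.v *)
(* The matrix range is only tested on a compression: for a suitable finite-dimensional
   [P], the operators [P T_i P] are close to [T_i] and their matrices on [P H], the
   image of [T] under a UCP map, have a normal dilation [N] with joint spectrum in
   [K]. A finite positive partition of the identity subordinate to the [N_i], obtained
   from the operator-valued binomial law (as in Bernstein's theorem) after Fuglede's
   theorem, replaces the spectral measure of [N]; compressed to [P H] it splits [P] into
   rank one operators [g_l g_l^*] with [T_i] close to [sum_l mu_l,i g_l g_l^*] and
   [mu_l] in [K]. Write [1 = (1 - delta) + delta] with [1 - delta = 1 / (1 + eps)]. The
   first weight carries the diagonal operators [(1 + eps) mu_l] on the coordinates
   [<., g_l>], which are [B]. The second is shared by copies of [H] on which [A]
   consists of the rescaled real and imaginary parts of the compact error, each part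
   on its own copy, so that [A] is commuting and normal although the parts need not
   commute. On [H] minus [P H] the dilation uses [0], as part of [A]. *)

From HB Require Import structures.
Require Import Defs.
From mathcomp Require Import all_boot all_order all_algebra sesquilinear.
From mathcomp Require Import complex ring lra.
From mathcomp Require Import all_classical all_reals all_analysis.

Set Implicit Arguments.
Unset Strict Implicit.
Unset Printing Implicit Defensive.

Import Order.TTheory GRing.Theory Num.Theory.
Import numFieldNormedType.Exports.

Local Open Scope classical_set_scope.
Local Open Scope ring_scope.
Local Open Scope complex_scope.

(** * Norms, linear maps and inner products *)

(** The inclusion of the joint spectrum in [K] enters by contraposition. If unit vectors are
    approximate joint eigenvectors for a point [l], limits of eigenvalues define a character, so [l]
    is in [K]. Hence at a point off [K] the operator sum_j (A_j - th_j)^2 is bounded below by a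
    positive constant. The binomial law has variance at most 1/p in each coordinate, so its cells
    away from [K] have total mass O(1/p) and may be sent to any point of [K]. Fuglede's theorem is
    needed because the operators of the law are products: these are positive only if the real and
    imaginary parts of different [N_i] commute, while a normal tuple is only given to have commuting
    entries. Each copy of [H] in the small part sees the error through the weight delta / (2d + 1),
    so each part of the error has to be multiplied by the inverse of that weight. This is why the
    approximation of [T] must be finer than [eps] by a factor of order delta / (2d + 1); the factor
    1 + eps on [K] is what pays for a positive delta. *)

Section RealNorm.
Context {R : realType}.
Local Notation C := R[i].

Lemma RCD (x y : R) : (x + y)%:C = x%:C + y%:C. Proof. exact: rmorphD. Qed.
Lemma RCN (x : R) : (- x)%:C = - x%:C. Proof. exact: rmorphN. Qed.
Lemma RCB (x y : R) : (x - y)%:C = x%:C - y%:C. Proof. exact: rmorphB. Qed.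
Lemma RCM (x y : R) : (x * y)%:C = x%:C * y%:C. Proof. exact: rmorphM. Qed.
Lemma RCX (x : R) n : (x ^+ n)%:C = x%:C ^+ n. Proof. exact: rmorphXn. Qed.
Lemma RCV (x : R) : (x^-1)%:C = x%:C^-1. Proof. exact: fmorphV. Qed.
Lemma RC_sum (I : Type) (r : seq I) (P : pred I) (F : I -> R) :
  (\sum_(i <- r | P i) F i)%:C = \sum_(i <- r | P i) (F i)%:C.
Proof. exact: rmorph_sum. Qed.

Lemma conjM (a b : C) : conjc (a * b) = conjc a * conjc b. Proof. exact: rmorphM. Qed.
Lemma conjD (a b : C) : conjc (a + b) = conjc a + conjc b. Proof. exact: rmorphD. Qed.
Lemma conjN (a : C) : conjc (- a) = - conjc a. Proof. exact: rmorphN. Qed.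
Lemma conjB (a b : C) : conjc (a - b) = conjc a - conjc b. Proof. exact: rmorphB. Qed.
Lemma conj_sum (I : Type) (r : seq I) (P : pred I) (F : I -> C) :
  conjc (\sum_(i <- r | P i) F i) = \sum_(i <- r | P i) conjc (F i).
Proof. exact: rmorph_sum. Qed.

Lemma ReD (a b : C) : complex.Re (a + b) = complex.Re a + complex.Re b.
Proof. by case: a; case: b. Qed.
Lemma ReN (a : C) : complex.Re (- a) = - complex.Re a.
Proof. by case: a. Qed.
Lemma ReB (a b : C) : complex.Re (a - b) = complex.Re a - complex.Re b.
Proof. by case: a; case: b. Qed.
Lemma Re_RC (x : R) : complex.Re x%:C = x. Proof. by []. Qed.
Lemma ReRM (x : R) (a : C) : complex.Re (x%:C * a) = x * complex.Re a.
Proof. by case: a => u v /=; rewrite mul0r subr0. Qed.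
Lemma Re_sum (I : Type) (r : seq I) (P : pred I) (F : I -> C) :
  complex.Re (\sum_(i <- r | P i) F i) = \sum_(i <- r | P i) complex.Re (F i).
Proof. by elim/big_rec2: _ => //= i x y _ <-; rewrite ReD. Qed.
Lemma Re_real (a : C) : conjc a = a -> a = (complex.Re a)%:C.
Proof.
case: a => x y [] /eqP; rewrite -subr_eq0 -opprD oppr_eq0 => /eqP h.
by congr (_ +i* _); lra.
Qed.

(** The norms here take values in [R[i]]; their real part loses nothing ([nmE]) and brings estimates
    into the ordered field [R]. *)
Definition nm (V : normedZmodType C) (x : V) : R := complex.Re `|x|.

Lemma nmE (V : normedZmodType C) (x : V) : `|x| = (nm x)%:C.
Proof. by rewrite /nm RRe_real// ger0_real. Qed.

Lemma nm_ge0 (V : normedZmodType C) (x : V) : 0 <= nm x.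
Proof. by rewrite -ler0c -nmE. Qed.

Lemma nm0 (V : normedZmodType C) : nm (0 : V) = 0.
Proof. by rewrite /nm normr0. Qed.

Lemma nmN (V : normedZmodType C) (x : V) : nm (- x) = nm x.
Proof. by rewrite /nm normrN. Qed.

Lemma nm_distC (V : normedZmodType C) (x y : V) : nm (x - y) = nm (y - x).
Proof. by rewrite -nmN opprB. Qed.

Lemma nm_triangle (V : normedZmodType C) (x y : V) : nm (x + y) <= nm x + nm y.
Proof. by rewrite -lecR rmorphD /= -!nmE ler_normD. Qed.

Lemma nm_triangleB (V : normedZmodType C) (x y : V) : nm (x - y) <= nm x + nm y.
Proof. by rewrite -(nmN y) nm_triangle. Qed.

Lemma nm_dist (V : normedZmodType C) (z x y : V) :
  nm (x - y) <= nm (x - z) + nm (z - y).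
Proof. by rewrite (_ : x - y = (x - z) + (z - y)) ?nm_triangle// addrA subrK. Qed.

Lemma nm_eq0 (V : normedZmodType C) (x : V) : nm x = 0 -> x = 0.
Proof. by move=> h; apply/normr0_eq0; rewrite nmE h. Qed.

Lemma nm_gt0 (V : normedZmodType C) (x : V) : x != 0 -> 0 < nm x.
Proof.
by move=> x0; rewrite lt_neqAle nm_ge0 andbT eq_sym; apply: contra_neq x0; exact: nm_eq0.
Qed.

Lemma nm_sum (V : normedZmodType C) (I : Type) (r : seq I) (P : pred I) (F : I -> V) :
  nm (\sum_(i <- r | P i) F i) <= \sum_(i <- r | P i) nm (F i).
Proof.
elim/big_ind2 : _ => //; first by rewrite nm0.
by move=> x a y b ha hb; rewrite (le_trans (nm_triangle _ _))// lerD.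
Qed.

Lemma nmZ (V : normedModType C) (a : C) (x : V) : nm (a *: x) = nm a * nm x.
Proof. by apply/complexI; rewrite rmorphM /= -!nmE normrZ. Qed.

Lemma nmM (a b : C) : nm (a * b) = nm a * nm b.
Proof. by apply/complexI; rewrite rmorphM /= -!nmE normrM. Qed.

Lemma nmX (a : C) n : nm (a ^+ n) = nm a ^+ n.
Proof. by apply/complexI; rewrite rmorphXn /= -!nmE normrX. Qed.

Lemma nmV (a : C) : nm a^-1 = (nm a)^-1.
Proof. by apply/complexI; rewrite fmorphV -!nmE normfV. Qed.

Lemma nmC (x : R) : nm (x%:C) = `|x|.
Proof. by rewrite /nm normc_def /= expr0n addr0 sqrtr_sqr. Qed.

Lemma nm_conj (a : C) : nm (conjc a) = nm a.
Proof. by rewrite /nm normcJ. Qed.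

Lemma RC_nat n : (n%:R : R)%:C = n%:R. Proof. exact: rmorph_nat. Qed.

Lemma nm_nat n : nm (n%:R : C) = n%:R.
Proof. by rewrite -RC_nat nmC ger0_norm. Qed.

Lemma nm1 : nm (1 : C) = 1.
Proof. by rewrite /nm normr1. Qed.

Lemma nmi : nm ('i : C) = 1.
Proof. by rewrite /nm normc_def /= expr0n expr1n add0r sqrtr1. Qed.

Lemma ge0_nm (x : C) : 0 <= x -> x = (nm x)%:C.
Proof. by move=> x0; rewrite -nmE ger0_norm. Qed.

Lemma Re_nm (a : C) : complex.Re a <= nm a.
Proof.
rewrite -lecR -nmE (le_trans _ (normc_ge_Re a))// lecR; exact: ler_norm.
Qed.

Lemma nm_sqr (a : C) : (nm a ^+ 2)%:C = a * conjc a.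
Proof. by rewrite rmorphXn /= -nmE sqr_normc. Qed.

Lemma nm_le_ReIm (a : C) : nm a <= `|complex.Re a| + `|complex.Im a|.
Proof.
rewrite {1}(complexE a) (le_trans (nm_triangle _ _))// nmM nmi mul1r !nmC//.
Qed.

Lemma conjE (a : C) : Num.conj a = conjc a. Proof. by []. Qed.

End RealNorm.

Section LinearFunctions.
Context {K : nzRingType} {U V : lmodType K} (f : U -> V) (fl : linear f).

(** Operators are bare functions with a proof of linearity; packing [f] once transfers the lemmas on
    bundled linear maps. *)
Let g : {linear U -> V} :=
  HB.pack f (GRing.isLinear.Build K U V *:%R f fl).

Lemma linD x y : f (x + y) = f x + f y. Proof. exact: (linearD g). Qed.
Lemma linB x y : f (x - y) = f x - f y. Proof. exact: (linearB g). Qed.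
Lemma linN x : f (- x) = - f x. Proof. exact: (linearN g). Qed.
Lemma linZ a x : f (a *: x) = a *: f x. Proof. exact: (linearZZ g). Qed.
Lemma lin0 : f 0 = 0. Proof. exact: (linear0 g). Qed.
Lemma lin_sum (I : Type) (r : seq I) (P : pred I) (F : I -> U) :
  f (\sum_(i <- r | P i) F i) = \sum_(i <- r | P i) f (F i).
Proof. exact: (linear_sum g). Qed.
End LinearFunctions.

Section LinearCombinations.
Context {K : comNzRingType} {U V W : lmodType K}.

Lemma linear_compo (f : V -> W) (g : U -> V) :
  linear f -> linear g -> linear (fun x => f (g x)).
Proof. by move=> fl gl a x y; rewrite gl fl. Qed.

Lemma linear_addf (f g : U -> V) :
  linear f -> linear g -> linear (fun x => f x + g x).
Proof. by move=> fl gl a x y; rewrite fl gl scalerDr addrACA. Qed.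

Lemma linear_scalef c (f : U -> V) : linear f -> linear (fun x => c *: f x).
Proof. by move=> fl a x y; rewrite fl scalerDr !scalerA mulrC. Qed.

Lemma linear_zerof : linear (fun x : U => 0 : V).
Proof. by move=> a x y; rewrite scaler0 addr0. Qed.

Lemma linear_sumf (I : Type) (r : seq I) (P : pred I) (f : I -> U -> V) :
  (forall i, linear (f i)) -> linear (fun x => \sum_(i <- r | P i) f i x).
Proof.
move=> fl a x y; rewrite scaler_sumr -big_split /=.
by apply: eq_bigr => i _; rewrite fl.
Qed.

Lemma linear_subf (f g : U -> V) :
  linear f -> linear g -> linear (fun x => f x - g x).
Proof. by move=> fl gl a x y; rewrite fl gl scalerBr opprD addrACA. Qed.

End LinearCombinations.

Section InnerProduct.
Context {R : realType} {H : hilbertType R}.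
Local Notation C := R[i].
Implicit Types x y z : H.

Lemma ipC x y : inner x y = conjc (inner y x).
Proof. by rewrite hermC expr0 mul1r. Qed.
Lemma ipDl x y z : inner (x + y) z = inner x z + inner y z.
Proof. exact: linearDl. Qed.
Lemma ipDr x y z : inner z (x + y) = inner z x + inner z y.
Proof. exact: linearDr. Qed.
Lemma ipNl x z : inner (- x) z = - inner x z.
Proof. exact: linearNl. Qed.
Lemma ipNr x z : inner z (- x) = - inner z x.
Proof. exact: linearNr. Qed.
Lemma ipBl x y z : inner (x - y) z = inner x z - inner y z.
Proof. exact: linearBl. Qed.
Lemma ipBr x y z : inner z (x - y) = inner z x - inner z y.
Proof. exact: linearBr. Qed.
Lemma ipZl a x z : inner (a *: x) z = a * inner x z.
Proof. exact: linearZl_LR. Qed.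
Lemma ipZr a x z : inner z (a *: x) = conjc a * inner z x.
Proof. exact: (linearZr_LR (@inner R H)). Qed.
Lemma ip0l z : inner 0 z = 0.
Proof. exact: linear0l. Qed.
Lemma ip0r z : inner z 0 = 0.
Proof. exact: linear0r. Qed.
Lemma ip_suml (I : Type) (r : seq I) (P : pred I) (F : I -> H) z :
  inner (\sum_(i <- r | P i) F i) z = \sum_(i <- r | P i) inner (F i) z.
Proof. exact: linear_sumlz. Qed.
Lemma ip_sumr (I : Type) (r : seq I) (P : pred I) (F : I -> H) z :
  inner z (\sum_(i <- r | P i) F i) = \sum_(i <- r | P i) inner z (F i).
Proof. exact: linear_sumr. Qed.

Lemma ipxx x : inner x x = (nm x ^+ 2)%:C.
Proof. by rewrite inner_normE nmE rmorphXn. Qed.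

Lemma ReC x y : complex.Re (inner x y) = complex.Re (inner y x).
Proof. by rewrite ipC; case: (inner y x). Qed.

Lemma nm_sqrD x y :
  nm (x + y) ^+ 2 = nm x ^+ 2 + nm y ^+ 2 + 2 * complex.Re (inner x y).
Proof.
have : complex.Re (inner (x + y) (x + y)) = nm (x + y) ^+ 2 by rewrite ipxx.
rewrite ipDl !ipDr !ipxx /= !ReD /= (ReC y x) => <-; ring.
Qed.

Lemma nm_sqrB x y :
  nm (x - y) ^+ 2 = nm x ^+ 2 + nm y ^+ 2 - 2 * complex.Re (inner x y).
Proof. by rewrite nm_sqrD nmN ipNr ReN mulrN. Qed.

Lemma cauchy_schwarz x y : nm (inner x y) <= nm x * nm y.
Proof.
have [->|y0] := eqVneq y 0; first by rewrite ip0r !nm0 mulr0.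
have y2 : 0 < nm y ^+ 2 by rewrite exprn_gt0// nm_gt0.
(* [c *: y] is the projection of [x] on [y], where the distance to [x] is minimal. *)
set a := inner x y; pose c := a * ((nm y ^+ 2)^-1)%:C.
have := sqr_ge0 (nm (x - c *: y)).
rewrite nm_sqrB nmZ ipZr -/a.
have -> : conjc c * a = (nm a ^+ 2 / nm y ^+ 2)%:C.
  by rewrite RCM nm_sqr /c conjM conjc_real mulrAC [a * _]mulrC.
rewrite [nm c]nmM nmC gtr0_norm ?invr_gt0//=.
have -> : (nm a / nm y ^+ 2 * nm y) ^+ 2 = nm a ^+ 2 / nm y ^+ 2.
  by field; rewrite gt_eqF// nm_gt0.
move=> h; have {}h : nm a ^+ 2 / nm y ^+ 2 <= nm x ^+ 2 by lra.
move: h; rewrite ler_pdivrMr// -exprMn ler_pXn2r// nnegrE ?mulr_ge0// nm_ge0//.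
Qed.

Lemma Re_cauchy_schwarz x y : complex.Re (inner x y) <= nm x * nm y.
Proof. exact: le_trans (Re_nm _) (cauchy_schwarz _ _). Qed.

Lemma ip_inj x y : (forall z, inner x z = inner y z) -> x = y.
Proof.
move=> h; apply/eqP; rewrite -subr_eq0; apply/eqP/nm_eq0.
have := ipxx (x - y); rewrite {1}ipBl h subrr => /esym/complexI/eqP.
by rewrite sqrf_eq0 => /eqP.
Qed.

End InnerProduct.

Section BoundedMaps.
Context {R : realType}.
Local Notation C := R[i].

(** Boundedness with an explicit constant, also between different spaces; [bounded_opP] ties it to
    continuity. *)
Definition bnd (U V : normedModType C) (A : U -> V) :=
  exists2 M : R, 0 <= M & forall x, nm (A x) <= M * nm x.

Lemma bounded_opP (H : hilbertType R) (A : H -> H) :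
  bounded_op A <-> linear A /\ bnd A.
Proof.
split=> -[Al].
- move=> Ac; split=> //.
  pose f : {linear H -> H} := HB.pack A (GRing.isLinear.Build _ _ _ *:%R A Al).
  have /linear_boundedP [y [yr fr]] : bounded_near f (nbhs (0 : H)).
    by apply/linear_bounded_continuous.
  pose m := Num.max 0 (complex.Re y).
  exists (m + 1) => [|x].
    by rewrite addr_ge0// le_max lexx.
  have ylt : y < (m + 1)%:C.
    rewrite -(RRe_real yr) ltcR (le_lt_trans (_ : _ <= m))//.
      by rewrite le_max lexx orbT.
    by rewrite ltrDl.
  by have := fr _ ylt x; rewrite -lecR rmorphM /= -!nmE.
- move=> [M M0 AM]; split=> //.
  pose f : {linear H -> H} := HB.pack A (GRing.isLinear.Build _ _ _ *:%R A Al).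
  apply: (@bounded_linear_continuous _ _ _ f).
  apply/linear_boundedP; exists (M%:C); split; first by rewrite complex_real.
  move=> r Mr x; rewrite (@le_trans _ _ (M%:C * `|x|))//.
    by rewrite !nmE -rmorphM /= lecR AM.
  by rewrite ler_wpM2r// ltW.
Qed.

Lemma bnd_id (U : normedModType C) : bnd (fun x : U => x).
Proof. by exists 1 => // x; rewrite mul1r. Qed.

Lemma bnd_zero (U V : normedModType C) : bnd (fun x : U => 0 : V).
Proof. by exists 0 => // x; rewrite mul0r nm0. Qed.

Lemma bnd_comp (U V W : normedModType C) (A : V -> W) (B : U -> V) :
  bnd A -> bnd B -> bnd (fun x => A (B x)).
Proof.
move=> [M M0 hA] [N N0 hB]; exists (M * N); first exact: mulr_ge0.
by move=> x; rewrite (le_trans (hA _))// -mulrA ler_wpM2l.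
Qed.

Lemma bnd_add (U V : normedModType C) (A B : U -> V) :
  bnd A -> bnd B -> bnd (fun x => A x + B x).
Proof.
move=> [M M0 hA] [N N0 hB]; exists (M + N); first exact: addr_ge0.
by move=> x; rewrite (le_trans (nm_triangle _ _))// mulrDl lerD.
Qed.

Lemma bnd_scale (U V : normedModType C) c (A : U -> V) :
  bnd A -> bnd (fun x => c *: A x).
Proof.
move=> [M M0 hA]; exists (nm c * M); first by rewrite mulr_ge0 ?nm_ge0.
by move=> x; rewrite nmZ -mulrA ler_wpM2l ?nm_ge0.
Qed.

Lemma bnd_opp (U V : normedModType C) (A : U -> V) :
  bnd A -> bnd (fun x => - A x).
Proof. by move=> [M M0 hA]; exists M => // x; rewrite nmN. Qed.

Lemma bnd_sum (U V : normedModType C) (I : Type) (r : seq I) (P : pred I)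
  (A : I -> U -> V) : (forall i, bnd (A i)) ->
  bnd (fun x => \sum_(i <- r | P i) A i x).
Proof.
move=> h; elim: r => [|i r [M M0 IH]].
  by exists 0 => // x; rewrite big_nil nm0 mul0r.
have [N N0 hN] := h i; exists (N + M); first exact: addr_ge0.
move=> x; rewrite big_cons mulrDl; case: ifP => _.
  by rewrite (le_trans (nm_triangle _ _))// lerD.
by rewrite (le_trans (IH x))// lerDr mulr_ge0// nm_ge0.
Qed.

Lemma op_norm_le (H : hilbertType R) (A : H -> H) c :
  (forall x, nm x <= 1 -> nm (A x) <= c) -> op_norm A <= c.
Proof.
move=> h; apply: ge_sup.
  by exists (nm (A 0)); exists 0 => //=; rewrite normr0 ler01.
move=> _ [x /= x1 <-]; apply: h.
by move: x1; rewrite nmE lecR.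
Qed.

Lemma le_op_norm (H : hilbertType R) (A : H -> H) x :
  bounded_op A -> nm (A x) <= op_norm A * nm x.
Proof.
move=> /bounded_opP [Al [M M0 hM]].
have [->|x0] := eqVneq x 0; first by rewrite lin0// !nm0 mulr0.
have nx := nm_gt0 x0.
have -> : x = (nm x)%:C *: ((nm x)^-1%:C *: x).
  by rewrite scalerA -rmorphM /= divff ?gt_eqF// scale1r.
rewrite linZ// !nmZ !nmC ger0_norm ?(ltW nx)//.
rewrite [X in _ <= _ * (_ * (X * _))]gtr0_norm ?invr_gt0//.
rewrite mulVf ?gt_eqF// mulr1 mulrC ler_wpM2r ?(ltW nx)//.
apply: ub_le_sup; last first.
  exists ((nm x)^-1%:C *: x) => //=.
  by rewrite nmE nmZ nmC gtr0_norm ?invr_gt0// mulVf ?gt_eqF// lexx.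
exists M => _ [y /= y1 <-]; rewrite (le_trans (hM _))//.
by rewrite ler_piMr//; move: y1; rewrite nmE lecR.
Qed.

End BoundedMaps.

(** * Riesz representation and adjoints *)

Section Completeness.
Context {R : realType}.
Local Notation C := R[i].

Lemma complete_seq (V : completeNormedModType C) (x : nat -> V) :
  (forall e : R, 0 < e -> exists n0, forall n m, (n0 <= n)%N -> (n0 <= m)%N ->
     nm (x n - x m) <= e) ->
  exists u, forall e : R, 0 < e -> exists n0, forall n, (n0 <= n)%N ->
     nm (x n - u) <= e.
Proof.
move=> xc.
have /cauchy_cvgP /cvg_ex [u xu] : cauchy (x @ \oo).
  apply: cauchy_exP => e e0.
  have ne : 0 < nm e by apply: nm_gt0; rewrite gt_eqF.
  have [n0 hn0] := xc (nm e / 2) (divr_gt0 ne (ltr0Sn _ _)).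
  exists (x n0); exists n0 => // m /= le; rewrite -ball_normE /=.
  rewrite nmE (ge0_nm (ltW e0)) ltcR (le_lt_trans (hn0 _ _ _ _))//.
  by rewrite gtr_pMr// invf_lt1// ltr1n.
exists u => e e0; have e0' : 0 < e%:C by rewrite ltcR.
have [n0 _ h] := (cvgrPdist_le _ _).1 xu _ e0'; exists n0 => n len.
by have := h n len; rewrite /= nmE lecR nm_distC.
Qed.

Lemma small_seq (e : R) : 0 < e -> exists n0, forall n, (n0 <= n)%N ->
  n.+1%:R^-1 <= e.
Proof.
move=> e0; exists (Num.truncn e^-1) => n len.
rewrite invf_ple ?posrE// (le_trans (ltW (truncnS_gt _)))//.
by rewrite ler_nat ltnS.
Qed.

Lemma ler_eps (a b : R) : (forall e : R, 0 < e -> a <= e + b) -> a <= b.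
Proof. by move=> h; apply/ler_addgt0Pl. Qed.

Lemma arch_inv (c e : R) : 0 < e -> exists2 n : nat, (0 < n)%N & c / n%:R <= e.
Proof.
move=> e0; exists (Num.truncn (c / e)).+1 => //.
by rewrite ler_pdivrMr// mulrC -ler_pdivrMr// ltW// truncnS_gt.
Qed.

Lemma arch_exp (c e : R) : 0 < e -> 0 <= c -> exists2 n : nat, (0 < n)%N & c <= e * n%:R.
Proof.
move=> e0 c0; have [n n0 h] := arch_inv c e0; exists n => //.
by rewrite -ler_pdivrMr// ltr0n.
Qed.

End Completeness.

Section Riesz.
Context {R : realType} {H : hilbertType R}.
Local Notation C := R[i].
Implicit Types x y : H.

Section MaximizingVector.
Variables (f : H -> C) (fl : forall a x y, f (a *: x + y) = a * f x + f y).
Variables (s : R) (s0 : 0 < s) (fs : forall x, nm (f x) <= s * nm x).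
Variable fsup : forall e : R, 0 < e ->
  exists2 x : H, nm x <= 1 & s - e <= complex.Re (f x).

Let f0 : f 0 = 0.
Proof. by have := fl (-1) 0 0; rewrite scaler0 addr0 mulN1r addNr. Qed.
Let fD x y : f (x + y) = f x + f y.
Proof. by have := fl 1 x y; rewrite scale1r mul1r. Qed.
Let fZ a x : f (a *: x) = a * f x.
Proof. by have := fl a x 0; rewrite !addr0 f0 addr0. Qed.

(* Near-maximizers on the unit ball are close to each other, by the
   parallelogram law. *)
Lemma near_maximizers_close e x y : 0 < e -> e <= s -> nm x <= 1 -> nm y <= 1 ->
  s - e <= complex.Re (f x) -> s - e <= complex.Re (f y) ->
  nm (x - y) ^+ 2 <= 8 * (e / s).
Proof.
move=> e0 es x1 y1 fx fy.
have h1 : 2 * (s - e) <= s * nm (x + y).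
  rewrite (le_trans _ (fs _))// (le_trans _ (Re_nm _))// fD ReD; lra.
have h2 : 2 * (1 - e / s) <= nm (x + y).
  rewrite -(ler_pM2l s0) (le_trans _ h1)//.
  by rewrite mulrCA mulrBr mulr1 mulrCA divff ?gt_eqF// mulr1.
have es1 : e / s <= 1 by rewrite ler_pdivrMr// mul1r.
have h3 : (2 * (1 - e / s)) ^+ 2 <= nm (x + y) ^+ 2.
  by rewrite ler_pXn2r// nnegrE ?nm_ge0// mulr_ge0// subr_ge0.
have : nm (x + y) ^+ 2 + nm (x - y) ^+ 2 = 2 * nm x ^+ 2 + 2 * nm y ^+ 2.
  by rewrite nm_sqrD nm_sqrB; ring.
have x2 : nm x ^+ 2 <= 1 by rewrite expr_le1// nm_ge0.
have y2 : nm y ^+ 2 <= 1 by rewrite expr_le1// nm_ge0.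
have t2 := sqr_ge0 (e / s).
move: h3; rewrite exprMn sqrrB; nra.
Qed.

(** A maximizing sequence is Cauchy, and its limit [u] is a unit vector with [f u = s]. Minimality
    of the norm on the hyperplane [f = s] makes the kernel of [f] orthogonal to [u], so [f] is
    represented by [s u]. *)
Lemma riesz_vector : exists u : H, forall x, f x = inner x u.
Proof.
have /choice[x hx] : forall n : nat, exists x : H,
    nm x <= 1 /\ s - s / n.+1%:R <= complex.Re (f x).
  move=> n; have [|x x1 fx] := fsup (e := s / n.+1%:R); last by exists x.
  by rewrite divr_gt0.
have [u hu] : exists u, forall e : R, 0 < e -> exists n0, forall n,
    (n0 <= n)%N -> nm (x n - u) <= e.
  apply: complete_seq => e e0.
  (* The 8 cancels the constant of [near_maximizers_close]. *)
  have [n0 hn0] := @small_seq R (e ^+ 2 / 8) (divr_gt0 (exprn_gt0 _ e0) (ltr0Sn _ _)).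
  exists n0 => n m ln lm.
  have [x1 fx] := hx n; have [y1 fy] := hx m.
  have sn0 : forall k : nat, (n0 <= k)%N -> s / k.+1%:R <= s / n0.+1%:R.
    by move=> k lk; rewrite ler_pM2l// lef_pV2 ?posrE// ler_nat ltnS.
  have := @near_maximizers_close (s / n0.+1%:R) (x n) (x m).
  have -> : s / n0.+1%:R / s = n0.+1%:R^-1 :> R by rewrite mulrAC divff ?gt_eqF// mul1r.
  move=> h.
  rewrite -(@ler_pXn2r _ 2)// ?nnegrE ?nm_ge0 ?(ltW e0)//.
  rewrite (le_trans (h _ _ _ _ _ _))//.
  - by rewrite divr_gt0.
  - by rewrite ler_pdivrMr// ler_pMr// ler1n.
  - by rewrite (le_trans _ fx)// lerB// sn0.
  - by rewrite (le_trans _ fy)// lerB// sn0.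
  - by rewrite mulrC -ler_pdivlMr// hn0.
have u1 : nm u <= 1.
  apply: ler_eps => e e0; have [n0 /(_ n0 (leqnn _)) h] := hu e e0.
  rewrite -(subrK (x n0) u) (le_trans (nm_triangle _ _))// nm_distC lerD//.
  by case: (hx n0).
have fu : s <= complex.Re (f u).
  apply: ler_eps => e e0.
  have e2 : 0 < e / 2 by rewrite divr_gt0.
  have [n0 h0] := hu (e / 2 / s) (divr_gt0 e2 s0).
  have [n1 h1] := @small_seq R (e / 2 / s) (divr_gt0 e2 s0).
  pose n := maxn n0 n1; have [_ fx] := hx n.
  have -> : u = (u - x n) + x n by rewrite subrK.
  rewrite fD ReD.
  have : nm (f (x n - u)) <= e / 2.
    rewrite (le_trans (fs _))// mulrC -ler_pdivlMr//.
    by apply: h0; rewrite leq_maxl.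
  have : s / n.+1%:R <= e / 2.
    by rewrite mulrC -ler_pdivlMr// h1// leq_maxr.
  have -> : f (u - x n) = - f (x n - u) by rewrite -(opprB (x n) u) -scaleN1r fZ mulN1r.
  have := Re_nm (f (x n - u)); rewrite ReN => k1 k2 k3.
  have k4 := le_trans k1 k3; set t := s / _ in fx k2; lra.
have u_eq1 : nm u = 1.
  apply/eqP; rewrite eq_le u1 /=.
  by rewrite -(ler_pM2l s0) mulr1 (le_trans fu)// (le_trans (Re_nm _)).
(* The modulus is at most [s] and the real part equals [s], which leaves no room for an imaginary
   part. *)
have fus : f u = s%:C.
  have nf : nm (f u) <= s by rewrite (le_trans (fs _))// u_eq1 mulr1.
  have rs : complex.Re (f u) = s.
    by apply/eqP; rewrite eq_le fu andbT (le_trans (Re_nm _)).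
  have : (nm (f u) ^+ 2)%:C = ((complex.Re (f u)) ^+ 2 + (complex.Im (f u)) ^+ 2)%:C.
    by rewrite RCX -nmE -add_Re2_Im2.
  move=> /complexI; rewrite rs => h.
  have : nm (f u) ^+ 2 <= s ^+ 2 by rewrite ler_pXn2r// nnegrE ?nm_ge0 ?ltW.
  rewrite h gerDl => h2.
  have /eqP : complex.Im (f u) ^+ 2 = 0 by apply/eqP; rewrite eq_le h2 sqr_ge0.
  rewrite sqrf_eq0 => /eqP im0.
  by rewrite (complexE (f u)) rs im0 mulr0 addr0.
(* Removing from [u] its component along [w] does not change [f], so the norm cannot drop below
   1. *)
have ker_orth w : f w = 0 -> inner w u = 0.
  move=> fw; have [->|w0] := eqVneq w 0; first by rewrite ip0l.
  have w2 : 0 < nm w ^+ 2 by rewrite exprn_gt0// nm_gt0.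
  pose a := inner u w; pose c := a * ((nm w ^+ 2)^-1)%:C.
  have h1 : 1 <= nm (u - c *: w).
    rewrite -(ler_pM2l s0) mulr1 (le_trans _ (fs _))// (le_trans _ (Re_nm _))//.
    by rewrite fD -scaleNr fZ fw mulr0 addr0 fus.
  have : 1 <= nm (u - c *: w) ^+ 2 by rewrite expr_ge1// nm_ge0.
  rewrite nm_sqrB nmZ ipZr -/a u_eq1.
  have -> : conjc c * a = (nm a ^+ 2 / nm w ^+ 2)%:C.
    by rewrite RCM nm_sqr /c conjM conjc_real mulrAC [a * _]mulrC.
  rewrite [nm c]nmM nmC gtr0_norm ?invr_gt0//=.
  have -> : (nm a / nm w ^+ 2 * nm w) ^+ 2 = nm a ^+ 2 / nm w ^+ 2.
    by field; rewrite gt_eqF// nm_gt0.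
  move=> h; have {}h : nm a ^+ 2 / nm w ^+ 2 <= 0 by lra.
  move: h; rewrite pmulr_lle0 ?invr_gt0// => h.
  have /eqP : nm a ^+ 2 = 0 by apply/eqP; rewrite eq_le h sqr_ge0.
  by rewrite sqrf_eq0 => /eqP/nm_eq0 a0; rewrite ipC -/a a0 conjc0.
exists (s%:C *: u) => {hx hu}x.
have sC0 : s%:C != 0 by rewrite gt_eqF// ltcR.
have : inner (x - (f x / s%:C) *: u) u = 0.
  by apply: ker_orth; rewrite fD -scaleNr fZ fus mulNr divfK// subrr.
rewrite ipBl ipZl ipxx u_eq1 expr1n mulr1 => /eqP; rewrite subr_eq0 => /eqP h.
by rewrite ipZr conjc_real h mulrC divfK.
Qed.
End MaximizingVector.

Lemma riesz (f : H -> C) : (forall a x y, f (a *: x + y) = a * f x + f y) ->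
  (exists M, forall x, nm (f x) <= M * nm x) ->
  exists u : H, forall x, f x = inner x u.
Proof.
move=> fl [M hM].
have f0 : f 0 = 0 by have := fl (-1) 0 0; rewrite scaler0 addr0 mulN1r addNr.
have fZ a x : f (a *: x) = a * f x.
  by have := fl a x 0; rewrite !addr0 f0 addr0.
(* The zero functional is set apart because the maximizing argument divides by [s]. *)
have [/existsNP[x0 /eqP fx0]|/contrapT h0] := pselect (~ forall x, f x = 0); last first.
  by exists 0 => x; rewrite h0 ip0r.
have x00 : x0 != 0 by apply: contra_neq fx0 => ->.
pose E := [set nm (f x) | x in [set x : H | nm x <= 1]].
have Eub y : nm y <= 1 -> nm (f y) <= `|M|.
  move=> y1; rewrite (le_trans (hM _))// (@le_trans _ _ (`|M| * nm y))//.
    by rewrite ler_wpM2r ?nm_ge0 ?ler_norm.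
  by rewrite ler_piMr.
have hsup : has_sup E.
  split; first by exists (nm (f 0)), 0 => //=; rewrite nm0.
  by exists `|M| => _ [y /= y1 <-]; exact: Eub.
pose s := sup E.
have Es y : nm y <= 1 -> nm (f y) <= s.
  by move=> y1; apply: ub_le_sup; [case: hsup|exists y].
have unit y : y != 0 -> nm ((nm y)^-1%:C *: y) = 1.
  by move=> y0; rewrite nmZ nmC gtr0_norm ?invr_gt0 ?nm_gt0// mulVf// gt_eqF// nm_gt0.
have s0 : 0 < s.
  rewrite (lt_le_trans _ (Es ((nm x0)^-1%:C *: x0) _)) ?unit//.
  by rewrite fZ nmM nmC mulr_gt0 ?normr_gt0 ?invr_eq0 ?gt_eqF ?nm_gt0.
apply: (riesz_vector fl s0) => [x|e e0].
  have [->|x1] := eqVneq x 0; first by rewrite f0 !nm0 mulr0.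
  rewrite -ler_pdivrMr ?nm_gt0//.
  have /Es : nm ((nm x)^-1%:C *: x) <= 1 by rewrite unit.
  by rewrite fZ nmM nmC gtr0_norm ?invr_gt0 ?nm_gt0// mulrC.
have [_ [y /= y1 <-] ys] := sup_adherent e0 hsup.
have [fy0|fy0] := eqVneq (f y) 0.
  by exists 0; rewrite ?nm0// f0; move: ys; rewrite fy0 nm0 -/s /=; lra.
(* A unimodular factor that turns [f y] into its modulus, so that the real part of [f] comes close
   to [s]. *)
pose w := conjc (f y) / (nm (f y))%:C.
have nw : nm w = 1.
  by rewrite /w nmM nm_conj nmV nmC ger0_norm ?nm_ge0// divff// gt_eqF// nm_gt0.
exists (w *: y); first by rewrite nmZ nw mul1r.
rewrite fZ /w mulrAC [conjc _ * _]mulrC -nm_sqr.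
by rewrite expr2 RCM mulfK ?gt_eqF ?ltcR ?nm_gt0//= ltW.
Qed.

Lemma op_adjoint_sym (A B : H -> H) : op_adjoint A B -> op_adjoint B A.
Proof. by move=> h x y; rewrite ipC -h -ipC. Qed.

Lemma op_adjoint_uniq (A B B' : H -> H) : op_adjoint A B -> op_adjoint A B' -> B = B'.
Proof.
move=> h h'; apply/funext => y; apply: ip_inj => z.
by rewrite ipC -h h' -ipC.
Qed.

Lemma op_adjoint_linear (A B : H -> H) : op_adjoint A B -> linear B.
Proof.
move=> h a x y; apply: ip_inj => z; rewrite ipC -h ipDl ipZl.
by rewrite ipDr conjD ipZr conjM conjcK !h -!ipC.
Qed.

(** From |B x|^2 = <A (B x), x>. The constant is kept, so estimates pass from an operator to its
    adjoint unchanged. *)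
Lemma op_adjoint_bound (A B : H -> H) M : 0 <= M -> (forall x, nm (A x) <= M * nm x) ->
  op_adjoint A B -> forall x, nm (B x) <= M * nm x.
Proof.
move=> M0 hA h x; have [->|bx] := eqVneq (B x) 0.
  by rewrite nm0 mulr_ge0// nm_ge0.
rewrite -(ler_pM2r (nm_gt0 bx)) -expr2.
have : (nm (B x) ^+ 2)%:C = inner (A (B x)) x by rewrite h ipxx.
move=> /(congr1 (@complex.Re R)) /= ->.
rewrite (le_trans (Re_cauchy_schwarz _ _))// mulrAC ler_wpM2r ?nm_ge0//.
Qed.

Lemma op_adjoint_bounded (A B : H -> H) : bounded_op A -> op_adjoint A B -> bounded_op B.
Proof.
move=> /bounded_opP[Al [M M0 AM]] h; apply/bounded_opP; split.
  exact: op_adjoint_linear h.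
by exists M => //; exact: op_adjoint_bound h.
Qed.

Lemma adjoint_exists (A : H -> H) : bounded_op A -> exists B, op_adjoint A B.
Proof.
move=> /bounded_opP[Al [M M0 AM]].
have /choice[B hB] : forall y, exists u, forall x, inner (A x) y = inner x u.
  move=> y; apply: riesz => [a x z|].
    by rewrite Al ipDl ipZl.
  exists (M * nm y) => x.
  by rewrite (le_trans (cauchy_schwarz _ _))// mulrAC ler_wpM2r ?nm_ge0.
by exists B => x y; exact: hB.
Qed.

End Riesz.

(** * Positive operators *)

Section Positive.
Context {R : realType} {H : hilbertType R}.
Local Notation C := R[i].
Implicit Types (x y : H) (A B : H -> H).

(** Boundedness is kept apart in [bnd]: the operators of a partition of the identity are estimated
    only through their quadratic forms. *)
Definition psd A :=
  [/\ linear A, op_adjoint A A & forall x, 0 <= complex.Re (inner (A x) x)].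

Lemma psd_id : psd (fun x => x).
Proof. by split=> // x; rewrite ipxx /= sqr_ge0. Qed.

Section IteratedDefect.
Variables (A : H -> H) (pA : psd A).
Hypothesis A1 : forall x, complex.Re (inner (A x) x) <= nm x ^+ 2.

Fixpoint defect n : H -> H :=
  if n is m.+1 then fun x => defect m x - defect m (defect m x) else A.

Lemma defect_psd n : psd (defect n) /\
  forall x, complex.Re (inner (defect n x) x) <= nm x ^+ 2.
Proof.
elim: n => [//|n [[Sl Ss S0] S1]] /=.
set S := defect n in Sl Ss S0 S1 *.
have SS x : inner (S (S x)) x = (nm (S x) ^+ 2)%:C by rewrite Ss ipxx.
(* The identity S - S^2 = (1 - S) S (1 - S) + S (1 - S) S, with both terms positive. *)
have key x : nm (S x) ^+ 2 <= complex.Re (inner (S x) x).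
  have := S0 (x - S x); have := S1 (S x).
  rewrite (linB Sl) ipBl !ipBr ipxx SS.
  by rewrite !ReB Re_RC; lra.
split; first split.
- exact: linear_subf Sl (linear_compo Sl Sl).
- by move=> x y; rewrite ipBl ipBr !Ss.
- by move=> x; rewrite ipBl ReB SS /= subr_ge0.
- move=> x; rewrite ipBl ReB SS /= (le_trans _ (S1 x))//.
  by rewrite gerBl sqr_ge0.
Qed.

Lemma defect_sum n x :
  A x = defect n x + \sum_(k < n) defect k (defect k x).
Proof.
elim: n => [|n IH]; first by rewrite big_ord0 addr0.
by rewrite big_ord_recr /= IH [_ + defect n (defect n x)]addrC addrA subrK.
Qed.

Lemma defect_commute B n : linear B -> (forall x, A (B x) = B (A x)) ->
  forall x, defect n (B x) = B (defect n x).
Proof.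
move=> Bl AB; elim: n => [//|n IH] x /=.
by rewrite (linB Bl) !IH.
Qed.

(** By [defect_sum], the sum of the |A_k x|^2 is at most <A x, x>, hence at most |x|^2, so its terms
    cannot all exceed e^2. *)
Lemma defect_small x (e : R) : 0 < e -> exists n, nm (defect n x) <= e.
Proof.
move=> e0; apply: contrapT => /forallNP h.
have [n n0 hn] := @arch_exp R (nm x ^+ 2 + 1) (e ^+ 2) (exprn_gt0 2 e0)
  (addr_ge0 (sqr_ge0 _) ler01).
have h1 : complex.Re (inner (A x) x) = complex.Re (inner (defect n x) x)
    + \sum_(k < n) nm (defect k x) ^+ 2.
  rewrite {1}(defect_sum n x) ipDl ReD ip_suml Re_sum; congr (_ + _).
  apply: eq_bigr => k _; have [[_ ks _] _] := defect_psd k.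
  by rewrite ks ipxx.
have h2 : e ^+ 2 * n%:R <= \sum_(k < n) nm (defect k x) ^+ 2.
  rewrite -{1}(card_ord n) mulr_natr -sumr_const ler_sum// => k _.
  rewrite ler_pXn2r// ?nnegrE ?nm_ge0 ?(ltW e0)//.
  by apply/ltW; rewrite ltNge; apply/negP/h.
have [[_ _ h3] _] := defect_psd n.
have := A1 x; have := h3 x; rewrite h1; lra.
Qed.

End IteratedDefect.

Lemma psd_scale A (t : R) : 0 <= t -> psd A -> psd (fun x => t%:C *: A x).
Proof.
move=> t0 [Al As A0]; split; first exact: linear_scalef.
- by move=> x y; rewrite ipZl ipZr conjc_real As.
- by move=> x; rewrite ipZl ReRM mulr_ge0.
Qed.

(* F. Riesz: with [A_0 = A <= 1] and [A_(n+1) = A_n - A_n^2], the product [A B]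
   is the sum of the positive operators [A_n B A_n]. *)
Lemma psd_mul A B : psd A -> bnd A -> psd B -> (forall x, A (B x) = B (A x)) ->
  psd (fun x => A (B x)).
Proof.
move=> pA [M M0 AM] pB AB.
have [Al As A0] := pA; have [Bl Bs B0] := pB.
split; first exact: linear_compo.
  by move=> x y; rewrite As Bs AB.
move=> x.
(* Scaling by [t] makes the operator at most 1; M + 1 is invertible also when M = 0. *)
pose t := (M + 1)^-1; have t0 : 0 < t by rewrite invr_gt0 ltr_wpDl.
pose A' y := t%:C *: A y.
have pA' : psd A' by apply: psd_scale => //; exact: ltW.
have A'1 y : complex.Re (inner (A' y) y) <= nm y ^+ 2.
  rewrite ipZl ReRM ler_pdivrMl ?ltr_wpDl// (le_trans (Re_cauchy_schwarz _ _))//.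
  by rewrite expr2 mulrA ler_wpM2r ?nm_ge0// (le_trans (AM y))// ler_wpM2r ?nm_ge0// lerDl.
have A'B y : A' (B y) = B (A' y) by rewrite /A' AB (linZ Bl).
suff : 0 <= complex.Re (inner (A' (B x)) x).
  by rewrite ipZl ReRM pmulr_rge0.
apply: ler_eps => e e0; 
have e1 : 0 < e / (nm (B x) + 1) by rewrite divr_gt0// ltr_wpDl// nm_ge0.
have [n hn] := defect_small pA' A'1 x e1.
(* The remainder [defect n x] is paired with [B x], so its smallness at the single vector [x]
   suffices. *)
rewrite (defect_sum A' n) ipDl ip_suml ReD Re_sum addrA addr_ge0//.
  have [[_ ns _] _] := defect_psd pA' A'1 n.
  rewrite ns; have := Re_cauchy_schwarz (- B x) (defect A' n x).
  rewrite nmN ipNl ReN => h.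
  have : nm (B x) * nm (defect A' n x) <= e.
    rewrite (le_trans (ler_wpM2l (nm_ge0 _) hn))// mulrA ler_pdivrMr ?ltr_wpDl ?nm_ge0//.
    by rewrite mulrC ler_pM2l// lerDl.
  lra.
apply: sumr_ge0 => k _; have [[_ ks _] _] := defect_psd pA' A'1 k.
by rewrite ks (defect_commute k Bl A'B) B0.
Qed.

(** The arithmetic mean in place of the geometric one is additive in [B], as needed to sum over a
    partition. *)
Lemma psd_cs B x y : psd B ->
  nm (inner (B x) y) <= (complex.Re (inner (B x) x) + complex.Re (inner (B y) y)) / 2.
Proof.
move=> [Bl Bs B0]; set a := inner (B x) y.
have [a0|a0] := eqVneq a 0.
  by rewrite a0 nm0 divr_ge0// addr_ge0.
have na := nm_gt0 a0.
(* The phase of [a]: at [x - c *: y] both cross terms of the form become minus the modulus of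
   [a]. *)
pose c := a / (nm a)%:C.
have := B0 (x - c *: y).
have -> : inner (B (x - c *: y)) (x - c *: y) = inner (B x) x + inner (B y) y
   - (nm a)%:C - (nm a)%:C.
  have na0 : (nm a)%:C != 0 by rewrite gt_eqF// ltcR.
  have e1 : conjc c * a = (nm a)%:C.
    rewrite /c -RCV conjM conjc_real mulrAC [conjc a * _]mulrC -nm_sqr expr2 RCM RCV mulfK//.
  have e2 : c * conjc c = 1.
    by rewrite -nm_sqr /c nmM nmV nmC ger0_norm ?nm_ge0// divff ?gt_eqF// expr1n.
  rewrite (linB Bl) (linZ Bl) ipBl !ipBr !ipZl !ipZr -/a (Bs y x).
  rewrite [inner y (B x)]ipC -/a.
  have -> : c * (conjc c * inner (B y) y) = inner (B y) y by rewrite mulrA e2 mul1r.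
  have -> : c * conjc a = (nm a)%:C by rewrite -(conjcK c) -conjM e1 conjc_real.
  rewrite e1; ring.
rewrite !ReB ReD /= => h; rewrite ler_pdivlMr//; lra.
Qed.

(** In [psd_cs] at [n x] and [y] the left side grows like [n] while the right side stays fixed. *)
Lemma psd_null B x : psd B -> complex.Re (inner (B x) x) = 0 ->
  forall y, inner (B x) y = 0.
Proof.
move=> pB h y; apply: nm_eq0; apply/eqP; rewrite eq_le nm_ge0 andbT.
apply: ler_eps => e e0; rewrite addr0.
pose k := complex.Re (inner (B y) y); have k0 : 0 <= k by have [_ _] := pB; exact.
have [n n0 hn] := arch_inv k e0.
have nn : 0 < n%:R :> R by rewrite ltr0n.
have [Bl _ _] := pB.
have := psd_cs (n%:R%:C *: x) y pB.
rewrite (linZ Bl) !ipZl ipZr mulrCA mulrA -!/(_ * _ * _) nmM nmC ger0_norm ?ler0n//.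
rewrite conjc_real -mulrA !ReRM h !mulr0 add0r -/k => h2.
rewrite -(ler_pM2l nn) (le_trans h2)//.
move: hn; rewrite ler_pdivrMr// => hn; lra.
Qed.

End Positive.

(** * Fuglede's theorem *)

Section FirstCoefficient.
Context {R : realType}.
Local Notation C := R[i].

Lemma root_minus_one k : exists2 w : C, w ^+ (2 ^ k) = -1 & nm w = 1.
Proof.
have k0 : (0 < 2 ^ k)%N by rewrite expn_gt0.
have [w hw] := @solve_monicpoly C (2 ^ k)%N (fun i => if i == 0%N then -1 else 0) k0.
have {}hw : w ^+ (2 ^ k) = -1.
  rewrite hw; case: (2 ^ k)%N k0 => // m _.
  rewrite big_ord_recl /= expr0 mulr1 big1 ?addr0// => i _.
  by rewrite mul0r.
exists w => //; have : nm w ^+ (2 ^ k) = 1 by rewrite -nmX hw nmN nm1.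
by move=> /eqP; rewrite pexpr_eq1 ?nm_ge0// => /eqP.
Qed.

(* Averaging over the 2^k-th roots of unity isolates the coefficients of index
   congruent to 1. *)
Lemma coef1_bound (p : {poly C}) (r c : R) : 0 <= r ->
  (forall z, nm z = r -> nm p.[z] <= c) -> nm p`_1 * r <= c.
Proof.
move=> r0 pc.
(* Each step averages q(z) with w^-1 q(w z), where w^(2^k) = -1. This doubles the modulus of the
   surviving class of indices and preserves the bound on the circle, because [w] is unimodular. *)
have [q qc qE] : exists2 q : {poly C}, (forall z, nm z = r -> nm q.[z] <= c) &
    forall j, q`_j = if (j == 1 %[mod 2 ^ size p])%N then p`_j else 0.
  elim: (size p) => [|k [q qc qE]].
    by exists p => // j; rewrite expn0 !modn1.
  have [w wk nw] := root_minus_one k.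
  have w0 : w != 0 by apply: contra_eq_neq nw => ->; rewrite nm0 eq_sym oner_neq0.
  pose q1 := \poly_(j < size q) (q`_j * w ^+ j).
  have q1E z : q1.[z] = q.[w * z].
    rewrite horner_poly horner_coef; apply: eq_bigr => i _.
    by rewrite exprMn mulrA.
  exists (2^-1 *: (q + w^-1 *: q1)).
    move=> z zr; rewrite hornerZ hornerD hornerZ q1E nmM nmV.
    rewrite nm_nat.
    rewrite mulrC ler_pdivrMr// (le_trans (nm_triangle _ _))// mulr_natr mulr2n lerD ?qc//.
    by rewrite nmM nmV nw invr1 mul1r qc// nmM nw mul1r.
  move=> j; rewrite coefZ coefD coefZ coef_poly.
  have -> : (if (j < size q)%N then q`_j * w ^+ j else 0) = q`_j * w ^+ j.
    by case: ltnP => // h; rewrite nth_default// mul0r.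
  rewrite !qE.
  have k0 : (0 < 2 ^ k)%N by rewrite expn_gt0.
  case: ifPn => [j1|j1]; last first.
    rewrite mul0r mulr0 addr0 mulr0 ifF//; apply/negP => /eqP h.
    move/eqP: j1; apply.
    have d : (2 ^ k %| 2 ^ k.+1)%N by rewrite dvdn_exp2l.
    by rewrite -(modn_dvdm j d) h modn_dvdm.
  (* Adding 2^k avoids a truncated subtraction: for k = 0 the index j = 0 is allowed. The index
     survives exactly when [m] is odd. *)
  have [m jm] : exists m, (j + 2 ^ k = 1 + m * 2 ^ k)%N.
    have : (2 ^ k %| (j + 2 ^ k) - 1)%N.
      rewrite -eqn_mod_dvd ?modnDr// ?(leq_trans k0 (leq_addl _ _))//.
    move=> /dvdnP[m hm]; exists m; rewrite -hm subnKC//.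
    by rewrite (leq_trans k0)// leq_addl.
  have wj : w^-1 * w ^+ j = - (-1) ^+ m.
    apply: (mulfI w0); rewrite mulrA divff// mul1r.
    have : w ^+ j * w ^+ (2 ^ k) = w * (w ^+ (2 ^ k)) ^+ m.
      by rewrite -exprD jm exprD expr1 mulnC exprM.
    by rewrite wk mulrN1 => /eqP; rewrite eqr_oppLR => /eqP ->; rewrite mulrN.
  rewrite [_^-1 * (_ * _)]mulrCA wj mulrN -{1}[p`_j]mulr1 -mulrBr mulrCA.
  have [n mE] : exists n, (m = n.*2.+1 \/ m = n.*2)%N.
    exists m./2; rewrite -{1 3}(odd_double_half m); case: odd; [left|right] => //.
  have e : (2 ^ k.+1 = 2 * 2 ^ k)%N by rewrite expnS.
  case: mE => mE.
    rewrite mE exprS mulN1r opprK -mul2n exprM sqrrN !expr1n -mulr2n mulVf ?pnatr_eq0// mulr1.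
    rewrite ifT// (_ : j = (1 + n * 2 ^ k.+1)%N) ?modnMDl ?[(1 + _)%N]addnC ?modnMDl//.
    by apply: (@addIn (2 ^ k)%N); rewrite jm mE e -mul2n mulSn; ring.
  rewrite mE -mul2n exprM sqrrN expr1n expr1n subrr mulr0 mulr0 ifF//.
  apply/negP => /eqP /esym h.
  have : (j + 2 ^ k = 1 %[mod 2 ^ k.+1])%N.
    rewrite jm mE -mul2n mulnAC -e addnC mulnC modnMDl //.
  rewrite -modnDml -h modnDml => /eqP.
  rewrite -{2}[1%N]addn0 eqn_modDl mod0n modn_small ?expn_gt0//; last first.
    by rewrite ltn_exp2l.
  by rewrite expn_eq0.
(* After [size p] steps the modulus exceeds every index, so 1 is alone in its class. *)
have size2 : (size p < 2 ^ size p)%N by exact: ltn_expl.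
have [p1|p1] := leqP (size p) 1.
  rewrite nth_default// nm0 mul0r (le_trans (nm_ge0 p.[r%:C]))// pc// nmC ger0_norm//.
have qX : q = p`_1 *: 'X.
  apply/polyP => j; rewrite coefZ coefX qE.
  have [->|j1] := eqVneq j 1%N; first by rewrite eqxx mulr1.
  rewrite mulr0; case: ifPn => // /eqP.
  have [jp|jp] := leqP (size p) j; first by rewrite nth_default.
  by rewrite !modn_small ?(ltn_trans _ size2)// => /eqP; rewrite (negPf j1).
have := qc r%:C; rewrite nmC ger0_norm// qX hornerZ hornerX nmM nmC ger0_norm//.
exact.
Qed.

End FirstCoefficient.

Section Fuglede.
Context {R : realType} {H : hilbertType R}.
Local Notation C := R[i].
Implicit Types (x y : H) (N M T : H -> H) (z : C).

Definition shift M z x := x + z *: M x.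

Lemma shift_linear M z : linear M -> linear (shift M z).
Proof. by move=> Ml; apply: linear_addf => //; exact: linear_scalef. Qed.

Lemma iter_linear (A : H -> H) n : linear A -> linear (iter n A).
Proof.
by move=> Al; elim: n => [|n IH] //=; exact: (linear_compo Al IH).
Qed.

Lemma iter_bound (A : H -> H) (k : R) n x : 0 <= k -> (forall x, nm (A x) <= k * nm x) ->
  nm (iter n A x) <= k ^+ n * nm x.
Proof.
move=> k0 Ak; elim: n => [|n IH] /=; first by rewrite expr0 mul1r.
by rewrite (le_trans (Ak _))// exprS -mulrA ler_wpM2l.
Qed.

Lemma iter_comp_commute (A B : H -> H) n x : (forall x, A (B x) = B (A x)) ->
  iter n A (iter n B x) = iter n (fun x => A (B x)) x.
Proof.
move=> AB; have AnB m y : iter m A (B y) = B (iter m A y).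
  by elim: m => [//|m IH] /=; rewrite IH AB.
elim: n x => [//|n IH] x.
by rewrite /= AnB IH.
Qed.

Lemma iter_commute (A B : H -> H) n x : (forall x, A (B x) = B (A x)) ->
  A (iter n B x) = iter n B (A x).
Proof. by move=> AB; elim: n => [//|n IH] /=; rewrite AB IH. Qed.

Section ConjugationByPowers.
Variables (N M T : H -> H).
Hypotheses (Nl : linear N) (Ml : linear M) (Tl : linear T) (NM : op_adjoint N M).
Hypothesis comNM : forall x, N (M x) = M (N x).
Hypothesis comTN : forall x, T (N x) = N (T x).
Variables (k t : R) (k0 : 0 <= k) (t0 : 0 <= t).
Hypotheses (Nk : forall x, nm (N x) <= k * nm x) (Tt : forall x, nm (T x) <= t * nm x).

Let Mk x : nm (M x) <= k * nm x.
Proof. exact: op_adjoint_bound NM x. Qed.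

(** Inner factors are peeled off onto [x] and outer ones, through the adjoint [N], onto [y], so the
    induction involves only scalar polynomials. *)
Lemma conjugation_poly (c : R) a b x y : exists p : {poly C},
  [/\ forall z, p.[z] =
        inner (iter a (shift M (z * c%:C)) (T (iter b (shift M (- (z * c%:C))) x))) y,
      p`_0 = inner (T x) y &
      p`_1 = c%:C * (a%:R * inner (M (T x)) y - b%:R * inner (T (M x)) y)].
Proof.
have MN := op_adjoint_sym NM.
elim: a y => [y|a IH y].
  elim: b x => [|b IH] x.
    exists (inner (T x) y)%:P; split; rewrite ?coefC//=.
      by move=> z; rewrite hornerC.
    by rewrite !mul0r subrr mulr0.
  have [p [pE p0 p1]] := IH x; have [q [qE q0 q1]] := IH (M x).
  exists (p - c%:C *: ('X * q)); split.
  - move=> z; rewrite hornerD hornerN hornerZ hornerM hornerX pE qE iterSr.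
    set A := iter b _; have Al : linear A by apply/iter_linear/shift_linear.
    rewrite /= /shift (linD Al) (linZ Al) (linD Tl) (linZ Tl) ipDl ipZl.
    by rewrite mulNr [z * _]mulrC mulrA.
  - by rewrite coefB coefZ coefXM mulr0 subr0.
  - rewrite coefB coefZ coefXM /= p1 q0 -mulrBr; congr (_ * _).
    by rewrite mul0r !sub0r -natr1; ring.
have [p [pE p0 p1]] := IH y; have [q [qE q0 q1]] := IH (N y).
exists (p + c%:C *: ('X * q)); split.
- move=> z; rewrite hornerD hornerZ hornerM hornerX pE qE /=.
  rewrite [in RHS]/shift ipDl ipZl MN.
  by rewrite [z * c%:C]mulrC mulrA.
- by rewrite coefD coefZ coefXM mulr0 addr0.
- rewrite coefD coefZ coefXM /= p1 q0 -mulrDr; congr (_ * _).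
  by rewrite -MN -natr1; ring.
Qed.

(** With M the adjoint of N, let X = (1 + u M) (1 - conj(u) N). Commutation gives X^* X = (1 - u^2
    M^2) (1 - conj(u)^2 N^2), without a term of first order in u: X is nearly unitary. *)
Lemma shift_prod_bound (u : C) x :
  nm (shift M u (shift N (- conjc u) x)) <= (1 + (nm u * k) ^+ 2) * nm x.
Proof.
have MN := op_adjoint_sym NM.
set rho := (nm u * k) ^+ 2; have rho0 : 0 <= rho by rewrite sqr_ge0.
have adj v a b (A B : H -> H) : op_adjoint A B -> inner (shift A v a) b = inner a (shift B (conjc v) b).
  by move=> AB; rewrite /shift ipDl ipDr ipZl ipZr AB conjcK.
have com v1 v2 (A B : H -> H) : linear A -> linear B -> (forall x, A (B x) = B (A x)) ->
    forall a, shift A v1 (shift B v2 a) = shift B v2 (shift A v1 a).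
  move=> Al Bl AB a; rewrite /shift (linD Al) (linZ Al) (linD Bl) (linZ Bl).
  rewrite !scalerDr !scalerA AB [v1 * v2]mulrC !addrA; congr (_ + _).
  by rewrite addrAC.
have sq (A : H -> H) v a : linear A -> (forall x, nm (A x) <= k * nm x) -> nm v = nm u ->
    nm (shift A v (shift A (- v) a)) <= (1 + rho) * nm a.
  move=> Al Ak nv.
  have -> : shift A v (shift A (- v) a) = a - (v * v) *: A (A a).
    rewrite /shift (linD Al) (linZ Al) scalerDr scalerA scaleNr mulrN scaleNr.
    by rewrite addrA subrK.
  rewrite (le_trans (nm_triangleB _ _))// mulrDl mul1r lerD2l nmZ nmM nv.
  rewrite (le_trans (ler_wpM2l _ (Ak _))) ?mulr_ge0 ?nm_ge0//.
  rewrite mulrA (le_trans (ler_wpM2l _ (Ak _))) ?mulr_ge0 ?nm_ge0//.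
  by rewrite le_eqVlt; apply/orP; left; apply/eqP; rewrite /rho; ring.
set X := shift M u (shift N (- conjc u) x).
have [X0|X0] := eqVneq X 0.
  by rewrite X0 nm0 mulr_ge0 ?nm_ge0// addr_ge0.
have r1 : 0 <= (1 + rho) * nm x by rewrite mulr_ge0 ?nm_ge0// addr_ge0.
rewrite -(@ler_pXn2r _ 2)// ?nnegrE ?nm_ge0//.
have -> : nm X ^+ 2 = complex.Re (inner (shift M (- u) (shift M u (shift N (conjc u) (shift N (- conjc u) x)))) x).
  have : (nm X ^+ 2)%:C = inner X X by rewrite ipxx.
  move=> /(congr1 (@complex.Re R)) /= ->.
  rewrite {1}/X (adj _ _ _ _ _ MN) (adj _ _ _ _ _ NM) conjN conjcK ReC.
  by rewrite /X (com _ _ _ _ Nl Ml comNM).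
rewrite (le_trans (Re_cauchy_schwarz _ _))// expr2 mulrA ler_wpM2r ?nm_ge0//.
have h := sq M (- u) (shift N (conjc u) (shift N (- conjc u) x)) Ml Mk (nmN u).
rewrite opprK in h; rewrite (le_trans h)// -mulrA ler_wpM2l ?addr_ge0//.
rewrite [nm x * _]mulrC; exact: sq (nm_conj u).
Qed.

Lemma shift_bound (u : C) x : nm (shift M u x) <= (1 + nm u * k) * nm x.
Proof.
rewrite (le_trans (nm_triangle _ _))// mulrDl mul1r lerD2l nmZ -mulrA.
by rewrite ler_wpM2l ?nm_ge0.
Qed.

Lemma near_id_iter (e : R) (D : H -> H) n x : linear D -> 0 <= e ->
  (forall x, nm (x - D x) <= e * nm x) ->
  nm (x - iter n D x) <= ((1 + e) ^+ n - 1) * nm x.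
Proof.
move=> Dl e0 De.
have D1 y : nm (D y) <= (1 + e) * nm y.
  by rewrite -[D y](subrKC y) (le_trans (nm_triangle _ _))// mulrDl mul1r lerD2l nm_distC.
elim: n => [|n IH] /=; first by rewrite subrr nm0 expr0 subrr mul0r.
rewrite (le_trans (nm_dist (iter n D x) _ _))//.
have -> : ((1 + e) ^+ n.+1 - 1) * nm x = ((1 + e) ^+ n - 1) * nm x + e * ((1 + e) ^+ n * nm x).
  by rewrite exprS; ring.
rewrite lerD// (le_trans (De _))// ler_wpM2l// iter_bound// addr_ge0//.
Qed.

(** Next to [T] one inserts D^n = (1 - conj(u) N)^n (1 + conj(u) N)^n and moves the first factor
    through [T], which commutes with [N]. Both sides of [T] then carry powers of nearly unitary
    products; the remainder is small since D = 1 - conj(u)^2 N^2. *)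
Lemma conjugation_bound (c a : R) n z x y : 0 <= c -> a = nm z * c * k ->
  nm (inner (iter n (shift M (z * c%:C)) (T (iter n (shift M (- (z * c%:C))) x))) y)
  <= t * ((1 + a ^+ 2) ^+ n * (1 + a ^+ 2) ^+ n +
      (1 + a) ^+ n * (1 + a) ^+ n * ((1 + a ^+ 2) ^+ n - 1)) * (nm x * nm y).
Proof.
move=> c0 aE; pose u : C := z * c%:C.
have nu : nm u = nm z * c by rewrite nmM nmC ger0_norm.
rewrite -{}nu in aE.
have a0 : 0 <= a by rewrite aE mulr_ge0// nm_ge0.
rewrite -/u; set P := shift M u; set Q := shift M (- u).
pose P' := shift N (- conjc u); pose Q' := shift N (conjc u).
pose D v := Q' (P' v).
have Pl : linear P by exact: shift_linear.
have Ql : linear Q by exact: shift_linear.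
have P'l : linear P' by exact: shift_linear.
have Q'l : linear Q' by exact: shift_linear.
have com v1 v2 (A B : H -> H) : linear A -> linear B -> (forall x, A (B x) = B (A x)) ->
    forall a, shift A v1 (shift B v2 a) = shift B v2 (shift A v1 a).
  move=> Al Bl AB b; rewrite /shift (linD Al) (linZ Al) (linD Bl) (linZ Bl).
  rewrite !scalerDr !scalerA AB [v1 * v2]mulrC !addrA; congr (_ + _).
  by rewrite addrAC.
have MN x' : M (N x') = N (M x') by rewrite comNM.
have TP' v : T (P' v) = P' (T v).
  by rewrite /P' /shift (linD Tl) (linZ Tl) comTN.
have DE v : D v = v - (conjc u * conjc u) *: N (N v).
  rewrite /D /Q' /P' /shift (linD Nl) (linZ Nl) scalerDr scalerA scaleNr mulrN scaleNr.
  by rewrite addrA subrK.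
have Db v : nm (v - D v) <= a ^+ 2 * nm v.
  rewrite DE opprB addrC subrK nmZ nmM nm_conj.
  rewrite (le_trans (ler_wpM2l _ (Nk _))) ?mulr_ge0 ?nm_ge0//.
  rewrite mulrA (le_trans (ler_wpM2l _ (Nk _))) ?mulr_ge0 ?nm_ge0//.
  by rewrite le_eqVlt; apply/orP; left; apply/eqP; rewrite aE; ring.
set v := iter n Q x.
have step : iter n P (T v) = iter n (fun v => P (P' v)) (T (iter n (fun v => Q' (Q v)) x))
    + iter n P (T (v - iter n D v)).
  rewrite (linB Tl) (linB (iter_linear n Pl)).
  rewrite -[in X in _ = X](iter_comp_commute (A := P) (B := P')); last first.
    by move=> w; apply: com.
  rewrite -(iter_comp_commute (A := Q') (B := Q)) -/v; last first.
    by move=> w; apply: com.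
  rewrite -(iter_comp_commute (A := Q') (B := P')); last first.
    by move=> w; apply: com.
  have -> : iter n Q' (iter n P' v) = iter n P' (iter n Q' v).
    rewrite (iter_comp_commute (A := Q') (B := P')); last by move=> w; apply: com.
    rewrite (iter_comp_commute (A := P') (B := Q')); last by move=> w; apply: com.
    by apply: eq_iter => w; apply: com.
  have -> : T (iter n P' (iter n Q' v)) = iter n P' (T (iter n Q' v)).
    by apply: iter_commute.
  by rewrite addrC subrK.
have a21 : 0 <= 1 + a ^+ 2 by rewrite addr_ge0// sqr_ge0.
have a1 : 0 <= 1 + a by rewrite addr_ge0.
have b1 w : nm (iter n (fun v => P (P' v)) w) <= (1 + a ^+ 2) ^+ n * nm w.
  by apply: iter_bound => // w'; rewrite aE; exact: shift_prod_bound.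
have b2 w : nm (iter n (fun v => Q' (Q v)) w) <= (1 + a ^+ 2) ^+ n * nm w.
  apply: iter_bound => // w'; rewrite /Q' /Q (com _ _ _ _ Nl Ml comNM) aE -(nmN u).
  by rewrite -[conjc u]opprK -conjN; exact: shift_prod_bound.
have b3 w : nm (iter n P w) <= (1 + a) ^+ n * nm w.
  by apply: iter_bound => // w'; rewrite aE; exact: shift_bound.
have b4 w : nm (iter n Q w) <= (1 + a) ^+ n * nm w.
  by apply: iter_bound => // w'; rewrite aE -(nmN u); exact: shift_bound.
have b5 w : nm (w - iter n D w) <= ((1 + a ^+ 2) ^+ n - 1) * nm w.
  apply: near_id_iter => //; last by rewrite sqr_ge0.
  exact: linear_compo.
have e0 : 0 <= (1 + a ^+ 2) ^+ n - 1.
  by rewrite subr_ge0 exprn_ege1// lerDl sqr_ge0.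
rewrite (le_trans (cauchy_schwarz _ _))// mulrA ler_wpM2r ?nm_ge0// step.
rewrite (le_trans (nm_triangle _ _))// mulrDr mulrDl lerD//.
  rewrite (le_trans (b1 _))// (le_trans (ler_wpM2l _ (Tt _))) ?exprn_ge0//.
  rewrite mulrCA -!mulrA ler_wpM2l// ler_wpM2l ?exprn_ge0//.
rewrite (le_trans (b3 _))// (le_trans (ler_wpM2l _ (Tt _))) ?exprn_ge0//.
rewrite mulrCA -!mulrA ler_wpM2l// ler_wpM2l ?exprn_ge0//.
by rewrite (le_trans (b5 _))// mulrCA ler_wpM2l//; exact: b4.
Qed.

End ConjugationByPowers.

Lemma exp_bound (a : R) n : 0 <= a -> (0 < n)%N -> (1 + a / n%:R) ^+ n <= expR a.
Proof.
move=> a0 n0; rewrite (@le_trans _ _ (expR (a / n%:R) ^+ n))//.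
  by rewrite ler_pXn2r// ?nnegrE ?expR_ge0// ?addr_ge0 ?divr_ge0// expR_ge1Dx.
by rewrite -expRM_natl mulrC divfK// pnatr_eq0 -lt0n.
Qed.

(* Fuglede's theorem, by Rosenblum's argument with [(1 + z N^* / n)^n] in place of
   [exp (z N^* )]: the conjugate [(1 + z N^* / n)^n T (1 - z N^* / n)^n] stays bounded as
   [n] grows, because [exp (z N^* - (z N^* )^* )] is unitary; its coefficient of
   index 1 in [z], namely [N^* T - T N^*], must vanish by Liouville. *)
Lemma fuglede N M T : bounded_op N -> op_adjoint N M -> (forall x, N (M x) = M (N x)) ->
  bounded_op T -> (forall x, T (N x) = N (T x)) -> forall x, T (M x) = M (T x).
Proof.
move=> /bounded_opP[Nl [k k0 Nk]] NM comNM /bounded_opP[Tl [t t0 Tt]] comTN x.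
have Ml := op_adjoint_linear NM.
apply: ip_inj => y; apply/eqP; rewrite eq_sym -subr_eq0; apply/eqP/nm_eq0/eqP.
rewrite eq_le nm_ge0 andbT; apply: ler_eps => e e0; rewrite addr0.
set delta := _ - _.
(* The 5 is 4 + 1: the main term of [conjugation_bound] is at most 4 and its remainder at most 1,
   once [n] is large. *)
pose B := 5 * t * (nm x * nm y).
have B0 : 0 <= B by rewrite !mulr_ge0// nm_ge0.
have [r r0 Br] := arch_inv B e0.
have rr : 0 < r%:R :> R by rewrite ltr0n.
suff : nm delta * r%:R <= B.
  by move=> h; rewrite (le_trans _ Br)// ler_pdivlMr.
pose a := r%:R * k; have a0 : 0 <= a by rewrite mulr_ge0.
have E0 := expR_gt0 (2 * a).
(* [n] is chosen after the radius [r]: the bound 1/2 gives the main term, and the other beats the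
   crude factor exp(2a) in the remainder. *)
have [n n0 hn] : exists2 n : nat, (0 < n)%N &
    a ^+ 2 / n%:R <= Num.min (1 / 2) (1 / (2 * expR (2 * a))).
  by apply: arch_inv; rewrite lt_min !divr_gt0// mulr_gt0.
move: hn; rewrite le_min => /andP[hn1 hn2].
have nn : 0 < n%:R :> R by rewrite ltr0n.
have [p [pE p0 p1]] := conjugation_poly Ml Tl NM n%:R^-1 n n x y.
have -> : delta = p`_1.
  rewrite p1 -mulrBr mulrA RCV RC_nat mulVf ?mul1r//.
  by rewrite pnatr_eq0 -lt0n.
apply: (coef1_bound (ltW rr)) => z zr; rewrite pE.
have c0 : 0 <= n%:R^-1 :> R by rewrite invr_ge0 ler0n.
have := @conjugation_bound N M T Nl Ml Tl NM comNM comTN k t k0 t0 Nk Tt _ _ n z x y c0 erefl.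
move=> /le_trans; apply; rewrite zr; have -> : r%:R * n%:R^-1 * k = a / n%:R by rewrite /a mulrAC.
rewrite /B ler_wpM2r ?mulr_ge0 ?nm_ge0// [5 * t]mulrC ler_wpM2l//.
have h1 : (1 + (a / n%:R) ^+ 2) ^+ n <= expR (a ^+ 2 / n%:R).
  rewrite (le_trans _ (@exp_bound (a ^+ 2 / n%:R) n _ _))//; last first.
    by rewrite divr_ge0// sqr_ge0.
  by rewrite exprMn expr2 [n%:R^-1 ^+ 2]expr2 mulrA.
have h2 : (1 + a / n%:R) ^+ n <= expR a by exact: exp_bound.
set s := a ^+ 2 / n%:R in hn1 hn2 h1 *.
have s0 : 0 <= s by rewrite divr_ge0// sqr_ge0.
have h3 : expR s <= 1 + 2 * s.
  have := expR_ge1Dx (- s); rewrite expRN => h.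
  have es := expR_gt0 s.
  have : (1 - s) * expR s <= 1 by rewrite -ler_pdivlMr// div1r.
  nra.
have h4 : (1 + (a / n%:R) ^+ 2) ^+ n <= 1 + 2 * s := le_trans h1 h3.
have h5 : 0 <= (1 + (a / n%:R) ^+ 2) ^+ n by rewrite exprn_ge0// addr_ge0// sqr_ge0.
have h6 : 0 <= (1 + a / n%:R) ^+ n by rewrite exprn_ge0// addr_ge0// divr_ge0.
have h7 : (1 + a / n%:R) ^+ n * (1 + a / n%:R) ^+ n <= expR (2 * a).
  by rewrite mulr_natl mulr2n expRD ler_pM.
have h8 : expR (2 * a) * s <= 1 / 2.
  rewrite mulrC -ler_pdivlMr// (le_trans hn2)// -mulrA invfM//.
move: h4 h5 h6 h7 h8; set X := (1 + _) ^+ n; set Y := (1 + _) ^+ n => h4 h5 h6 h7 h8.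
have X1 : 0 <= X - 1 by rewrite subr_ge0 exprn_ege1// lerDl sqr_ge0.
have h9 : X * X <= 4 by nra.
have h10 : Y * Y * (X - 1) <= expR (2 * a) * (2 * s).
  by rewrite ler_pM ?mulr_ge0//; lra.
lra.
Qed.

End Fuglede.

(** * Approximate eigenvectors and the joint spectrum *)

Section ComplexComplete.
Context {R : realType}.
Local Notation C := R[i].

Lemma ImB (a b : C) : complex.Im (a - b) = complex.Im a - complex.Im b.
Proof. by case: a; case: b. Qed.

(** Serves twice: for limits of eigenvalues along a norm limit of operators, and to make [R[i]] a
    Hilbert space. *)
Lemma complex_complete (F : set_system C) : ProperFilter F -> cauchy F -> cvg F.
Proof.
move=> FF /cauchyP Fc.
have part (f : C -> R) : (forall z w, `|f z - f w| <= nm (z - w)) -> cvg (f @ F).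
  move=> fl; apply/cauchy_cvgP/cauchy_exP => e e0.
  have e0' : 0 < e%:C by rewrite ltcR.
  have [z Fz] := Fc _ e0'; exists (f z); move: Fz; rewrite /nbhs /=; apply: filterS => w.
  rewrite -!ball_normE /= nmE ltcR; exact: le_lt_trans (fl _ _).
have Rel (z w : C) : `|complex.Re z - complex.Re w| <= nm (z - w).
  by rewrite -ReB -lecR -nmE normc_ge_Re.
have Iml (z w : C) : `|complex.Im z - complex.Im w| <= nm (z - w).
  have -> : complex.Im z - complex.Im w = complex.Re (- 'i * (z - w)).
    by case: z => a b; case: w => c d /=; rewrite oppr0 !mul0r sub0r !mulN1r opprK.
  by rewrite -(mul1r (nm (z - w))) -nmi -nmN -nmM -lecR -nmE normc_ge_Re.
have /cvg_ex [a Fa] := part _ Rel; have /cvg_ex [b Fb] := part _ Iml.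
apply/cvg_ex; exists (a +i* b); apply/cvgrPdist_le => e e0.
have ne : 0 < nm e / 2 by rewrite divr_gt0// nm_gt0// gt_eqF.
have h1 : \forall z \near F, `|a - complex.Re z| <= nm e / 2.
  by apply: (cvgrPdist_le _ _).1.
have h2 : \forall z \near F, `|b - complex.Im z| <= nm e / 2.
  by apply: (cvgrPdist_le _ _).1.
near=> z; rewrite nmE (ge0_nm (ltW e0)) lecR (le_trans (nm_le_ReIm _))//.
rewrite [leRHS]splitr lerD//.
  by rewrite ReB; near: z; exact: h1.
by rewrite ImB; near: z; exact: h2.
Unshelve. all: by end_near. Qed.

End ComplexComplete.

HB.instance Definition _ (R : realType) :=
  Uniform_isComplete.Build R[i] (@complex_complete R).

Section ApproximateEigenvectors.
Context {R : realType} {H : hilbertType R}.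
Local Notation C := R[i].
Implicit Types (A B : H -> H).

Variables (x : nat -> H) (x1 : forall n, nm (x n) = 1).

(** [l] is the asymptotic eigenvalue of [A] along the fixed sequence [x]; as a function of [A] it
    will be the character. *)
Definition acts_as A (l : C) := forall e : R, 0 < e ->
  exists n0, forall n, (n0 <= n)%N -> nm (A (x n) - l *: x n) <= e.

Lemma acts_as_uniq A l l' : acts_as A l -> acts_as A l' -> l = l'.
Proof.
move=> h h'; apply/eqP; rewrite -subr_eq0; apply/eqP/nm_eq0/eqP.
rewrite eq_le nm_ge0 andbT; apply: ler_eps => e e0; rewrite addr0.
have e2 : 0 < e / 2 by rewrite divr_gt0.
have [n0 hn0] := h _ e2; have [n1 hn1] := h' _ e2; pose n := maxn n0 n1.
have := nm_dist (A (x n)) (l *: x n) (l' *: x n).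
rewrite -scalerBl nmZ x1 mulr1 => /le_trans; apply.
by rewrite [leRHS]splitr lerD// ?[nm (l *: _ - _)]nm_distC ?hn0 ?hn1// ?leq_maxl ?leq_maxr.
Qed.

Lemma acts_as_id : acts_as id 1.
Proof. by move=> e e0; exists 0%N => n _; rewrite scale1r subrr nm0 ltW. Qed.

Lemma acts_as_lin a A B l m : acts_as A l -> acts_as B m ->
  acts_as (fun x => a *: A x + B x) (a * l + m).
Proof.
move=> hA hB e e0.
have a1 : 0 < nm a + 1 by rewrite ltr_wpDl// nm_ge0.
have e1 : 0 < e / (nm a + 1) / 2 by rewrite !divr_gt0.
have e2 : 0 < e / 2 by rewrite divr_gt0.
have [n0 hn0] := hA _ e1; have [n1 hn1] := hB _ e2.
exists (maxn n0 n1) => n; rewrite geq_max => /andP[le0 le1].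
rewrite scalerDl -scalerA opprD addrACA -scalerBr.
rewrite (le_trans (nm_triangle _ _))// nmZ [leRHS]splitr lerD ?hn1//.
rewrite (le_trans (ler_wpM2l (nm_ge0 _) (hn0 _ le0)))//.
rewrite mulrA ler_wpM2r ?invr_ge0// mulrA ler_pdivrMr// [nm a * e]mulrC.
by rewrite ler_wpM2l ?(ltW e0)// lerDl.
Qed.

Lemma acts_as_comp A B l m : linear A -> bnd A -> acts_as A l -> acts_as B m ->
  acts_as (A \o B) (l * m).
Proof.
move=> Al [M M0 AM] hA hB e e0.
have M1 : 0 < M + 1 by rewrite ltr_wpDl.
have m1 : 0 < nm m + 1 by rewrite ltr_wpDl// nm_ge0.
have e1 : 0 < e / (nm m + 1) / 2 by rewrite !divr_gt0.
have e2 : 0 < e / (M + 1) / 2 by rewrite !divr_gt0.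
have [n0 hn0] := hA _ e1; have [n1 hn1] := hB _ e2.
exists (maxn n0 n1) => n; rewrite geq_max => /andP[le0 le1] /=.
have -> : A (B (x n)) - (l * m) *: x n =
    A (B (x n) - m *: x n) + m *: (A (x n) - l *: x n).
  by rewrite (linB Al) (linZ Al) scalerBr scalerA [m * l]mulrC addrA subrK.
rewrite (le_trans (nm_triangle _ _))// nmZ [leRHS]splitr lerD//.
  rewrite (le_trans (AM _))// (le_trans (ler_wpM2l M0 (hn1 _ le1)))//.
  rewrite mulrA ler_wpM2r ?invr_ge0// mulrA ler_pdivrMr// [M * e]mulrC.
  by rewrite ler_wpM2l ?(ltW e0)// lerDl.
rewrite (le_trans (ler_wpM2l (nm_ge0 _) (hn0 _ le0)))//.
rewrite mulrA ler_wpM2r ?invr_ge0// mulrA ler_pdivrMr// [nm m * e]mulrC.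
by rewrite ler_wpM2l ?(ltW e0)// lerDl.
Qed.

Lemma acts_as_dist A B l m (c : R) : (forall x, nm (A x - B x) <= c * nm x) ->
  acts_as A l -> acts_as B m -> nm (l - m) <= c.
Proof.
move=> AB hA hB; apply: ler_eps => e e0.
have e2 : 0 < e / 2 by rewrite divr_gt0.
have [n0 hn0] := hA _ e2; have [n1 hn1] := hB _ e2; pose n := maxn n0 n1.
have := nm_dist (A (x n)) (l *: x n) (m *: x n).
rewrite -scalerBl nmZ x1 mulr1 => /le_trans; apply.
have := nm_dist (B (x n)) (A (x n)) (m *: x n) => h.
rewrite (le_trans (lerD (lexx _) h))//.
have h0 := hn0 n (leq_maxl _ _); have h1 := hn1 n (leq_maxr _ _).
have := AB (x n); rewrite x1 mulr1 => h2.
rewrite nm_distC (splitr e) -addrA lerD// addrC lerD//.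
Qed.

Lemma acts_as_approx A l : (forall e : R, 0 < e -> exists B m,
   [/\ acts_as B m, nm (l - m) <= e & forall x, nm (A x - B x) <= e * nm x]) ->
  acts_as A l.
Proof.
move=> h e e0.
have e3 : 0 < e / 3 by rewrite divr_gt0.
have [B [m [hB lm AB]]] := h _ e3; have [n0 hn0] := hB _ e3.
exists n0 => n le; have := AB (x n); rewrite x1 mulr1 => h1.
have h2 := hn0 _ le.
have h3 : nm (m *: x n - l *: x n) <= e / 3.
  by rewrite -scalerBl nmZ x1 mulr1 nm_distC.
rewrite (le_trans (nm_dist (B (x n)) _ _))//.
rewrite (le_trans (lerD h1 (le_trans (nm_dist (m *: x n) _ _) (lerD h2 h3))))//.
lra.
Qed.

(** Carrying the adjoint with the conjugate eigenvalue makes this set a C*-algebra, so it contains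
    the one generated by any tuple of its members. *)
Definition diagonal_ops : set (H -> H) :=
  [set A | bounded_op A /\ exists B l, [/\ op_adjoint A B, acts_as A l & acts_as B (conjc l)]].

Lemma diagonal_ops_cstar : cstar_subalgebra diagonal_ops.
Proof.
split.
- split; first by move=> A [].
  split; first by apply/bounded_opP; split => //; exact: bnd_id.
  by exists id, 1; split => //; rewrite ?conjc1; exact: acts_as_id.
- move=> a A A' [/bounded_opP[Al Ab] [B [l [AB hA hB]]]].
  move=> [/bounded_opP[A'l A'b] [B' [l' [AB' hA' hB']]]]; split.
    apply/bounded_opP; split.
      exact: (linear_addf (linear_scalef a Al) A'l).
    exact: (bnd_add (bnd_scale a Ab) A'b).
  exists (fun x => conjc a *: B x + B' x), (a * l + l'); split.
  + by move=> u v; rewrite ipDl ipDr ipZl ipZr conjcK AB AB'.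
  + exact: acts_as_lin.
  + by rewrite conjD conjM; exact: acts_as_lin.
- move=> A A' [Abd [B [l [AB hA hB]]]] [A'bd [B' [l' [AB' hA' hB']]]].
  have [Al Ab] := (bounded_opP _).1 Abd; have [A'l A'b] := (bounded_opP _).1 A'bd.
  have [B'l B'b] := (bounded_opP _).1 (op_adjoint_bounded A'bd AB').
  split.
    apply/bounded_opP; split; first exact: (linear_compo Al A'l).
    exact: (bnd_comp Ab A'b).
  exists (B' \o B), (l * l'); split.
  + by move=> u v /=; rewrite AB AB'.
  + exact: acts_as_comp.
  + by rewrite conjM mulrC; exact: acts_as_comp.
- move=> A B' [Abd [B [l [AB hA hB]]]] AB'.
  rewrite -(op_adjoint_uniq AB AB'); split; first exact: op_adjoint_bounded AB.
  by exists A, (conjc l); rewrite conjcK; split => //; exact: op_adjoint_sym.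
- move=> A Abd happ; split => //.
  have [B AB] := adjoint_exists Abd.
  have /choice[Dk hD] : forall k : nat, exists D, diagonal_ops D /\ op_norm (A - D) < k.+1%:R^-1.
    by move=> k; have [|D ? ?] := happ k.+1%:R^-1; [rewrite invr_gt0|exists D].
  have [Al Ab] := (bounded_opP _).1 Abd.
  have diffb k : bounded_op (A - Dk k).
    have [[Dbd _] _] := hD k; have [Dl Db] := (bounded_opP _).1 Dbd.
    apply/bounded_opP; split.
      exact: (linear_subf Al Dl).
    exact: (bnd_add Ab (bnd_opp Db)).
  have ADk k y : nm (A y - Dk k y) <= k.+1%:R^-1 * nm y.
    rewrite (le_trans (le_op_norm y (diffb k)))// ler_wpM2r ?nm_ge0// ltW//.
    by case: (hD k).
  have /choice[Ek hE] : forall k, exists E, op_adjoint (Dk k) E /\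
      exists l, acts_as (Dk k) l /\ acts_as E (conjc l).
    by move=> k; have [[_ [E [l [? ? ?]]]] _] := hD k; exists E; split => //; exists l.
  have /choice[lk hl] : forall k, exists l, acts_as (Dk k) l /\ acts_as (Ek k) (conjc l).
    by move=> k; have [_ ?] := hE k.
  have BEk k y : nm (B y - Ek k y) <= k.+1%:R^-1 * nm y.
    have := @op_adjoint_bound _ _ (fun y => A y - Dk k y) (fun y => B y - Ek k y) k.+1%:R^-1.
    move=> /(_ _ (ADk k)) h; apply: h; first by rewrite invr_ge0.
    by move=> u v; rewrite ipBl ipBr AB (hE k).1.
  (* Eigenvalues of the approximants are as close as the operators ([acts_as_dist]), hence form a
     Cauchy sequence. *)
  have [l hlim] : exists l, forall e : R, 0 < e -> exists n0, forall n, (n0 <= n)%N ->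
      nm (lk n - l) <= e.
    apply: complete_seq => e e0; have [n0 hn0] := small_seq (divr_gt0 e0 (ltr0Sn R 1)).
    exists n0 => n m ln lm.
    apply: (acts_as_dist _ (hl n).1 (hl m).1) => y.
    rewrite (le_trans (nm_dist (A y) _ _))// nm_distC (le_trans (lerD (ADk _ _) (ADk _ _)))//.
    by rewrite -mulrDl ler_wpM2r ?nm_ge0// [leRHS]splitr lerD ?hn0.
  exists B, l; split => //.
    apply: acts_as_approx => e e0.
    have [n0 hn0] := hlim e e0; have [n1 hn1] := small_seq e0.
    exists (Dk (maxn n0 n1)), (lk (maxn n0 n1)); split; first by case: (hl (maxn n0 n1)).
      by rewrite nm_distC hn0// leq_maxl.
    by move=> y; rewrite (le_trans (ADk _ _))// ler_wpM2r ?nm_ge0// hn1// leq_maxr.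
  apply: acts_as_approx => e e0.
  have [n0 hn0] := hlim e e0; have [n1 hn1] := small_seq e0.
  exists (Ek (maxn n0 n1)), (conjc (lk (maxn n0 n1))); split; first by case: (hl (maxn n0 n1)).
    by rewrite -conjB nm_conj nm_distC hn0// leq_maxl.
  by move=> y; rewrite (le_trans (BEk _ _))// ler_wpM2r ?nm_ge0// hn1// leq_maxr.
Qed.

Lemma acts_as_joint_spectrum d (N M : 'I_d -> H -> H) (l : 'rV[C]_d) :
  (forall i, bounded_op (N i)) -> (forall i, op_adjoint (N i) (M i)) ->
  (forall i, acts_as (N i) (l 0 i)) -> (forall i, acts_as (M i) (conjc (l 0 i))) ->
  joint_spectrum N l.
Proof.
move=> Nb NM hN hM.
have gen A : cstar_gen N A -> exists l, acts_as A l.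
  move=> /(_ diagonal_ops) []; last by move=> _ [B [m [_ ? _]]]; exists m.
  split; first exact: diagonal_ops_cstar.
  by move=> _ [i _ <-]; split => //; exists (M i), (l 0 i).
have genb A : cstar_gen N A -> bounded_op A.
  move=> /(_ diagonal_ops) []; last by [].
  split; first exact: diagonal_ops_cstar.
  by move=> _ [i _ <-]; split => //; exists (M i), (l 0 i).
(* The default 0 is taken only where there is no asymptotic eigenvalue, hence never on the generated
   algebra. *)
pose chi A := xget 0 [set m | acts_as A m].
have chiE A m : acts_as A m -> chi A = m.
  move=> h; apply: (@acts_as_uniq A) => //.
  by have := xgetI 0 (h : [set m | acts_as A m] m).
exists chi; last by move=> i; rewrite (chiE _ _ (hN i)).
split; first exact: (chiE _ _ acts_as_id).
  move=> a A B /gen[m hm] /gen[m' hm'].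
  by rewrite (chiE _ _ hm) (chiE _ _ hm'); apply: chiE; exact: acts_as_lin.
move=> A B gA /gen[m' hm']; have [m hm] := gen _ gA.
have [Al Ab] := (bounded_opP _).1 (genb _ gA).
by rewrite (chiE _ _ hm) (chiE _ _ hm'); apply: chiE; exact: acts_as_comp.
Qed.

End ApproximateEigenvectors.

Section SpectrumCriterion.
Context {R : realType} {H : hilbertType R}.
Local Notation C := R[i].

Lemma joint_spectrum_approx d (N M : 'I_d -> H -> H) (l : 'rV[C]_d) :
  (forall i, bounded_op (N i)) -> (forall i, op_adjoint (N i) (M i)) ->
  (forall e : R, 0 < e -> exists2 x, nm x = 1 & forall i,
     nm (N i x - l 0 i *: x) <= e /\ nm (M i x - conjc (l 0 i) *: x) <= e) ->
  joint_spectrum N l.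
Proof.
move=> Nb NM h.
have /choice[x hx] : forall n : nat, exists x, nm x = 1 /\ forall i,
     nm (N i x - l 0 i *: x) <= n.+1%:R^-1 /\ nm (M i x - conjc (l 0 i) *: x) <= n.+1%:R^-1.
  by move=> n; have [|x ? ?] := h n.+1%:R^-1; [rewrite invr_gt0|exists x].
apply: (@acts_as_joint_spectrum _ _ x _ d N M) => // [n|i|i]; first by case: (hx n).
  move=> e /small_seq[n0 hn0]; exists n0 => n le.
  by rewrite (le_trans _ (hn0 _ le))//; have [_ /(_ i)[]] := hx n.
move=> e /small_seq[n0 hn0]; exists n0 => n le.
by rewrite (le_trans _ (hn0 _ le))//; have [_ /(_ i)[]] := hx n.
Qed.

End SpectrumCriterion.

(** How one trial changes a second moment: from a cell of mass [b] and count [a], the mass [y]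
    succeeds and [b - y] fails. *)
Lemma trial_square (K : comNzRingType) (V : lmodType K) (a : K) (b y : V) :
  (a + 1) ^+ 2 *: y + a ^+ 2 *: (b - y) = a ^+ 2 *: b + (y + 2 *: (a *: y)).
Proof.
have -> : (a + 1) ^+ 2 = a ^+ 2 + (2 * a + 1) by ring.
rewrite [X in X + _]scalerDl [X in _ + X + _]scalerDl scale1r scalerBr scalerA.
by rewrite addrC -!addrA; congr (_ + _); rewrite addKr addrC.
Qed.

(** * Binomial partitions of the identity *)

Section BinomialPartition.
Context {R : realType} {H : hilbertType R}.
Local Notation C := R[i].
Variables (J : finType) (A : J -> H -> H).
Hypotheses (pA : forall j, psd (A j)) (bA : forall j, bnd (A j)).
Hypothesis pA1 : forall j, psd (fun x => x - A j x).
Hypothesis comA : forall i j x, A i (A j x) = A j (A i x).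

(* The law of the number of successes of each kind in a sequence [w] of independent
   trials, a trial of kind [j] succeeding with operator-valued probability [A j]. *)
Lemma trials_partition (w : seq J) : exists (I : finType) (c : I -> J -> nat) (B : I -> H -> H),
  [/\ forall i, psd (B i) /\ forall j x, B i (A j x) = A j (B i x),
      forall i j, (c i j <= count_mem j w)%N,
      forall x, \sum_i B i x = x,
      forall j x, \sum_i (c i j)%:R *: B i x = (count_mem j w)%:R *: A j x &
      forall j x, \sum_i (c i j)%:R ^+ 2 *: B i x = (count_mem j w)%:R *: A j x +
        ((count_mem j w)%:R ^+ 2 - (count_mem j w)%:R) *: A j (A j x)].
Proof.
elim: w => [|j0 w [I [c [B [pB cw B1 Bc Bc2]]]]].
  exists unit, (fun _ _ => 0%N), (fun _ x => x); split => //.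
  - by move=> _; split => //; exact: psd_id.
  - by move=> x; rewrite big_const card_unit /= addr0.
  - by move=> j x; rewrite big1 ?scale0r.
  - by move=> j x; rewrite big1 ?expr0n /= ?subrr ?scale0r ?addr0.
pose I' := (bool * I)%type.
pose c' (p : I') j := (c p.2 j + (p.1 && (j == j0)))%N.
(* Success multiplies the mass of a cell by [A j0] and failure by [1 - A j0]; everything commutes,
   so [psd_mul] keeps the masses positive. *)
pose B' (p : I') x := if p.1 then A j0 (B p.2 x) else B p.2 x - A j0 (B p.2 x).
have [Al _ _] := pA j0.
have sumE (F : bool -> I -> H) : \sum_p F p.1 p.2 = \sum_i (F true i + F false i).
  by rewrite -(pair_bigA _ F) /= big_bool big_split.
exists I', c', B'; split.
- move=> [b i] /=; have [pBi comB] := pB i; have [Bl _ _] := pBi; split.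
    rewrite /B'; case: b => /=.
      by apply: psd_mul => // x; rewrite comB.
    apply: (@psd_mul _ _ (fun x => x - A j0 x)) => //.
      exact: bnd_add (bnd_id _) (bnd_opp (bA j0)).
    by move=> x; rewrite (linB Bl) comB.
  move=> j x; have [Ajl _ _] := pA j; rewrite /B'; case: b => /=.
    by rewrite comB comA.
  by rewrite comB (linB Ajl) [in RHS]comA.
- move=> [b i] j; rewrite /c' /= addnC [_ == _]eq_sym leq_add//.
  by case: b => //=; case: eqP.
- move=> x; rewrite (sumE (fun b i => B' (b, i) x)).
  by under eq_bigr => i _ do rewrite /B' /= addrC subrK; exact: B1.
- move=> j x; rewrite (sumE (fun b i => (c' (b, i) j)%:R *: B' (b, i) x)).
  have -> : (count_mem j (j0 :: w))%:R = (j0 == j)%:R + (count_mem j w)%:R :> C.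
    by rewrite /= natrD.
  rewrite eq_sym; have [->|jj] := eqVneq j j0.
    transitivity (\sum_i ((c i j0)%:R *: B i x + A j0 (B i x))).
      apply: eq_bigr => i _; rewrite /B' /c' /= eqxx addn0 addn1 -natr1 scalerDl scale1r.
      by rewrite scalerBr addrAC [_ *: A _ _ + _]addrC subrK.
    by rewrite big_split /= Bc -(lin_sum Al) B1 scalerDl scale1r addrC.
  rewrite add0r -Bc; apply: eq_bigr => i _; rewrite /B' /c' /= (negPf jj) !addn0.
  by rewrite scalerBr addrC subrK.
- move=> j x; rewrite (sumE (fun b i => (c' (b, i) j)%:R ^+ 2 *: B' (b, i) x)).
  have -> : (count_mem j (j0 :: w))%:R = (j0 == j)%:R + (count_mem j w)%:R :> C.
    by rewrite /= natrD.
  rewrite eq_sym; have [->|jj] := eqVneq j j0.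
    set n := count_mem j0 w.
    transitivity (\sum_i ((c i j0)%:R ^+ 2 *: B i x + (A j0 (B i x) +
        2 *: A j0 ((c i j0)%:R *: B i x)))).
      apply: eq_bigr => i _; rewrite /B' /c' /= eqxx addn0 addn1 -natr1.
      by rewrite (linZ Al) trial_square.
    rewrite big_split big_split /= Bc2 -(lin_sum Al) B1.
    rewrite -scaler_sumr -(lin_sum Al) Bc (linZ Al) -/n.
    have -> : (1 + n%:R : C) ^+ 2 - (1 + n%:R) = (n%:R ^+ 2 - n%:R) + 2 * n%:R by ring.
    rewrite [(1 + _) *: A j0 x]scalerDl [(_ + 2 * _) *: _]scalerDl scale1r scalerA.
    by rewrite addrACA [_ *: A j0 x + _]addrC.
  rewrite add0r -Bc2; apply: eq_bigr => i _; rewrite /B' /c' /= (negPf jj) !addn0.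
  by rewrite scalerBr addrC subrK.
Qed.

Lemma count_repeat_enum p j : count_mem j (flatten (nseq p (enum J))) = p.
Proof.
elim: p => [//|p IH] /=.
by rewrite count_cat IH count_uniq_mem ?enum_uniq// mem_enum.
Qed.

(** With [p] trials of each kind, [q i j] is the frequency of successes. The last clause is
    Bernstein's variance A_j (1 - A_j) / p, bounded by 1/p. *)
Lemma binomial_partition p : (0 < p)%N ->
  exists (I : finType) (q : I -> J -> R) (B : I -> H -> H),
  [/\ forall i, psd (B i) /\ forall j x, B i (A j x) = A j (B i x),
      forall i j, 0 <= q i j <= 1,
      forall x, \sum_i B i x = x,
      forall j x, \sum_i (q i j)%:C *: B i x = A j x &
      forall j x, \sum_i complex.Re (inner (B i (A j x - (q i j)%:C *: x))
        (A j x - (q i j)%:C *: x)) <= nm x ^+ 2 / p%:R].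
Proof.
move=> p0.
have [I [c [B [pB cp B1 Bc Bc2]]]] := trials_partition (flatten (nseq p (enum J))).
have pp : 0 < p%:R :> R by rewrite ltr0n.
have pC : p%:R != 0 :> C by rewrite pnatr_eq0 -lt0n.
have {}Bc j x : \sum_i (c i j)%:R *: B i x = p%:R *: A j x.
  by rewrite Bc count_repeat_enum.
have {}Bc2 j x : \sum_i (c i j)%:R ^+ 2 *: B i x =
    p%:R *: A j x + (p%:R ^+ 2 - p%:R) *: A j (A j x).
  by rewrite Bc2 count_repeat_enum.
pose q i j : R := (c i j)%:R / p%:R.
have qE i j : (q i j)%:C = p%:R^-1 * (c i j)%:R by rewrite RCM RCV !RC_nat mulrC.
have Bq j x : \sum_i (q i j)%:C *: B i x = A j x.
  under eq_bigr => i _ do rewrite qE -scalerA.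
  by rewrite -scaler_sumr Bc scalerA mulVf// scale1r.
exists I, q, B; split => //.
  move=> i j; rewrite divr_ge0//= ler_pdivrMr// mul1r ler_nat.
  by rewrite (leq_trans (cp i j))// count_repeat_enum.
move=> j x; have [Al As A0] := pA j; have [_ _ A1] := pA1 j.
have term i : inner (B i (A j x - (q i j)%:C *: x)) (A j x - (q i j)%:C *: x) =
   inner (B i (A j (A j x))) x - inner (2 *: ((q i j)%:C *: B i (A j x))) x +
   inner ((q i j)%:C ^+ 2 *: B i x) x.
  have [[Bl Bs _] comB] := pB i.
  rewrite (linB Bl) (linZ Bl) ipBl !ipBr !ipZl !ipZr conjc_real.
  rewrite -!(As (B i _)) -!comB; ring.
rewrite -Re_sum; under eq_bigr => i _ do rewrite term.
rewrite big_split sumrB /= -!ip_suml B1 -scaler_sumr Bq.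
have -> : \sum_i (q i j)%:C ^+ 2 *: B i x =
    (p%:R^-1 ^+ 2) *: (p%:R *: A j x + (p%:R ^+ 2 - p%:R) *: A j (A j x)).
  rewrite -Bc2 scaler_sumr; apply: eq_bigr => i _.
  by rewrite qE exprMn scalerA.
have -> : inner (A j (A j x)) x - inner (2 *: A j (A j x)) x +
    inner ((p%:R^-1 ^+ 2) *: (p%:R *: A j x + (p%:R ^+ 2 - p%:R) *: A j (A j x))) x =
    (p%:R^-1)%:C * (inner (A j x) x - inner (A j (A j x)) x).
  by rewrite !ipZl ipDl !ipZl RCV RC_nat; field.
rewrite ReRM mulrC ler_wpM2r ?invr_ge0 ?ler0n//.
rewrite ReB [inner (A j (A j x)) x]As ipxx Re_RC.
have := A1 x; rewrite ipBl ipxx ReB Re_RC.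
have := sqr_ge0 (nm (A j x)); lra.
Qed.

End BinomialPartition.

Section PsdCombination.
Context {R : realType} {H : hilbertType R}.
Local Notation C := R[i].

(** The coefficients are complex, so the sum has no quadratic form to compare with. It is paired
    instead with its own value rescaled to the length of [x], and [psd_cs] is applied to each
    term. *)
Lemma psd_sum_bound (I : finType) (B : I -> H -> H) (a : I -> C) (e : R) :
  (forall i, psd (B i)) ->
  (forall x, \sum_i nm (a i) * complex.Re (inner (B i x) x) <= e * nm x ^+ 2) ->
  forall x, nm (\sum_i a i *: B i x) <= e * nm x.
Proof.
move=> pB h x; set z := \sum_i _.
have [x0|x0] := eqVneq x 0.
  rewrite x0 nm0 mulr0 /z big1 ?nm0// => i _.
  by rewrite x0; have [Bl _ _] := pB i; rewrite (lin0 Bl) scaler0.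
have nx := nm_gt0 x0.
have [z0|z0] := eqVneq z 0.
  rewrite z0 nm0; have := h x; set s := \sum_i _ => hs.
  have s0 : 0 <= s.
    by apply: sumr_ge0 => i _; rewrite mulr_ge0 ?nm_ge0//; have [_ _] := pB i; exact.
  have := le_trans s0 hs; rewrite pmulr_lge0 ?exprn_gt0// => e0.
  by rewrite mulr_ge0// ltW.
have nz := nm_gt0 z0.
pose y := (nm x / nm z)%:C *: z.
have ny : nm y = nm x.
  by rewrite nmZ nmC ger0_norm ?divr_ge0 ?nm_ge0// divfK// gt_eqF.
have zy : nm (inner z y) = nm x * nm z.
  rewrite ipZr ipxx conjc_real nmM !nmC !ger0_norm ?divr_ge0 ?sqr_ge0 ?nm_ge0//.
  by field; rewrite gt_eqF.
rewrite -(ler_pM2l nx) -zy /z ip_suml (le_trans (nm_sum _ _ _))//.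
apply: (@le_trans _ _ (\sum_i nm (a i) *
    ((complex.Re (inner (B i x) x) + complex.Re (inner (B i y) y)) / 2))).
  by apply: ler_sum => i _; rewrite ipZl nmM ler_wpM2l ?nm_ge0// psd_cs.
have -> : \sum_i nm (a i) *
    ((complex.Re (inner (B i x) x) + complex.Re (inner (B i y) y)) / 2) =
  (\sum_i nm (a i) * complex.Re (inner (B i x) x) +
   \sum_i nm (a i) * complex.Re (inner (B i y) y)) / 2.
  by rewrite -big_split mulr_suml; apply: eq_bigr => i _ /=; rewrite -mulrDr mulrA.
have := h x; have := h y; rewrite ny; nra.
Qed.

End PsdCombination.

(** * Spectral approximation of a normal tuple *)

Section UniformOnCube.
Context {R : realType}.

(** Compactness of the cube, as a near covering along [n] tending to infinity: monotonicity in [n]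
    allows one index to serve everywhere. *)
Lemma cube_uniform (J : finType) (P : nat -> (J -> R) -> Prop) :
  (forall n m th, (n <= m)%N -> P n th -> P m th) ->
  (forall th, (forall j, 0 <= th j <= 1) -> exists (t : R) n, 0 < t /\
     forall th', (forall j, `|th j - th' j| < t) -> P n th') ->
  exists n, forall th, (forall j, 0 <= th j <= 1) -> P n th.
Proof.
move=> Pmono Ploc.
pose th (v : 'rV[R]_#|J|) j := v ord0 (enum_rank j).
pose cube := [set v : 'rV[R]_#|J| | forall i, `[0, 1]%classic (v ord0 i)].
have /compact_near_coveringP cc : compact cube.
  by apply: (@rV_compact R _ (fun=> `[0, 1]%classic)) => i; exact: segment_compact.
have [] := cc nat \oo (fun n v => P n (th v)) _.
  move=> v cv; have [|t [n [t0 h]]] := Ploc (th v).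
    by move=> j; have := cv (enum_rank j); rewrite /= in_itv.
  exists (ball v t, [set m | (n <= m)%N]) => /=.
    by split; [exact: nbhsx_ballx|exists n].
  move=> [v' m] /= [[_ bv'] nm]; apply: Pmono nm _; apply: h => j.
  exact: bv'.
move=> n _ /(_ n (leqnn n)) h; exists n => t ht.
have := h (\row_i t (enum_val i)).
have -> : th (\row_i t (enum_val i)) = t.
  by apply/funext => j; rewrite /th mxE enum_rankK.
by apply => i /=; rewrite in_itv /= mxE; exact: ht.
Qed.

End UniformOnCube.

Section NormalTuple.
Context {R : realType} {H : hilbertType R}.
Local Notation C := R[i].
Variables (d : nat) (N : 'I_d -> H -> H).
Hypothesis nN : normal_tuple N.

(** The mixed commutations for different indices are Fuglede's theorem; [normal_op] states them only
    for equal indices. *)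
Lemma normal_adjoints : exists M : 'I_d -> H -> H,
  [/\ forall i, op_adjoint (N i) (M i),
      forall i j x, N i (M j x) = M j (N i x) &
      forall i j x, M i (M j x) = M j (M i x)].
Proof.
have [nNi comN] := nN.
have /choice[M hM] : forall i, exists M, op_adjoint (N i) M /\ N i \o M = M \o N i.
  by move=> i; have [_ [B ? ?]] := nNi i; exists B.
have adj i : op_adjoint (N i) (M i) by case: (hM i).
exists M; split => //.
- move=> i j x.
  apply: (@fuglede _ _ (N j) (M j) (N i)) => //.
  + by case: (nNi j).
  + by move=> y; have [_ /(congr1 (fun f => f y))] := hM j.
  + by case: (nNi i).
  + by move=> y; have /(congr1 (fun f => f y)) := comN i j.
- move=> i j x; apply: ip_inj => y.
  rewrite !(op_adjoint_sym (adj _)).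
  by congr (inner _ _); have /(congr1 (fun f => f y)) := comN j i.
Qed.

Lemma uniform_bound (I : finType) (A : I -> H -> H) : (forall i, bnd (A i)) ->
  exists2 k : R, 0 < k & forall i x, nm (A i x) <= k * nm x.
Proof.
move=> bA; have /choice[k hk] : forall i, exists k : R, 0 <= k /\ forall x, nm (A i x) <= k * nm x.
  by move=> i; have [k k0 h] := bA i; exists k.
exists (\sum_i k i + 1).
  by rewrite ltr_wpDl// sumr_ge0// => i _; case: (hk i).
move=> i x; rewrite (le_trans ((hk i).2 x))// ler_wpM2r ?nm_ge0//.
rewrite (bigD1 i)//= -addrA lerDl addr_ge0// sumr_ge0// => j _.
by case: (hk j).
Qed.

(** Undoes the rescaling (S + k) / (2k) of [normal_parts]: the point of C^d whose rescaled real
    ([true]) and imaginary ([false]) parts are [th]. *)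
Definition cell_center (k : R) (th : 'I_d * bool -> R) : 'rV[C]_d :=
  \row_i ((2 * k * th (i, true) - k)%:C + 'i * (2 * k * th (i, false) - k)%:C).

Lemma cell_center_lip k th th' (t : R) i : 0 <= k -> (forall j, `|th j - th' j| <= t) ->
  nm (cell_center k th 0 i - cell_center k th' 0 i) <= 4 * k * t.
Proof.
move=> k0 h; rewrite !mxE.
have -> : forall a b a' b' : R, (a%:C + 'i * b%:C) - (a'%:C + 'i * b'%:C) =
    (a - a')%:C + 'i * (b - b')%:C.
  by move=> a b a' b'; rewrite !RCB; ring.
rewrite (le_trans (nm_triangle _ _))// nmM nmi mul1r !nmC.
have aux (u v : R) : `|u - v| <= t -> `|2 * k * u - k - (2 * k * v - k)| <= 2 * k * t.
  move=> uv; have -> : 2 * k * u - k - (2 * k * v - k) = 2 * k * (u - v) by ring.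
  by rewrite normrM ger0_norm ?mulr_ge0// ler_wpM2l// mulr_ge0.
have := aux _ _ (h (i, true)); have := aux _ _ (h (i, false)); lra.
Qed.

(* Affinely rescaled real and imaginary parts of the [N i]. *)
Lemma normal_parts : exists (k : R) (A : 'I_d * bool -> H -> H) (M : 'I_d -> H -> H),
  [/\ 0 < k,
      [/\ forall j, psd (A j), forall j, bnd (A j),
          forall j, psd (fun x => x - A j x) &
          forall i j x, A i (A j x) = A j (A i x)],
      forall i, op_adjoint (N i) (M i),
      forall th i x, N i x - cell_center k th 0 i *: x =
        (2 * k)%:C *: ((A (i, true) x - (th (i, true))%:C *: x) +
           'i *: (A (i, false) x - (th (i, false))%:C *: x)) &
      forall th i x, M i x - conjc (cell_center k th 0 i) *: x =
        (2 * k)%:C *: ((A (i, true) x - (th (i, true))%:C *: x) -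
           'i *: (A (i, false) x - (th (i, false))%:C *: x))].
Proof.
have [M [adj comNM comMM]] := normal_adjoints.
have [nNi comN] := nN.
have Nbd i : bounded_op (N i) by case: (nNi i).
have Mbd i : bounded_op (M i) := op_adjoint_bounded (Nbd i) (adj i).
have Nl i : linear (N i) by case: (Nbd i).
have Ml i : linear (M i) by case: (Mbd i).
(* Coefficients of [N] and of its adjoint in the real part (N + M) / 2 and the imaginary part (N -
   M) / (2i). *)
pose a (b : bool) : C := if b then 2^-1 else - 'i / 2.
pose b (b : bool) : C := if b then 2^-1 else 'i / 2.
pose S (j : 'I_d * bool) x := a j.2 *: N j.1 x + b j.2 *: M j.1 x.
have half2 : 2^-1 + 2^-1 = 1 :> C by field.
have ii : 'i * 'i = -1 :> C by rewrite -expr2 sqr_i.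
have conj_i : conjc 'i = - 'i :> C by apply/eqP; rewrite eq_complex /= oppr0 !eqxx.
have conj_h : conjc 2^-1 = 2^-1 :> C by rewrite -(RC_nat 2) -RCV conjc_real.
have conj_a c : conjc (a c) = b c.
  by case: c; rewrite /a /b ?conj_h// conjM conj_h conjN conj_i opprK.
have Sl j : linear (S j) by apply: linear_addf; exact: linear_scalef.
have Ss j : op_adjoint (S j) (S j).
  move=> x y; rewrite ipDl ipDr !ipZl !ipZr -conj_a conjcK conj_a adj.
  by rewrite (op_adjoint_sym (adj _)) addrC.
have Sb j : bnd (S j).
  have [_ n1] := (bounded_opP _).1 (Nbd j.1); have [_ n2] := (bounded_opP _).1 (Mbd j.1).
  exact: bnd_add (bnd_scale _ n1) (bnd_scale _ n2).
have Scom i j x : S i (S j x) = S j (S i x).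
  have e u v : N u (N v x) = N v (N u x) by have /(congr1 (fun f => f x)) := comN u v.
  rewrite /S !(linD (Nl _)) !(linD (Ml _)) !(linZ (Nl _)) !(linZ (Ml _)).
  rewrite !scalerDr !scalerA (e i.1) !comNM (comMM i.1) addrACA.
  rewrite [a i.2 * _]mulrC [b i.2 * a j.2]mulrC [b i.2 * b j.2]mulrC [a i.2 * b j.2]mulrC.
  by [].
have [k k0 Sk] := uniform_bound Sb.
(* Since -k <= S <= k, this lies between 0 and 1, as an operator-valued probability must. *)
pose A j x := (2 * k)^-1%:C *: (S j x + k%:C *: x).
have k2 : 0 < (2 * k)^-1 by rewrite invr_gt0 mulr_gt0.
have k2C : (2 * k)%:C != 0 by rewrite gt_eqF// ltcR mulr_gt0.
have SE j x : S j x = (2 * k)%:C *: A j x - k%:C *: x.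
  by rewrite /A scalerA RCV divff// scale1r addrK.
have Abs j x : - (k * nm x ^+ 2) <= complex.Re (inner (S j x) x) <= k * nm x ^+ 2.
  have h1 := Re_cauchy_schwarz (S j x) x; have := Re_cauchy_schwarz (- S j x) x.
  have h2 : nm (S j x) * nm x <= k * nm x ^+ 2.
    by rewrite expr2 mulrA ler_wpM2r ?nm_ge0.
  by rewrite ipNl ReN nmN => h3; apply/andP; split; lra.
exists k, A, M; split => //.
- split.
  + move=> j; split.
    * apply: linear_scalef; apply: linear_addf => //; exact: linear_scalef.
    * by move=> x y; rewrite ipZl ipZr conjc_real ipDl ipDr ipZl ipZr conjc_real Ss.
    * move=> x; rewrite ipZl ReRM mulr_ge0 ?(ltW k2)// ipDl ReD ipZl ReRM ipxx /=.
      have /andP[h _] := Abs j x; lra.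
  + by move=> j; apply: bnd_scale; apply: bnd_add => //; apply: bnd_scale; exact: bnd_id.
  + move=> j.
    have E x : x - A j x = (2 * k)^-1%:C *: (k%:C *: x - S j x).
      rewrite /A RCV RCM RC_nat; rewrite RCM RC_nat in k2C.
      move: (k%:C) k2C => kC k2C; apply: ip_inj => w; rewrite !(ipDl, ipNl, ipZl).
      by move: (inner x w) (inner (S j x) w) => u v; field; apply: contraNneq k2C => ->; rewrite mulr0.
    split.
    * apply: linear_subf => //; apply: linear_scalef; apply: linear_addf => //; exact: linear_scalef.
    * move=> x y; rewrite !E ipZl ipZr conjc_real ipBl ipBr ipZl ipZr conjc_real Ss//.
    * move=> x; rewrite E ipZl ReRM mulr_ge0 ?(ltW k2)// ipBl ReB ipZl ReRM ipxx Re_RC.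
      have /andP[_ h] := Abs j x; lra.
  + move=> i j x; rewrite /A (linZ (Sl i)) (linZ (Sl j)) (linD (Sl i)) (linD (Sl j)).
    rewrite (linZ (Sl i)) (linZ (Sl j)) Scom.
    by apply: ip_inj => w; rewrite !(ipDl, ipNl, ipZl); ring.
- move=> th i x.
  have NE : N i x = S (i, true) x + 'i *: S (i, false) x.
    rewrite /S /= scalerDr !scalerA addrACA -!scalerDl.
    have -> : 2^-1 + 'i * (- 'i / 2) = 1 :> C.
      by rewrite mulrA mulrN ii opprK mul1r half2.
    have -> : 2^-1 + 'i * ('i / 2) = 0 :> C by rewrite mulrA ii mulN1r subrr.
    by rewrite scale1r scale0r addr0.
  rewrite NE !SE mxE !RCB !(RCM (2 * k)).
  apply: ip_inj => w; rewrite !(ipDl, ipNl, ipZl); ring.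
- move=> th i x.
  have ME : M i x = S (i, true) x - 'i *: S (i, false) x.
    rewrite /S /= scalerDr !scalerA opprD addrACA -!scalerBl.
    have -> : 2^-1 - 'i * (- 'i / 2) = 0 :> C.
      by rewrite mulrA mulrN ii opprK mul1r subrr.
    have -> : 2^-1 - 'i * ('i / 2) = 1 :> C.
      by rewrite mulrA ii mulN1r opprK half2.
    by rewrite scale1r scale0r add0r.
  rewrite ME !SE mxE conjD conjM conj_i !conjc_real !RCB !(RCM (2 * k)).
  apply: ip_inj => w; rewrite !(ipDl, ipNl, ipZl); ring.
Qed.

End NormalTuple.

Section SpectralApproximation.
Context {R : realType} {H : hilbertType R}.
Local Notation C := R[i].
Variables (d : nat) (K : set 'rV[C]_d) (N : 'I_d -> H -> H).
Hypothesis nN : normal_tuple N.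
Hypothesis NK : joint_spectrum N `<=` K.

Lemma sum_sqr_le (I : finType) (f : I -> R) (i : I) (c : R) :
  \sum_j f j ^+ 2 <= c -> f i ^+ 2 <= c.
Proof.
apply: le_trans; rewrite (bigD1 i)//= lerDl sumr_ge0// => j _.
exact: sqr_ge0.
Qed.

(** Without a lower bound, unit vectors almost annihilated by every [A j - th j] are approximate
    joint eigenvectors of the [N i] and their adjoints, and the point belongs to the spectrum. *)
Lemma off_spectrum (k : R) (A : 'I_d * bool -> H -> H) (M : 'I_d -> H -> H)
    (th : 'I_d * bool -> R) : 0 < k -> (forall i, op_adjoint (N i) (M i)) ->
  (forall th i x, N i x - cell_center k th 0 i *: x =
        (2 * k)%:C *: ((A (i, true) x - (th (i, true))%:C *: x) +
           'i *: (A (i, false) x - (th (i, false))%:C *: x))) ->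
  (forall th i x, M i x - conjc (cell_center k th 0 i) *: x =
        (2 * k)%:C *: ((A (i, true) x - (th (i, true))%:C *: x) -
           'i *: (A (i, false) x - (th (i, false))%:C *: x))) ->
  (forall j, linear (A j)) ->
  ~ K (cell_center k th) ->
  exists2 dl : R, 0 < dl &
    forall x, dl * nm x ^+ 2 <= \sum_j nm (A j x - (th j)%:C *: x) ^+ 2.
Proof.
move=> k0 NM EN EM Al nK; apply: contrapT => h; apply: nK; apply: NK.
have [nNi _] := nN.
apply: (@joint_spectrum_approx _ _ d N M) => //; first by move=> i; case: (nNi i).
move=> e e0.
(* Errors [u] in the two parts give 2k (u + u) = e in [N i]. *)
pose u := e / (4 * k); have u0 : 0 < u by rewrite divr_gt0// mulr_gt0.
have [x hx] : exists x, \sum_j nm (A j x - (th j)%:C *: x) ^+ 2 < u ^+ 2 * nm x ^+ 2.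
  apply: contrapT => /forallNP hn; apply: h; exists (u ^+ 2); first by rewrite exprn_gt0.
  by move=> x; rewrite leNgt; apply/negP/hn.
have x0 : x != 0.
  apply: contraTneq hx => ->; rewrite nm0 expr0n /= mulr0 -leNgt sumr_ge0// => j _.
  exact: sqr_ge0.
have nx := nm_gt0 x0.
pose y := (nm x)^-1%:C *: x.
have ny : nm y = 1 by rewrite nmZ nmC ger0_norm ?invr_ge0 ?nm_ge0// mulVf// gt_eqF.
have hy j : nm (A j y - (th j)%:C *: y) <= u.
  have -> : A j y - (th j)%:C *: y = (nm x)^-1%:C *: (A j x - (th j)%:C *: x).
    by rewrite (linZ (Al j)) scalerBr !scalerA [(th j)%:C * _]mulrC.
  rewrite nmZ nmC ger0_norm ?invr_ge0 ?nm_ge0// mulrC ler_pdivrMr//.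
  have un : 0 <= u * nm x by rewrite mulr_ge0 ?nm_ge0 ?(ltW u0).
  rewrite -(@ler_pXn2r _ 2)// ?nnegrE ?nm_ge0//.
  rewrite exprMn; apply: (sum_sqr_le (f := fun j => nm (A j x - (th j)%:C *: x))).
  exact: ltW.
have k2 : 0 <= 2 * k by rewrite mulr_ge0// ltW.
have uE : 2 * k * (u + u) = e by rewrite /u; field; rewrite gt_eqF.
exists y => // i; rewrite EN EM !nmZ nmC ger0_norm// -uE.
split; rewrite ler_wpM2l//; first rewrite (le_trans (nm_triangle _ _))//.
  by rewrite nmZ nmi mul1r lerD ?hy.
by rewrite (le_trans (nm_triangleB _ _))// nmZ nmi mul1r lerD ?hy.
Qed.

Lemma sqr_dist_lower (a b t : R) : 0 <= a -> 0 <= b -> b <= a + t -> 0 <= t ->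
  b ^+ 2 / 2 - t ^+ 2 <= a ^+ 2.
Proof. move=> a0 b0 bat t0; have := sqr_ge0 (a - t); nra. Qed.

(* Unlike the points of [K], the other points of the cube have a neighbourhood on
   which [sum_j (A j - th j)^2] is bounded below; compactness makes the bound uniform. *)
Lemma uniform_gap (r k : R) (A : 'I_d * bool -> H -> H) (M : 'I_d -> H -> H) :
  0 < r -> 0 < k -> (forall i, op_adjoint (N i) (M i)) ->
  (forall th i x, N i x - cell_center k th 0 i *: x =
        (2 * k)%:C *: ((A (i, true) x - (th (i, true))%:C *: x) +
           'i *: (A (i, false) x - (th (i, false))%:C *: x))) ->
  (forall th i x, M i x - conjc (cell_center k th 0 i) *: x =
        (2 * k)%:C *: ((A (i, true) x - (th (i, true))%:C *: x) -
           'i *: (A (i, false) x - (th (i, false))%:C *: x))) ->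
  (forall j, linear (A j)) ->
  exists2 dl : R, 0 < dl & forall th : 'I_d * bool -> R, (forall j, 0 <= th j <= 1) ->
    (exists2 l, K l & forall i, nm (cell_center k th 0 i - l 0 i) <= r) \/
    forall x, dl * nm x ^+ 2 <= \sum_j nm (A j x - (th j)%:C *: x) ^+ 2.
Proof.
move=> r0 k0 NM EN EM Al.
have [|th _|n hn] := @cube_uniform R ('I_d * bool)%type (fun n th =>
   (exists2 l, K l & forall i, nm (cell_center k th 0 i - l 0 i) <= r) \/
    forall x, n.+1%:R^-1 * nm x ^+ 2 <= \sum_j nm (A j x - (th j)%:C *: x) ^+ 2).
- move=> n m th nm [h|h]; [by left|right] => x; apply: le_trans (h x).
  by rewrite ler_wpM2r ?sqr_ge0// lef_pV2 ?posrE// ler_nat ltnS.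
- have [Kth|nKth] := pselect (K (cell_center k th)).
    exists (r / (4 * k)), 0%N; split; first by rewrite divr_gt0// mulr_gt0.
    move=> th' h; left; exists (cell_center k th) => // i; rewrite nm_distC.
    rewrite (le_trans (@cell_center_lip _ _ k th th' (r / (4 * k)) i _ _))//.
    + exact: ltW.
    + by move=> j; rewrite ltW.
    + by rewrite mulrC divfK// gt_eqF// mulr_gt0.
  have [dl dl0 hd] := off_spectrum k0 NM EN EM Al nKth.
  pose m : R := #|{: 'I_d * bool}|%:R.
  have m0 : 0 <= m by exact: ler0n.
  (* Moving [th] by less than [t] halves the bound [dl] and costs m t^2 <= m t <= dl / 4, leaving dl
     / 4. *)
  pose t := Num.min 1 (dl / (4 * (m + 1))).
  have m1 : 0 < m + 1 by rewrite ltr_wpDl.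
  have t0 : 0 < t by rewrite lt_min ltr01 divr_gt0// mulr_gt0.
  have t1 : t <= 1 by rewrite ge_min lexx.
  have tm : m * t <= dl / 4.
    rewrite (le_trans (_ : _ <= (m + 1) * t))//.
      by rewrite ler_wpM2r ?(ltW t0)// lerDl.
    rewrite mulrC -ler_pdivlMr// /t ge_min; apply/orP; right.
    by rewrite invfM mulrA.
  have [n0 hn0] := @small_seq R (dl / 4) (divr_gt0 dl0 (ltr0Sn _ _)).
  exists t, n0; split => // th' h; right => x.
  have step : dl / 4 * nm x ^+ 2 <= \sum_j nm (A j x - (th' j)%:C *: x) ^+ 2.
    have low : \sum_j (nm (A j x - (th j)%:C *: x) ^+ 2 / 2 - t * nm x ^+ 2) <=
        \sum_j nm (A j x - (th' j)%:C *: x) ^+ 2.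
      apply: ler_sum => j _.
      apply: (@le_trans _ _ (nm (A j x - (th j)%:C *: x) ^+ 2 / 2 - (t * nm x) ^+ 2)).
        rewrite lerD2l lerN2 exprMn ler_wpM2r ?sqr_ge0// expr2 ler_piMr// ltW//.
      apply: sqr_dist_lower; rewrite ?nm_ge0 ?mulr_ge0 ?(ltW t0) ?nm_ge0//.
      rewrite (le_trans (nm_dist ((th' j)%:C *: x) _ _))// lerD2l -scalerBl nmZ -RCB nmC.
      by rewrite ler_wpM2r ?nm_ge0// distrC ltW.
    have sc (c : R) : \sum_(j : 'I_d * bool) c = m * c by rewrite sumr_const /m mulr_natl.
    apply: le_trans low; rewrite big_split /= -mulr_suml sc; have := hd x; have := sqr_ge0 (nm x); nra.
  apply: le_trans step; rewrite ler_wpM2r ?sqr_ge0//.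
  exact: hn0.
exists n.+1%:R^-1; first by rewrite invr_gt0.
exact: hn.
Qed.

(** Takes the place of a Riemann sum against the spectral measure; the [B i] are positive but need
    not be projections. The vector [x0] provides a point of [K]. *)
Theorem spectral_approximation (x0 : H) (r : R) : x0 != 0 -> 0 < r ->
  exists (I : finType) (l : I -> 'rV[C]_d) (B : I -> H -> H),
  [/\ forall i, K (l i), forall i, psd (B i), forall x, \sum_i B i x = x &
      forall j x, nm (N j x - \sum_i l i 0 j *: B i x) <= r * nm x].
Proof.
move=> x00 r0; have r2 : 0 < r / 2 by rewrite divr_gt0.
have [k [A [M [k0 [pA bA pA1 comA] NM EN EM]]]] := normal_parts nN.
have Al j : linear (A j) by case: (pA j).
have [dl dl0 gap] := uniform_gap r2 k0 NM EN EM Al.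
pose m : R := #|{: 'I_d * bool}|%:R.
have m0 : 0 <= m by exact: ler0n.
pose near th := exists2 l, K l & forall i, nm (cell_center k th 0 i - l 0 i) <= r / 2.
(* The cells far from [K] carry a small mass, by Chebyshev's inequality. *)
have part p : (0 < p)%N -> exists (I : finType) (q : I -> 'I_d * bool -> R) (B : I -> H -> H),
   [/\ forall i, psd (B i), forall i j, 0 <= q i j <= 1, forall x, \sum_i B i x = x,
       forall j x, \sum_i cell_center k (q i) 0 j *: B i x = N j x &
       forall x, \sum_(i | ~~ `[< near (q i) >]) complex.Re (inner (B i x) x) <=
          m / dl / p%:R * nm x ^+ 2].
  move=> p0; have [I [q [B [pB q01 B1 Bq var]]]] := binomial_partition pA bA pA1 comA p0.
  exists I, q, B; split => //; first by move=> i; case: (pB i).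
    move=> j x; have := EN (fun=> 0) j x.
    rewrite !scale0r !subr0 => /eqP; rewrite subr_eq => /eqP ->.
    rewrite -[X in _ + _ *: X](B1 x) -!Bq.
    rewrite !scaler_sumr -big_split /= scaler_sumr -big_split /=; apply: eq_bigr => i _.
    rewrite !mxE !mulr0 !sub0r !RCB !(RCM (2 * k)) !RCN.
    by apply: ip_inj => w; rewrite !(ipDl, ipNl, ipZl); ring.
  move=> x; have p0' : 0 < p%:R :> R by rewrite ltr0n.
  rewrite mulrAC -mulrA mulrAC mulrA ler_pdivlMr// mulrC mulr_sumr.
  apply: (@le_trans _ _ (\sum_i \sum_j complex.Re (inner (B i (A j x - (q i j)%:C *: x))
        (A j x - (q i j)%:C *: x)))).
    rewrite big_mkcond /=; apply: ler_sum => i _; have [pBi comB] := pB i.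
    have [Bl Bs B0] := pBi.
    have t0 : 0 <= \sum_j complex.Re (inner (B i (A j x - (q i j)%:C *: x))
        (A j x - (q i j)%:C *: x)) by apply: sumr_ge0.
    case: ifPn => // /asboolP nn; have [//|gi] := gap (q i) (q01 i).
    (* The operator sum_j (A_j - q_ij)^2. As D - dl is positive and commutes with [B i], their
       product is positive, which bounds the mass of a far cell by its share of the variance. *)
    pose D y := \sum_j (A j (A j y - (q i j)%:C *: y) - (q i j)%:C *: (A j y - (q i j)%:C *: y)).
    have Dl : linear D.
      apply: linear_sumf => j; have l1 : linear (fun y => A j y - (q i j)%:C *: y).
        by apply: linear_subf => //; exact: linear_scalef.
      apply: linear_subf; first exact: (linear_compo (Al j) l1).
      exact: linear_scalef.
    have Dip u v : inner (D u) v = \sum_j inner (A j u - (q i j)%:C *: u) (A j v - (q i j)%:C *: v).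
      rewrite ip_suml; apply: eq_bigr => j _; have [_ Ajs _] := pA j.
      by rewrite ipBl ipZl Ajs [RHS]ipBr ipZr conjc_real.
    have DB : psd (fun y => D y - dl%:C *: y).
      split.
      - by apply: linear_subf => //; exact: linear_scalef.
      - move=> u v; rewrite ipBl ipBr ipZl ipZr conjc_real Dip [inner u (D v)]ipC Dip conj_sum.
        by congr (_ - _); apply: eq_bigr => j _; rewrite -ipC.
      - move=> u; rewrite ipBl ReB ipZl ReRM ipxx Dip Re_sum subr_ge0.
        rewrite (le_trans (gi u))// le_eqVlt; apply/orP; left; apply/eqP.
        by apply: eq_bigr => j _; rewrite ipxx.
    have Db : bnd (fun y => D y - dl%:C *: y).
      apply: bnd_add; last by apply/bnd_opp/bnd_scale/bnd_id.
      apply: bnd_sum => j.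
      have b1 : bnd (fun y => A j y - (q i j)%:C *: y).
        by apply: bnd_add => //; apply/bnd_opp/bnd_scale/bnd_id.
      apply: bnd_add; first exact: (bnd_comp (bA j) b1).
      exact/bnd_opp/bnd_scale.
    have comA' j y : B i (A j y - (q i j)%:C *: y) = A j (B i y) - (q i j)%:C *: B i y.
      by rewrite (linB Bl) (linZ Bl) comB.
    have [_ _ pos] : psd (fun y => D (B i y) - dl%:C *: B i y).
      apply: (psd_mul DB Db pBi) => y.
      rewrite (linB Bl) (linZ Bl) /D (lin_sum Bl); congr (_ - _).
      by apply: eq_bigr => j _; rewrite (linB Bl) (linZ Bl) comB !comA'.
    have := pos x; rewrite ipBl ReB ipZl ReRM subr_ge0 mulrC => /le_trans; apply.
    rewrite Dip Re_sum le_eqVlt; apply/orP; left; apply/eqP.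
    by apply: eq_bigr => j _; rewrite comA'.
  rewrite exchange_big /= (le_trans (ler_sum _ (fun j _ => var j x)))//.
  by rewrite sumr_const /m -mulrA mulr_natl.
have nx0 : 0 < nm x0 ^+ 2 by rewrite exprn_gt0// nm_gt0.
(* If every cell were far from [K], all of the mass of [x0] would be at most half of itself. *)
have [l0 Kl0] : exists l0, K l0.
  have [p p0 hp] := @arch_inv R (m / dl) (1 / 2) (divr_gt0 ltr01 (ltr0Sn _ _)).
  have [I [q [B [pB _ B1 _ out]]]] := part p p0.
  have [[i [l Kl _]]|/forallNP h] := pselect (exists i, near (q i)); first by exists l.
  have := out x0; under eq_bigl => i do rewrite asboolF//.
  rewrite -Re_sum -ip_suml B1 ipxx Re_RC; nra.
pose Cc i := 2 * (4 * k) + nm (cell_center k (fun=> 0) 0 i - l0 0 i).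
have CcP (th : 'I_d * bool -> R) i : (forall j, 0 <= th j <= 1) ->
    nm (cell_center k th 0 i - l0 0 i) <= Cc i.
  move=> th01; rewrite (le_trans (nm_dist (cell_center k (fun=> 0) 0 i) _ _))// lerD2r.
  rewrite (le_trans (@cell_center_lip _ d k th (fun=> 0) 1 i _ _)) ?mulr1 ?(ltW k0)//.
    by move=> j; have /andP[h0 h1] := th01 j; rewrite subr0 ger0_norm.
  by rewrite ler_peMl ?mulr_ge0 ?(ltW k0)// ler1n.
have Cc0 i : 0 <= Cc i by rewrite addr_ge0 ?nm_ge0// !mulr_ge0// ltW.
pose Ct := \sum_i Cc i; have Ct0 : 0 <= Ct by exact: sumr_ge0.
have CcC i : Cc i <= Ct by rewrite /Ct (bigD1 i)//= lerDl sumr_ge0.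
(* Far cells are sent to [l0], at distance at most [Ct]; this [p] makes their total contribution at
   most r / 2. *)
have [p p0 hp] := arch_inv (Ct * (m / dl)) r2.
have [I [q [B [pB q01 B1 BN out]]]] := part p p0.
have /choice[l hl] : forall i, exists l, [/\ K l,
    near (q i) -> forall j, nm (cell_center k (q i) 0 j - l 0 j) <= r / 2 &
    ~ near (q i) -> forall j, nm (cell_center k (q i) 0 j - l 0 j) <= Ct].
  move=> i; have [[l Kl hl]|ni] := pselect (near (q i)).
    by exists l; split => // nn; case: nn; exists l.
  exists l0; split => // _ j; rewrite (le_trans _ (CcC j))//; exact: CcP.
exists I, l, B; split => // [i|j x]; first by case: (hl i).
rewrite -BN -sumrB; under eq_bigr => i _ do rewrite -scalerBl.
apply: psd_sum_bound => // {}x.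
have B0 i y : 0 <= complex.Re (inner (B i y) y) by have [_ _] := pB i; exact.
apply: (@le_trans _ _ (\sum_i r / 2 * complex.Re (inner (B i x) x) +
    \sum_(i | ~~ `[< near (q i) >]) Ct * complex.Re (inner (B i x) x))).
  rewrite [X in _ + X]big_mkcond -big_split /=; apply: ler_sum => i _.
  have [_ h1 h2] := hl i; case: ifPn => [/asboolP ni|/negPn/asboolP ni].
    rewrite -mulrDl ler_wpM2r// (le_trans (h2 ni j))// lerDr ltW//.
  by rewrite addr0 ler_wpM2r// h1.
rewrite -!mulr_sumr -Re_sum -ip_suml B1 ipxx Re_RC.
have h := ler_wpM2l Ct0 (out x); rewrite [leRHS]mulrA in h.
rewrite (le_trans (lerD (lexx _) h))// -mulrDl ler_wpM2r ?sqr_ge0//.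
by rewrite [leRHS]splitr lerD2l mulrA.
Qed.

End SpectralApproximation.

(** * Compact operators and finite rank approximation *)

Section GramSchmidt.
Context {R : realType} {H : hilbertType R}.
Local Notation C := R[i].
Variables (B : H -> H) (pB : psd B).

(** Projection for the semi-inner product <B x, y>. With the identity it gives orthonormal bases;
    with a partition operator it splits that operator into rank one pieces. *)
Definition proj_on (e : seq H) x := \sum_(u <- e) inner (B x) u *: u.

Definition orthonormal_for (e : seq H) := forall i j, (i < size e)%N -> (j < size e)%N ->
  inner (B e`_i) e`_j = (i == j)%:R.

Let Bl : linear B. Proof. by case: pB. Qed.
Let Bs : op_adjoint B B. Proof. by case: pB. Qed.

Lemma proj_on_linear e : linear (proj_on e).
Proof.
by move=> a x y; rewrite /proj_on scaler_sumr -big_split /=; apply: eq_bigr => u _;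
   rewrite Bl ipDl ipZl scalerDl scalerA.
Qed.

Lemma proj_on_nth e x : proj_on e x = \sum_(i < size e) inner (B x) e`_i *: e`_i.
Proof. by rewrite /proj_on (big_nth 0) big_mkord. Qed.

Lemma proj_on_inner e x i : orthonormal_for e -> (i < size e)%N ->
  inner (B (proj_on e x)) e`_i = inner (B x) e`_i.
Proof.
move=> oe ie; rewrite proj_on_nth (lin_sum Bl) ip_suml (bigD1 (Ordinal ie))//= big1.
  by rewrite addr0 (linZ Bl) ipZl oe// eqxx mulr1.
move=> j ji; rewrite (linZ Bl) ipZl oe//.
by rewrite -[_ == i]/(j == Ordinal ie :> 'I_ _) (negPf ji) mulr0.
Qed.

Lemma gram_schmidt (s : seq H) : exists e, orthonormal_for e /\
  forall v, v \in s -> forall y, inner (B (v - proj_on e v)) y = 0.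
Proof.
elim: s => [|a s [e [oe hs]]]; first by exists [::].
pose a' := a - proj_on e a.
have a'e i : (i < size e)%N -> inner (B a') e`_i = 0.
  by move=> ie; rewrite (linB Bl) ipBl proj_on_inner// subrr.
(* The form may be degenerate: a residue of length zero cannot be normalized, but [B] kills it by
   [psd_null]. *)
have [n0|n0] := eqVneq (complex.Re (inner (B a') a')) 0.
  exists e; split => // v; rewrite inE => /orP[/eqP -> y|/hs//].
  exact: psd_null.
have npos : 0 < complex.Re (inner (B a') a').
  by rewrite lt_neqAle eq_sym n0/=; case: pB.
pose n := Num.sqrt (complex.Re (inner (B a') a')).
have n_gt0 : 0 < n by rewrite sqrtr_gt0.
have nC : n%:C != 0 by rewrite gt_eqF// ltcR.
have aa : inner (B a') a' = n%:C ^+ 2.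
  rewrite -RCX sqr_sqrtr ?ltW//; apply: Re_real.
  by rewrite -ipC Bs.
pose u := n^-1%:C *: a'.
have uu : inner (B u) u = 1.
  by rewrite (linZ Bl) ipZl ipZr conjc_real aa RCV; field.
have ue i : (i < size e)%N -> inner (B u) e`_i = 0.
  by move=> ie; rewrite (linZ Bl) ipZl a'e// mulr0.
have eu i : (i < size e)%N -> inner (B e`_i) u = 0.
  by move=> ie; rewrite Bs ipC ue// conjc0.
have proj_u x : inner (B (proj_on e x)) u = 0.
  rewrite proj_on_nth (lin_sum Bl) ip_suml big1// => i _.
  by rewrite (linZ Bl) ipZl eu// mulr0.
exists (u :: e); split.
  move=> [|i] [|j] //= ie je; rewrite ?uu//.
  - by rewrite ue.
  - by rewrite eu.
  - by rewrite oe// eqSS.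
have projE x : proj_on (u :: e) x = inner (B x) u *: u + proj_on e x.
  by rewrite /proj_on big_cons.
move=> v; rewrite inE => /orP[/eqP ->|vs] y; rewrite projE opprD addrCA addrC -/a'.
  have -> : inner (B a) u = n%:C.
    have -> : a = a' + proj_on e a by rewrite subrK.
    rewrite (linD Bl) ipDl proj_u addr0 ipZr conjc_real aa RCV; field.
    exact: nC.
  by rewrite scalerA RCV divff// scale1r subrr (lin0 Bl) ip0l.
have -> : inner (B v) u = 0.
  have -> : v = (v - proj_on e v) + proj_on e v by rewrite subrK.
  by rewrite (linD Bl) ipDl proj_u addr0 hs.
by rewrite scale0r subr0 hs.
Qed.

Lemma parseval e v w : (forall y, inner (B (v - proj_on e v)) y = 0) ->
  inner (B v) w = \sum_(u <- e) inner (B v) u * conjc (inner (B w) u).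
Proof.
move=> hv; have -> : inner (B v) w = inner (B (proj_on e v)) w.
  by have := hv w; rewrite (linB Bl) ipBl => /eqP; rewrite subr_eq0 => /eqP.
rewrite /proj_on (lin_sum Bl) ip_suml; apply: eq_bigr => u _.
by rewrite (linZ Bl) ipZl (Bs u w) [inner u _]ipC.
Qed.

End GramSchmidt.

Section TotallyBounded.
Context {R : realType}.
Local Notation C := R[i].

(** Compactness by finite nets, convenient for sums, compositions and limits; for bounded operators
    on a Hilbert space it agrees with [compact_op]. *)
Definition tb (U V : normedModType C) (A : U -> V) := forall e : R, 0 < e ->
  exists s : seq V, forall x, nm x <= 1 -> exists2 y, y \in s & nm (A x - y) <= e.

Lemma tb_add (U V : normedModType C) (A B : U -> V) :
  tb A -> tb B -> tb (fun x => A x + B x).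
Proof.
move=> hA hB e e0; have e2 : 0 < e / 2 by rewrite divr_gt0.
have [s hs] := hA _ e2; have [t ht] := hB _ e2.
exists [seq a + b | a <- s, b <- t] => x x1.
have [a as_ ha] := hs x x1; have [b bt hb] := ht x x1.
exists (a + b); first by apply/allpairsP; exists (a, b).
by rewrite opprD addrACA (le_trans (nm_triangle _ _))// [leRHS]splitr lerD.
Qed.

Lemma tb_zero (U V : normedModType C) : tb (fun x : U => 0 : V).
Proof. by move=> e e0; exists [:: 0] => x _; exists 0; rewrite ?inE// subrr nm0 ltW. Qed.

Lemma tb_sum (U V : normedModType C) (I : Type) (r : seq I) (A : I -> U -> V) :
  (forall i, tb (A i)) -> tb (fun x => \sum_(i <- r) A i x).
Proof.
move=> h; elim: r => [|i r IH].
  by under eq_fun => x do rewrite big_nil; exact: tb_zero.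
by under eq_fun => x do rewrite big_cons; exact: tb_add.
Qed.

Lemma tb_comp (U V W X : normedModType C) (D : W -> X) (A : V -> W) (B : U -> V) :
  linear D -> bnd D -> linear A -> bnd B -> tb A -> tb (fun x => D (A (B x))).
Proof.
move=> Dl [M M0 DM] Al [k k0 Bk] hA e e0.
have k1 : 0 < k + 1 by rewrite ltr_wpDl.
have M1 : 0 < M + 1 by rewrite ltr_wpDl.
have e1 : 0 < e / (M + 1) / (k + 1) by rewrite !divr_gt0.
have [s hs] := hA _ e1.
(* [B] maps the unit ball into the ball of radius k + 1, so the net for [A] is used after scaling
   down and then scaled back. *)
exists [seq D ((k + 1)%:C *: a) | a <- s] => x x1.
have k1C : (k + 1)%:C != 0 by rewrite gt_eqF// ltcR.
have [|a as_ ha] := hs ((k + 1)^-1%:C *: B x).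
  rewrite nmZ nmC ger0_norm ?invr_ge0 ?(ltW k1)// mulrC ler_pdivrMr// mul1r.
  rewrite (le_trans (Bk _))// (le_trans (ler_wpM2l k0 x1))// mulr1 lerDl//.
exists (D ((k + 1)%:C *: a)); first by rewrite map_f.
have -> : D (A (B x)) - D ((k + 1)%:C *: a) =
    D ((k + 1)%:C *: (A ((k + 1)^-1%:C *: B x) - a)).
  by rewrite (linZ Al) scalerBr scalerA RCV divff// scale1r -(linB Dl).
rewrite (le_trans (DM _))// nmZ nmC ger0_norm ?(ltW k1)//.
rewrite (@le_trans _ _ (M * (e / (M + 1))))//.
  by rewrite ler_wpM2l// mulrC -ler_pdivlMr.
by rewrite mulrCA ler_piMr ?(ltW e0)// ler_pdivrMr// mul1r lerDl.
Qed.

Lemma tb_limit (U V : normedModType C) (A : U -> V) :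
  (forall e : R, 0 < e -> exists2 B, tb B & forall x, nm (A x - B x) <= e * nm x) -> tb A.
Proof.
move=> h e e0; have e2 : 0 < e / 2 by rewrite divr_gt0.
have [B hB AB] := h _ e2; have [s hs] := hB _ e2; exists s => x x1.
have [y ys hy] := hs x x1; exists y => //.
rewrite (le_trans (nm_dist (B x) _ _))// [leRHS]splitr lerD// (le_trans (AB x))//.
by rewrite ler_piMr// ltW.
Qed.

Lemma tb_scalar : tb (fun z : C => z).
Proof.
move=> e e0; have e2 : 0 < e / 2 by rewrite divr_gt0.
have [n n0 hn] := @arch_inv R 1 (e / 2) e2.
have nn : 0 < n%:R :> R by rewrite ltr0n.
(* A grid of mesh 1/n from -1 to 1; truncating (x + 1) n picks the grid point just below [x]. *)
pose g (k : nat) : R := (k%:R - n%:R) / n%:R.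
exists [seq (g a)%:C + 'i * (g b)%:C | a <- iota 0 (n + n).+1, b <- iota 0 (n + n).+1] => z z1.
have approx (x : R) : `|x| <= 1 -> exists2 k, (k < (n + n).+1)%N & `|x - g k| <= e / 2.
  move=> x1; have /andP[xl xr] : -1 <= x <= 1 by rewrite -ler_norml.
  have t0 : 0 <= x * n%:R + n%:R by nra.
  exists (Num.truncn (x * n%:R + n%:R)).
    rewrite ltnS -(@ler_nat R) natrD; have /andP[h1 _] := truncn_itv t0.
    by rewrite (le_trans h1)// lerD2r ler_piMl.
  have /andP[h1 h2] := truncn_itv t0.
  set k := Num.truncn _ in h1 h2 *; rewrite (le_trans _ hn)//.
  have -> : x - g k = (x * n%:R + n%:R - k%:R) / n%:R by rewrite /g; field; rewrite gt_eqF.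
  rewrite normrM [`|n%:R^-1|]ger0_norm ?invr_ge0 ?ler0n// ler_wpM2r ?invr_ge0 ?ler0n//.
  by rewrite ger0_norm ?subr_ge0// lerBlDl -natr1 in h2 *; rewrite ltW// addrC natr1.
have rez : `|complex.Re z| <= 1 by rewrite (le_trans _ z1)// -lecR -nmE normc_ge_Re.
have imz : `|complex.Im z| <= 1.
  rewrite (le_trans _ z1)//.
  have -> : complex.Im z = complex.Re (- 'i * z).
    by case: z {z1 rez} => a b /=; rewrite oppr0 mul0r sub0r mulN1r opprK.
  by rewrite -(mul1r (nm z)) -nmi -nmN -nmM -lecR -nmE normc_ge_Re.
have [a ha ra] := approx _ rez; have [b hb ib] := approx _ imz.
exists ((g a)%:C + 'i * (g b)%:C).
  by apply/allpairsP; exists (a, b); rewrite !mem_iota.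
rewrite (le_trans (nm_le_ReIm _))// [leRHS]splitr lerD//.
  by rewrite ReB ReD Re_RC /= !mul0r mulr0 subr0 addr0.
by rewrite ImB /= !mul0r mul1r !add0r.
Qed.

End TotallyBounded.

Section CompactOperators.
Context {R : realType}.
Local Notation C := R[i].

Lemma compact_op_tb (H : hilbertType R) (A : H -> H) : compact_op A -> tb A.
Proof.
move=> [_]; rewrite precompactE compact_cover => cA e e0.
have e0C : 0 < e%:C by rewrite ltcR.
have [||D _ AD] := cA H setT (fun v => ball v e%:C).
- by move=> v _; exact: ball_open.
- by move=> v _; exists v => //; exact: ballxx.
exists (finmap.enum_fset D) => x x1.
have [|v /= vD] := AD (A x).
  by apply: subset_closure; exists x => //=; rewrite nmE lecR.
rewrite -ball_normE /= nmE ltcR nm_distC => h.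
by exists v => //; exact: ltW.
Qed.

(** A finite net covers the closure of the image by small balls, and an ultrafilter must contain one
    of them: it is Cauchy, hence convergent. *)
Lemma tb_compact_op (H : hilbertType R) (A : H -> H) : bounded_op A -> tb A -> compact_op A.
Proof.
move=> Abd tA; split => //; rewrite precompactE compact_ultra => F UF FA.
have FF : ProperFilter F by exact: ultra_proper.
set X := A @` _ in FA.
have Fc : cauchy_ex F.
  move=> e e0; have ne : 0 < nm e / 3 by rewrite divr_gt0// nm_gt0// gt_eqF.
  have [s hs] := tA _ ne.
  have cover : closure X `<=` [set y | exists2 v, v \in s & ball v e y].
    move=> y /(_ (ball y (nm e / 3)%:C)) [].
      by apply: nbhsx_ballx; rewrite ltcR.
    move=> z [[x /= x1 <-]]; rewrite -ball_normE /= nmE ltcR => yz.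
    have [|v vs hv] := hs x; first by move: x1; rewrite nmE lecR.
    exists v => //; rewrite nmE (ge0_nm (ltW e0)) ltcR.
    rewrite nm_distC (le_lt_trans (nm_dist (A x) _ _))//.
    have : nm (y - A x) + nm (A x - v) < nm e / 3 + nm e / 3 by rewrite ltr_leD.
    by move=> /lt_trans; apply; lra.
  have {}FA : F [set y | exists2 v, v \in s & ball v e y] by apply: filterS FA.
  elim: s {hs cover} FA => [|v s IH] FA.
    by have [y [v]] := filter_ex FA.
  have [FB|FB] := in_ultra_setVsetC (ball v e) UF; first by exists v.
  apply: IH; apply: filterS (filterI FA FB) => y [[w]].
  by rewrite inE => /orP[/eqP ->|ws] // hw _; exists w.
have /cvg_ex [p Fp] : cvg F by apply: cauchy_cvg; exact: cauchy_exP.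
exists p; split => //; apply: closed_closure => B Bp.
by apply: (@filter_ex _ F); apply: filterI => //; exact: Fp.
Qed.

End CompactOperators.

Section FiniteRankApproximation.
Context {R : realType} {H : hilbertType R}.
Local Notation C := R[i].
Implicit Types (A B : H -> H) (e s : seq H).

Definition onb e := orthonormal_for (id : H -> H) e.
Definition pr e := proj_on (id : H -> H) e.

Lemma pr_linear e : linear (pr e). Proof. exact: proj_on_linear psd_id _. Qed.

Lemma pr_sym e x y : inner (pr e x) y = inner x (pr e y).
Proof.
rewrite ip_suml ip_sumr; apply: eq_bigr => u _.
by rewrite ipZl ipZr -ipC mulrC.
Qed.

Lemma pr_idem e x : onb e -> pr e (pr e x) = pr e x.
Proof.
move=> oe; rewrite /pr !(proj_on_nth (id : H -> H)).
apply: eq_bigr => i _; congr (_ *: _).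
by rewrite -(proj_on_inner psd_id x oe (ltn_ord i)) /= proj_on_nth.
Qed.

Lemma pr_pythagoras e x : onb e -> nm x ^+ 2 = nm (pr e x) ^+ 2 + nm (x - pr e x) ^+ 2.
Proof.
move=> oe; have {1}-> : x = pr e x + (x - pr e x) by rewrite addrC subrK.
rewrite nm_sqrD pr_sym (linB (pr_linear e)) pr_idem// subrr ip0r /=.
by rewrite mulr0 addr0.
Qed.

Lemma pr_contract e x : onb e -> nm (pr e x) <= nm x.
Proof.
move=> oe; rewrite -(@ler_pXn2r _ 2)// ?nnegrE ?nm_ge0// [leRHS](pr_pythagoras x oe).
by rewrite lerDl sqr_ge0.
Qed.

Lemma pr_co_contract e x : onb e -> nm (x - pr e x) <= nm x.
Proof.
move=> oe; rewrite -(@ler_pXn2r _ 2)// ?nnegrE ?nm_ge0// [leRHS](pr_pythagoras x oe).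
by rewrite lerDr sqr_ge0.
Qed.

Lemma exists_onb s : exists2 e, onb e & forall v, v \in s -> pr e v = v.
Proof.
have [e [oe hs]] := gram_schmidt (psd_id (H := H)) s; exists e => // v vs.
apply/eqP; rewrite eq_sym -subr_eq0; apply/eqP; apply: ip_inj => y.
by rewrite ip0l hs.
Qed.

(** Stated for every orthonormal [e] whose span contains the net, so that one [e] can serve all the
    [T i] and their adjoints. *)
Lemma tb_range_approx A (c : R) : linear A -> tb A -> 0 < c ->
  exists s, forall e, onb e -> (forall v, v \in s -> pr e v = v) ->
    forall x, nm (A x - pr e (A x)) <= c * nm x.
Proof.
move=> Al tA c0; have [s hs] := tA c c0; exists s => e oe es x.
have [->|x0] := eqVneq x 0.
  by rewrite (lin0 Al) (lin0 (pr_linear e)) subrr nm0 mulr0.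
have nx := nm_gt0 x0.
have [|v vs hv] := hs ((nm x)^-1%:C *: x).
  by rewrite nmZ nmC ger0_norm ?invr_ge0 ?nm_ge0// mulVf// gt_eqF.
rewrite (linZ Al) in hv.
have h : nm ((nm x)^-1%:C *: (A x - pr e (A x))) <= c.
  apply: le_trans hv; rewrite scalerBr -(linZ (pr_linear e)).
  set w := _ *: A x; have -> : w - pr e w = (w - v) - pr e (w - v).
    by rewrite (linB (pr_linear e)) (es v vs) opprB addrA subrK.
  exact: pr_co_contract.
by move: h; rewrite nmZ nmC ger0_norm ?invr_ge0 ?nm_ge0// mulrC ler_pdivrMr.
Qed.

Lemma rank_one_linear (u v : H) : linear (fun x => inner x u *: v).
Proof. by move=> a x y; rewrite ipDl ipZl scalerDl scalerA. Qed.

Lemma rank_one_bnd (u v : H) : bnd (fun x => inner x u *: v).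
Proof.
exists (nm u * nm v) => [|x]; first by rewrite mulr_ge0 ?nm_ge0.
by rewrite nmZ mulrAC ler_wpM2r ?nm_ge0// mulrC cauchy_schwarz.
Qed.

Lemma tb_rank_one (u v : H) : tb (fun x => inner x u *: v).
Proof.
apply: (@tb_comp _ H C C H (fun z => z *: v) (fun z => z) (fun x => inner x u)) => //.
- by move=> a z w; rewrite scalerDl scalerA.
- by exists (nm v) => [|z]; rewrite ?nm_ge0// nmZ mulrC.
- by exists (nm u) => [|z]; rewrite ?nm_ge0// mulrC cauchy_schwarz.
- exact: tb_scalar.
Qed.

Lemma tb_finite_rank A e : linear A -> tb (fun x => A (pr e x)).
Proof.
move=> Al.
have -> : (fun x => A (pr e x)) = fun x => \sum_(u <- e) inner x u *: A u.
  by apply/funext => x; rewrite /pr /proj_on (lin_sum Al); apply: eq_bigr => u _; rewrite (linZ Al).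
by apply: tb_sum => u; exact: tb_rank_one.
Qed.

(** Schauder's theorem: B - B P is the adjoint of A - P A, so [B] is a norm limit of finite rank
    operators. *)
Lemma tb_adjoint A B : bounded_op A -> op_adjoint A B -> tb A -> tb B.
Proof.
move=> Abd AB tA; have [Al Ab] := (bounded_opP _).1 Abd.
have [Bl Bb] := (bounded_opP _).1 (op_adjoint_bounded Abd AB).
apply: tb_limit => c c0.
have [s hs] := tb_range_approx Al tA c0; have [e oe es] := exists_onb s.
exists (fun x => B (pr e x)); first exact: tb_finite_rank.
apply: (@op_adjoint_bound _ _ (fun x => A x - pr e (A x)) (fun x => B x - B (pr e x)) c).
- exact: ltW.
- exact: hs.
- by move=> x y; rewrite ipBl ipBr pr_sym !AB.
Qed.

(** T - P T P = (T - P T) + P (T - T P), where T - T P is the adjoint of S - P S for S the adjoint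
    of T. *)
Lemma compression_approx (d : nat) (T : 'I_d -> H -> H) (s0 : seq H) (c : R) :
  (forall i, bounded_op (T i)) -> (forall i, tb (T i)) -> 0 < c ->
  exists e, [/\ onb e, forall v, v \in s0 -> pr e v = v &
    forall i x, nm (T i x - pr e (T i (pr e x))) <= c * nm x].
Proof.
move=> Tb tT c0; have c2 : 0 < c / 2 by rewrite divr_gt0.
have /choice[s hs] : forall i, exists s, forall e, onb e -> (forall v, v \in s -> pr e v = v) ->
    forall x, nm (T i x - pr e (T i (pr e x))) <= c * nm x.
  move=> i; have [Tl Tbd] := (bounded_opP _).1 (Tb i).
  have [S TS] := adjoint_exists (Tb i); have Sb := op_adjoint_bounded (Tb i) TS.
  have [s hs] := tb_range_approx Tl (tT i) c2.
  have [Sl _] := (bounded_opP _).1 Sb.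
  have [t ht] := tb_range_approx Sl (tb_adjoint (Tb i) TS (tT i)) c2.
  exists (s ++ t) => e oe est x.
  have h1 y : nm (T i y - pr e (T i y)) <= c / 2 * nm y.
    by apply: hs => // v vs; apply: est; rewrite mem_cat vs.
  have h2 y : nm (T i y - T i (pr e y)) <= c / 2 * nm y.
    apply: (@op_adjoint_bound _ _ (fun x => S x - pr e (S x)) (fun x => T i x - T i (pr e x)) (c / 2)).
    - exact: ltW.
    - by apply: ht => // v vt; apply: est; rewrite mem_cat vt orbT.
    - by move=> u v; rewrite ipBl ipBr pr_sym !(op_adjoint_sym TS).
  rewrite (le_trans (nm_dist (pr e (T i x)) _ _))// [c in leRHS]splitr mulrDl lerD//.
  by rewrite -(linB (pr_linear e)) (le_trans (pr_contract _ oe)).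
have [e oe es] := exists_onb (s0 ++ flatten [seq s i | i <- enum 'I_d]).
exists e; split => // [v vs|i x].
  by apply: es; rewrite mem_cat vs.
apply: hs => // v vs; apply: es; rewrite mem_cat; apply/orP; right.
by apply/flattenP; exists (s i) => //; apply: map_f; rewrite mem_enum.
Qed.

End FiniteRankApproximation.

(** * Compressions *)

Section Polarization.
Context {R : realType} {H L : hilbertType R}.
Local Notation C := R[i].

(** [dilation] states the isometry on the diagonal only; testing at x + y and x + i y recovers the
    off-diagonal values. *)
Lemma polarization (U : H -> L) (P : H -> H) : linear U -> linear P ->
  (forall x, inner (U x) (U x) = inner (P x) x) ->
  forall x y, inner (U x) (U y) = inner (P x) y.
Proof.
move=> Ul Pl UP x y.
have h1 : inner (U x) (U y) + inner (U y) (U x) = inner (P x) y + inner (P y) x.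
  have := UP (x + y); rewrite (linD Ul) (linD Pl) !ipDl !ipDr !UP.
  rewrite -!addrA => /addrI; rewrite !addrA => /addIr.
  exact.
have h2 : - 'i * inner (U x) (U y) + 'i * inner (U y) (U x) =
    - 'i * inner (P x) y + 'i * inner (P y) x.
  have := UP (x + 'i *: y); rewrite (linD Ul) (linD Pl) (linZ Ul) (linZ Pl).
  have ci : conjc 'i = - 'i :> C by apply/eqP; rewrite eq_complex /= oppr0 !eqxx.
  rewrite !ipDl !ipDr !ipZl !ipZr !UP ci => h.
  have {}h : inner (P x) x + (- 'i * inner (U x) (U y) + 'i * inner (U y) (U x)) +
       'i * (- 'i * inner (P y) y) =
     inner (P x) x + (- 'i * inner (P x) y + 'i * inner (P y) x) + 'i * (- 'i * inner (P y) y).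
    by rewrite !addrA -[X in X + _ = _]addrA -[X in _ = X + _]addrA in h *; rewrite h.
  by move/addIr: h => /addrI.
have i0 : 'i != 0 :> C by rewrite eq_complex /= oner_eq0 andbF.
have h3 : - inner (U x) (U y) + inner (U y) (U x) = - inner (P x) y + inner (P y) x.
  by apply: (mulfI i0); rewrite !mulrDr !mulrN -!mulNr.
have : inner (U x) (U y) + inner (U x) (U y) = inner (P x) y + inner (P x) y.
  have e1 (u v : C) : u + u = (u + v) - (- u + v) by ring.
  by rewrite (e1 _ (inner (U y) (U x))) h1 h3 -e1.
have two0 : (2 : C) != 0 by rewrite pnatr_eq0.
by move=> h; apply: (mulfI two0); rewrite !mulr_natl !mulr2n.
Qed.

Lemma nm_le_inner (z : H) (k : R) : 0 <= k ->
  (forall y, nm (inner z y) <= k * nm y) -> nm z <= k.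
Proof.
move=> k0 h; have [->|z0] := eqVneq z 0; first by rewrite nm0.
have nz := nm_gt0 z0; rewrite -(ler_pM2r nz) -expr2.
by have := h z; rewrite ipxx nmC ger0_norm ?sqr_ge0.
Qed.

End Polarization.

Section Compression.
Context {R : realType} {H : hilbertType R}.
Local Notation C := R[i].
Variables (e : seq H) (oe : onb e).

Definition emb (u : 'cV[C]_(size e)) : H := \sum_(a < size e) u a 0 *: e`_a.
Definition coords (x : H) : 'cV[C]_(size e) := \col_a inner x e`_a.
Definition compress (A : H -> H) : 'M[C]_(size e) :=
  \matrix_(a, b) inner (A e`_b) e`_a.

Lemma emb_coords x : emb (coords x) = pr e x.
Proof.
by rewrite /emb /pr proj_on_nth; apply: eq_bigr => a _; rewrite mxE.
Qed.

Lemma coords_linear : linear coords.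
Proof. by move=> a x y; apply/colP => i; rewrite !mxE ipDl ipZl. Qed.

Lemma coords_pr x : coords (pr e x) = coords x.
Proof. by apply/colP => i; rewrite !mxE (proj_on_inner psd_id). Qed.

Lemma dotC_compress (A : H -> H) u v : linear A ->
  dotC (compress A *m u) v = inner (A (emb u)) (emb v).
Proof.
move=> Al; rewrite /dotC /emb ip_sumr; apply: eq_bigr => a _.
rewrite mxE ipZr mulrC; congr (_ * _).
rewrite (lin_sum Al) ip_suml; apply: eq_bigr => b _.
by rewrite mxE (linZ Al) ipZl mulrC.
Qed.

Lemma dotC_coords x y : dotC (coords x) (coords y) = inner (pr e x) y.
Proof.
rewrite /dotC /pr proj_on_nth ip_suml; apply: eq_bigr => a _.
by rewrite !mxE ipZl [inner _ y]ipC.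
Qed.

(** With V = [emb], this is A |-> V^* A V; positivity at every level is positivity of the given form
    at the vectors [emb (u q)]. *)
Lemma compress_ucp : ucp compress.
Proof.
split.
- by move=> a A B _ _; apply/matrixP => i j; rewrite !mxE ipDl ipZl.
- apply/matrixP => i j; rewrite !mxE oe//.
  by rewrite eq_sym.
- move=> k A Ab Apos u; have := Apos (fun q => emb (u q)).
  congr (0 <= _); apply: eq_bigr => p _; apply: eq_bigr => q _.
  by rewrite dotC_compress//; case: (Ab p q).
Qed.

End Compression.

Section FiniteDilation.
Context {R : realType} {H : hilbertType R}.
Local Notation C := R[i].

Lemma dotC_conj n (u v : 'cV[C]_n) : dotC u v = conjc (dotC v u).
Proof.
by rewrite /dotC conj_sum; apply: eq_bigr => a _; rewrite conjM conjE conjcK mulrC.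
Qed.

Lemma sum_tagged (V : nmodType) (I : finType) (n : I -> nat) (F : forall i, 'I_(n i) -> V) :
  \sum_(p : {i : I & 'I_(n i)}) F (tag p) (tagged p) = \sum_i \sum_(k < n i) F i k.
Proof. by rewrite (sig_big_dep _ (fun i (_ : 'I_(n i)) => true)). Qed.

(* Up to a small error, [T] has a finite-dimensional diagonal dilation with entries in
   [K]: the vectors [g l] form a Parseval frame of the range of [pr e]. *)
Lemma finite_dilation d (K : set 'rV[C]_d) (T : 'I_d -> H -> H) (x0 : H) (c : R) :
  x0 != 0 -> (forall i, bounded_op (T i)) -> (forall i, tb (T i)) ->
  (forall n, (0 < n)%N -> matrix_range T n `<=` Wmin K n) -> 0 < c ->
  exists (J : finType) (mu : J -> 'rV[C]_d) (g : J -> H) (e : seq H),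
  [/\ onb e, forall l, K (mu l),
      forall x, \sum_l inner x (g l) *: g l = pr e x &
      forall i x, nm (T i x - \sum_l mu l 0 i *: (inner x (g l) *: g l)) <= c * nm x].
Proof.
move=> x00 Tb tT TK c0; have c2 : 0 < c / 2 by rewrite divr_gt0.
have [e [oe ex0 Te]] := compression_approx [:: x0] Tb tT c2.
have {}ex0 : pr e x0 = x0 by apply: ex0; rewrite inE.
(* The inclusion of matrix ranges is assumed for positive sizes; the range of [pr e] contains
   [x0]. *)
have n0 : (0 < size e)%N.
  case: e {oe Te} ex0 => // /esym; rewrite /pr /proj_on big_nil => h.
  by move/eqP: x00.
have Tl i : linear (T i) by case: (Tb i).
have [L [N [nN NK [V [W [Vl Viso VW XN]]]]]] :
    Wmin K (size e) (fun i => compress e (T i)).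
  by apply: TK => //; exists (compress e) => //; exact: compress_ucp.
(* A partial isometry with U^* U = P, for which U^* N_i U = P T_i P. *)
pose U x := V (coords e x).
have Ul : linear U by exact: linear_compo Vl (coords_linear e).
have Uip x y : inner (U x) (U y) = inner (pr e x) y.
  by apply: polarization => // [|z]; [exact: pr_linear|rewrite Viso dotC_coords].
have UN i x y : inner (N i (U x)) (U y) = inner (pr e (T i (pr e x))) y.
  rewrite ipC VW -[W _]/((W \o N i \o V) (coords e x)) -XN dotC_conj conjcK.
  by rewrite dotC_compress// !emb_coords pr_sym.
have Upr x : U (pr e x) = U x by rewrite /U coords_pr.
have Ux0 : U x0 != 0.
  apply: contra_neq x00 => h; apply: nm_eq0; apply/eqP.
  have := Uip x0 x0; rewrite h ip0l ex0 ipxx => /esym/complexI/eqP.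
  by rewrite sqrf_eq0.
have Unm x : nm (U x) <= nm x.
  rewrite -(@ler_pXn2r _ 2)// ?nnegrE ?nm_ge0//.
  have : (nm (U x) ^+ 2)%:C = (nm (pr e x) ^+ 2)%:C.
    by rewrite -!ipxx Uip [in RHS]pr_sym pr_idem// -pr_sym.
  by move=> /complexI ->; rewrite ler_pXn2r ?nnegrE ?nm_ge0//; exact: pr_contract.
have [I [l [B [Kl pB B1 BN]]]] := spectral_approximation nN NK Ux0 c2.
have /choice[f hf] : forall i, exists f, forall v, v \in [seq U u | u <- e] ->
    forall y, inner (B i (v - proj_on (B i) f v)) y = 0.
  by move=> i; have [f [_ hf]] := gram_schmidt (pB i) [seq U u | u <- e]; exists f.
have UE x : U x = \sum_(a < size e) inner x e`_a *: U e`_a.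
  rewrite -Upr /pr proj_on_nth (lin_sum Ul); apply: eq_bigr => a _.
  by rewrite (linZ Ul).
have nullU i x y : inner (B i (U x - proj_on (B i) (f i) (U x))) y = 0.
  have [Bl _ _] := pB i; have Pl := proj_on_linear (pB i) (f i).
  rewrite (UE x) (lin_sum Pl) -sumrB (lin_sum Bl) ip_suml big1// => a _.
  rewrite (linZ Pl) -scalerBr (linZ Bl) ipZl hf ?mulr0//.
  by apply: map_f; apply: mem_nth.
(* This is U^* (B_i u), in coordinates. The Parseval identity for [B i] then writes U^* B_i U as a
   sum of rank one operators on [H]. *)
pose gg i u := \sum_(a < size e) conjc (inner (B i (U e`_a)) u) *: e`_a.
have ggE i u x : inner x (gg i u) = inner (B i (U x)) u.
  have [Bl _ _] := pB i.
  rewrite (UE x) (lin_sum Bl) ip_suml ip_sumr; apply: eq_bigr => a _.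
  by rewrite ipZr conjcK (linZ Bl) ipZl mulrC.
have BU i x y : inner (B i (U x)) (U y) =
    inner (\sum_(k < size (f i)) inner x (gg i (f i)`_k) *: gg i (f i)`_k) y.
  rewrite (parseval (pB i) _ (nullU i x)) (big_nth 0) big_mkord ip_suml.
  apply: eq_bigr => k _; rewrite ipZl ggE [inner (gg _ _) y]ipC ggE.
  by [].
pose J := {i : I & 'I_(size (f i))}.
pose g (p : J) := gg (tag p) (f (tag p))`_(tagged p).
exists J, (fun p => l (tag p)), g, e; split => //.
- move=> x; apply: ip_inj => y.
  rewrite (sum_tagged (fun i k => inner x (gg i (f i)`_k) *: gg i (f i)`_k)).
  rewrite -Uip -{1}(B1 (U x)) !ip_suml; apply: eq_bigr => i _.
  by rewrite BU.
- move=> i x; rewrite (le_trans (nm_dist (pr e (T i (pr e x))) _ _))//.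
  rewrite [c in leRHS]splitr mulrDl lerD//.
  apply: nm_le_inner; first by rewrite mulr_ge0 ?nm_ge0 ?(ltW c2).
  move=> y; have -> : inner (pr e (T i (pr e x)) -
      \sum_(p : J) l (tag p) 0 i *: (inner x (g p) *: g p)) y =
      inner (N i (U x) - \sum_k l k 0 i *: B k (U x)) (U y).
    rewrite !ipBl UN; congr (_ - _).
    rewrite (sum_tagged (fun k a => l k 0 i *: (inner x (gg k (f k)`_a) *: gg k (f k)`_a))).
    rewrite !ip_suml; apply: eq_bigr => k _.
    by rewrite -scaler_sumr !ipZl BU.
  rewrite (le_trans (cauchy_schwarz _ _))// ler_pM ?nm_ge0//.
  by rewrite (le_trans (BN _ _))// ler_wpM2l// ltW.
Qed.

End FiniteDilation.

(** * Finite Hilbert sums *)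

Section RootSumSquares.
Context {R : realType} (I : finType).
Implicit Types a b : I -> R.

Definition rss a := Num.sqrt (\sum_i a i ^+ 2).

Lemma sum_sqr_ge0 a : 0 <= \sum_i a i ^+ 2.
Proof. by apply: sumr_ge0 => i _; rewrite sqr_ge0. Qed.

Lemma rss_ge0 a : 0 <= rss a. Proof. exact: sqrtr_ge0. Qed.

Lemma rss_sqr a : rss a ^+ 2 = \sum_i a i ^+ 2.
Proof. by rewrite sqr_sqrtr// sum_sqr_ge0. Qed.

Lemma rss_eq0 a : rss a = 0 -> forall i, a i = 0.
Proof.
move=> h i; have : \sum_i a i ^+ 2 = 0 by rewrite -rss_sqr h expr0n.
move=> /eqP; rewrite psumr_eq0 => [/allP /(_ i)|j _]; last exact: sqr_ge0.
by rewrite mem_index_enum => /(_ isT) /=; rewrite sqrf_eq0 => /eqP.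
Qed.

Lemma sum_mul_le a b : \sum_i a i * b i <= rss a * rss b.
Proof.
have [a0|a0] := eqVneq (rss a) 0.
  rewrite a0 mul0r big1// => i _; by rewrite (rss_eq0 a0) mul0r.
have [b0|b0] := eqVneq (rss b) 0.
  rewrite b0 mulr0 big1// => i _; by rewrite (rss_eq0 b0) mulr0.
have ap : 0 < rss a by rewrite lt_neqAle eq_sym a0 rss_ge0.
have bp : 0 < rss b by rewrite lt_neqAle eq_sym b0 rss_ge0.
(* The weights balance the two sums of squares: each of them becomes [rss a * rss b]. *)
apply: (@le_trans _ _ (\sum_i (rss b / rss a * a i ^+ 2 + rss a / rss b * b i ^+ 2) / 2)).
  apply: ler_sum => i _; rewrite ler_pdivlMr//.
  have := sqr_ge0 (rss b * a i - rss a * b i); rewrite sqrrB => h.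
  have abp : 0 < rss a * rss b by rewrite mulr_gt0.
  rewrite -(ler_pM2l abp).
  have -> : rss a * rss b * (rss b / rss a * a i ^+ 2 + rss a / rss b * b i ^+ 2) =
    (rss b * a i) ^+ 2 + (rss a * b i) ^+ 2 by field; rewrite a0 b0.
  move: h; nra.
rewrite -mulr_suml big_split /= -!mulr_sumr -!rss_sqr le_eqVlt; apply/orP; left; apply/eqP.
by field; rewrite a0 b0.
Qed.

Lemma rss_triangle a b : rss (fun i => a i + b i) <= rss a + rss b.
Proof.
rewrite -(@ler_pXn2r _ 2)// ?nnegrE ?addr_ge0 ?rss_ge0// sqrrD !rss_sqr.
have -> : \sum_i (a i + b i) ^+ 2 = \sum_i a i ^+ 2 + \sum_i b i ^+ 2 + 2 * \sum_i a i * b i.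
  rewrite mulr_sumr -!big_split /=; apply: eq_bigr => i _; ring.
have := sum_mul_le a b; lra.
Qed.

Lemma rss_le a b : (forall i, 0 <= a i <= b i) -> rss a <= rss b.
Proof.
move=> h; rewrite ler_sqrt ?sum_sqr_ge0//; apply: ler_sum => i _.
have /andP[h1 h2] := h i; rewrite ler_pXn2r// nnegrE//; exact: le_trans h2.
Qed.

Lemma rss_le_sum a : (forall i, 0 <= a i) -> rss a <= \sum_i a i.
Proof.
move=> a0; have s0 : 0 <= \sum_i a i by exact: sumr_ge0.
rewrite -(@ler_pXn2r _ 2)// ?nnegrE ?rss_ge0// rss_sqr expr2 mulr_suml.
apply: ler_sum => i _; rewrite expr2 ler_wpM2l// (bigD1 i)//= lerDl.
exact: sumr_ge0.
Qed.

Lemma le_rss a i : 0 <= a i -> a i <= rss a.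
Proof.
move=> ai; rewrite -(@ler_pXn2r _ 2)// ?nnegrE ?rss_ge0// rss_sqr.
by rewrite (bigD1 i)//= lerDl; apply: sumr_ge0 => j _; rewrite sqr_ge0.
Qed.

End RootSumSquares.

Section ComplexHilbert.
Context {R : realType}.
Local Notation C := R[i].

Definition cdot (z w : C) : C := z * Num.conj w.

Lemma cdot_bilinear : bilinear_for
    (GRing.Scale.Law.clone _ _ ( *%R ) _) (GRing.Scale.Law.clone _ _ (Num.conj \; *%R ) _)
    (cdot : C -> C -> C).
Proof.
split=> [u'|u] a x y /=; rewrite /cdot.
- by rewrite mulrDl mulrA.
- by rewrite rmorphD rmorphM /= mulrDr mulrCA.
Qed.

HB.instance Definition _ := bilinear_isBilinear.Build C C C C
    (GRing.Scale.Law.clone _ _ ( *%R ) _)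
    (GRing.Scale.Law.clone _ _ (Num.conj \; *%R ) _) cdot cdot_bilinear.

Lemma cdot_herm (x y : C) : cdot x y = (-1) ^+ false * Num.conj (cdot y x).
Proof. by rewrite expr0 mul1r /cdot rmorphM /= conjCK mulrC. Qed.

HB.instance Definition _ := isHermitianSesquilinear.Build C C false Num.conj cdot cdot_herm.

Lemma cdot_gt0 (u : C) : u != 0 -> 0 < cdot u u.
Proof. by move=> u0; rewrite /cdot -normCK exprn_gt0// normr_gt0. Qed.

HB.instance Definition _ := isDotProduct.Build C C cdot cdot_gt0.

Lemma cdot_normE (x : C) : (cdot : {dot C for @Num.conj C}) x x = `|x| ^+ 2.
Proof. by rewrite /cdot normCK. Qed.

End ComplexHilbert.

HB.instance Definition _ (R : realType) :=
  NormedModule_isInnerProduct.Build R R[i] (@cdot_normE R).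

(** A name of its own for the product, to carry the l^2 norm and inner product. *)
Definition hsum (R : realType) (I : finType) (E : I -> hilbertType R) := forall i, E i.

Section HilbertSum.
Context {R : realType} {I : finType} {E : I -> hilbertType R}.
Local Notation C := R[i].
Local Notation S := (hsum E).
Implicit Types (f g : S).

HB.instance Definition _ := gen_eqMixin S.
HB.instance Definition _ := gen_choiceMixin S.

Definition hsum_add f g : S := fun i => f i + g i.
Definition hsum_opp f : S := fun i => - f i.
Definition hsum_zero : S := fun i => 0.
Definition hsum_scale (a : C) f : S := fun i => a *: f i.

Lemma hsum_eq f g : (forall i, f i = g i) -> f = g.
Proof. exact: functional_extensionality_dep. Qed.

Lemma hsum_addA : associative hsum_add.
Proof. by move=> f g h; apply: hsum_eq => i; rewrite /hsum_add addrA. Qed.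
Lemma hsum_addC : commutative hsum_add.
Proof. by move=> f g; apply: hsum_eq => i; rewrite /hsum_add addrC. Qed.
Lemma hsum_add0 : left_id hsum_zero hsum_add.
Proof. by move=> f; apply: hsum_eq => i; rewrite /hsum_add add0r. Qed.
Lemma hsum_addN : left_inverse hsum_zero hsum_opp hsum_add.
Proof. by move=> f; apply: hsum_eq => i; rewrite /hsum_add addNr. Qed.

HB.instance Definition _ := GRing.isZmodule.Build S
  hsum_addA hsum_addC hsum_add0 hsum_addN.

Lemma hsum_scaleA a b f : hsum_scale a (hsum_scale b f) = hsum_scale (a * b) f.
Proof. by apply: hsum_eq => i; rewrite /hsum_scale scalerA. Qed.
Lemma hsum_scale1 : left_id 1 hsum_scale.
Proof. by move=> f; apply: hsum_eq => i; rewrite /hsum_scale scale1r. Qed.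
Lemma hsum_scaleDr : right_distributive hsum_scale +%R.
Proof. by move=> a f g; apply: hsum_eq => i; rewrite /hsum_scale scalerDr. Qed.
Lemma hsum_scaleDl f : {morph hsum_scale^~ f : a b / a + b}.
Proof. by move=> a b; apply: hsum_eq => i; rewrite /hsum_scale scalerDl. Qed.

HB.instance Definition _ := GRing.Zmodule_isLmodule.Build C S
  hsum_scaleA hsum_scale1 hsum_scaleDr hsum_scaleDl.

Lemma hsumD f g i : (f + g) i = f i + g i. Proof. by []. Qed.
Lemma hsumB f g i : (f - g) i = f i - g i. Proof. by []. Qed.
Lemma hsumZ a f i : (a *: f) i = a *: f i. Proof. by []. Qed.

Definition hsum_norm f : C := (rss (fun i => nm (f i)))%:C.

Lemma hsum_normD f g : hsum_norm (f + g) <= hsum_norm f + hsum_norm g.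
Proof.
rewrite /hsum_norm -RCD lecR (le_trans _ (rss_triangle _ _))//.
by apply: rss_le => i; rewrite nm_ge0 nm_triangle.
Qed.

Lemma hsum_normZ a f : hsum_norm (a *: f) = `|a| * hsum_norm f.
Proof.
rewrite nmE -RCM /hsum_norm; congr (_%:C).
rewrite /rss -[nm a]ger0_norm ?nm_ge0// -sqrtr_sqr -sqrtrM ?sqr_ge0//; congr Num.sqrt.
by rewrite mulr_sumr; apply: eq_bigr => i _; rewrite nmZ exprMn.
Qed.

Lemma hsum_norm_eq0 f : hsum_norm f = 0 -> f = 0.
Proof. by move=> /complexI /rss_eq0 h; apply: hsum_eq => i; apply: nm_eq0. Qed.

HB.instance Definition _ := Lmodule_isNormed.Build C S
  hsum_normD hsum_normZ hsum_norm_eq0.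

Lemma nm_hsum f : nm f = rss (fun i => nm (f i)). Proof. by []. Qed.

Lemma nm_hsum_le f i : nm (f i) <= nm f.
Proof. by rewrite nm_hsum; apply: (le_rss (a := fun i => nm (f i))); rewrite nm_ge0. Qed.

Lemma hsum_complete (F : set_system S) : ProperFilter F -> cauchy F -> cvg F.
Proof.
move=> FF /cauchyP Fc.
have part i : cvg ((fun f : S => f i) @ F).
  apply/cauchy_cvgP/cauchy_exP => e e0.
  have [f Ff] := Fc _ e0; exists (f i); rewrite /nbhs /=; apply: filterS Ff => g.
  rewrite -!ball_normE /= !nmE (ge0_nm (ltW e0)) !ltcR; apply: le_lt_trans.
  by rewrite -hsumB nm_hsum_le.
pose p : S := fun i => lim ((fun f : S => f i) @ F).
have hp i : (fun f : S => f i) @ F --> p i by exact: part.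
apply/cvg_ex; exists p; apply/cvgrPdist_le => e e0.
have ne : 0 < nm e by rewrite nm_gt0// gt_eqF.
(* The added 1 keeps [m] positive for an empty index type. *)
pose m : R := #|I|%:R + 1; have m0 : 0 < m by rewrite ltr_wpDl.
have em : 0 < (nm e / m)%:C by rewrite ltcR divr_gt0.
have near_all : \forall f \near F, forall i, nm (p i - f i) <= nm e / m.
  apply: filter_forall => i.
  have : \forall f \near F, `|p i - f i| <= (nm e / m)%:C.
    by apply: (cvgrPdist_le _ _).1 em; exact: hp.
  by apply: filterS => f; rewrite nmE lecR.
near=> f; rewrite nmE (ge0_nm (ltW e0)) lecR nm_hsum.
rewrite (le_trans (rss_le_sum _))//; first by move=> i; exact: nm_ge0.
rewrite (@le_trans _ _ (\sum_(i : I) nm e / m))//.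
  by apply: ler_sum => i _; move: i; near: f.
rewrite sumr_const -mulr_natr mulrAC ler_pdivrMr// ler_wpM2l ?nm_ge0//.
by rewrite lerDl.
Unshelve. all: by end_near. Qed.

HB.instance Definition _ := Uniform_isComplete.Build S hsum_complete.

Definition hdot f g : C := \sum_i inner (f i) (g i).

Lemma hdot_bilinear : bilinear_for
    (GRing.Scale.Law.clone _ _ ( *%R ) _) (GRing.Scale.Law.clone _ _ (Num.conj \; *%R ) _)
    (hdot : S -> S -> C).
Proof.
split=> [u'|u] a x y /=; rewrite /hdot mulr_sumr -big_split /=; apply: eq_bigr => i _.
- by rewrite hsumD hsumZ ipDl ipZl.
- by rewrite hsumD hsumZ ipDr ipZr.
Qed.

HB.instance Definition _ := bilinear_isBilinear.Build C S S C
    (GRing.Scale.Law.clone _ _ ( *%R ) _)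
    (GRing.Scale.Law.clone _ _ (Num.conj \; *%R ) _) hdot hdot_bilinear.

Lemma hdot_herm f g : hdot f g = (-1) ^+ false * Num.conj (hdot g f).
Proof.
by rewrite expr0 mul1r /hdot rmorph_sum /=; apply: eq_bigr => i _; rewrite ipC.
Qed.

HB.instance Definition _ := isHermitianSesquilinear.Build C S false Num.conj hdot hdot_herm.

Lemma hdot_self f : hdot f f = (nm f ^+ 2)%:C.
Proof. by rewrite nm_hsum rss_sqr RC_sum; apply: eq_bigr => i _; rewrite ipxx. Qed.

Lemma hdot_gt0 f : f != 0 -> 0 < hdot f f.
Proof. by move=> f0; rewrite hdot_self ltcR exprn_gt0// nm_gt0. Qed.

HB.instance Definition _ := isDotProduct.Build C S hdot hdot_gt0.

Lemma hdot_normE f : (hdot : {dot S for @Num.conj C}) f f = `|f| ^+ 2.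
Proof. by rewrite nmE -RCX -hdot_self. Qed.

HB.instance Definition _ := NormedModule_isInnerProduct.Build R S hdot_normE.

End HilbertSum.

Lemma ip_hsum (R : realType) (I : finType) (E : I -> hilbertType R) (f g : hsum E) :
  inner f g = \sum_i inner (f i) (g i).
Proof. by []. Qed.

(** * Diagonal operators on Hilbert sums *)

Section DiagonalOperators.
Context {R : realType} {I : finType} {E : I -> hilbertType R}.
Local Notation C := R[i].

Definition hdiag (G : forall i, E i -> E i) (f : hsum E) : hsum E := fun i => G i (f i).

Lemma hdiag_linear G : (forall i, linear (G i)) -> linear (hdiag G).
Proof. by move=> Gl a f g; apply: hsum_eq => i; rewrite /hdiag hsumD hsumZ Gl. Qed.

Lemma hdiag_bound G (k : R) f : 0 <= k -> (forall i x, nm (G i x) <= k * nm x) ->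
  nm (hdiag G f) <= k * nm f.
Proof.
move=> k0 Gk; have -> : k * nm f = nm (k%:C *: f) by rewrite nmZ nmC ger0_norm.
rewrite !nm_hsum; apply: rss_le => i.
by rewrite nm_ge0 /= hsumZ nmZ nmC ger0_norm// Gk.
Qed.

Lemma hdiag_adjoint G G' : (forall i, op_adjoint (G i) (G' i)) ->
  op_adjoint (hdiag G) (hdiag G').
Proof.
by move=> GG f g; rewrite !ip_hsum; apply: eq_bigr => i _; rewrite GG.
Qed.

Lemma hdiag_bounded G : (forall i, bounded_op (G i)) -> bounded_op (hdiag G).
Proof.
move=> Gb; apply/bounded_opP; split; first by apply: hdiag_linear => i; case: (Gb i).
have h i : exists k : R, 0 <= k /\ forall x, nm (G i x) <= k * nm x.
  by have [_ [k k0 hk]] := (bounded_opP _).1 (Gb i); exists k.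
have [k hk] := choice h.
have k0 : 0 <= \sum_i k i by apply: sumr_ge0 => i _; case: (hk i).
exists (\sum_i k i) => // f; apply: hdiag_bound => // i x.
rewrite (le_trans ((hk i).2 x))// ler_wpM2r ?nm_ge0// (bigD1 i)//= lerDl.
by apply: sumr_ge0 => j _; case: (hk j).
Qed.

Lemma hdiag_tb G : (forall i, tb (G i)) -> tb (hdiag G).
Proof.
move=> Gt e e0.
pose m : R := #|I|%:R + 1; have m0 : 0 < m by rewrite ltr_wpDl.
have em : 0 < e / m by rewrite divr_gt0.
pose s i := sval (cid (Gt i _ em)).
have hs i x : nm x <= 1 -> exists2 y, y \in s i & nm (G i x - y) <= e / m.
  exact: (svalP (cid (Gt i _ em))).
pose n := \max_i size (s i).
(* The product of the coordinate nets, indexed by a common bound [n] on their sizes; indices past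
   the end of [s i] yield the harmless point 0. *)
pose net (c : {ffun I -> 'I_n.+1}) : hsum E := fun i => (s i)`_(c i).
exists (codom net) => f f1.
have h i : exists k : 'I_n.+1, nm (G i (f i) - (s i)`_k) <= e / m.
  have [|y ys hy] := hs i (f i); first exact: le_trans (nm_hsum_le _ _) f1.
  have yn : (index y (s i) < n.+1)%N.
    by rewrite ltnS (leq_trans (index_size _ _))// (leq_bigmax i).
  by exists (Ordinal yn) => /=; rewrite nth_index.
have [c hc] := choice h.
exists (net [ffun i => c i]); first exact: codom_f.
rewrite nm_hsum (le_trans (rss_le_sum _))//; first by move=> i; exact: nm_ge0.
rewrite (@le_trans _ _ (\sum_(i : I) e / m))//.
  by apply: ler_sum => i _; rewrite hsumB /net ffunE hc.
rewrite sumr_const -mulr_natr mulrAC ler_pdivrMr// ler_wpM2l ?(ltW e0)//.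
by rewrite lerDl.
Qed.

Lemma hdiag_normal_tuple d (G : 'I_d -> forall i, E i -> E i) :
  (forall i, normal_tuple (fun j => G j i)) -> normal_tuple (fun j => hdiag (G j)).
Proof.
move=> nG; split => [j|j k]; last first.
  apply/funext => f; apply: hsum_eq => i /=.
  by have [_ /(_ j k) /(congr1 (fun F => F (f i)))] := nG i.
have Gn i : normal_op (G j i) by case: (nG i).
split; first by apply: hdiag_bounded => i; case: (Gn i).
have h i : exists B, op_adjoint (G j i) B /\ G j i \o B = B \o G j i.
  by have [_ [B ? ?]] := Gn i; exists B.
exists (hdiag (fun i => sval (cid (h i)))).
  by apply: hdiag_adjoint => i; case: (svalP (cid (h i))).
apply/funext => f; apply: hsum_eq => i; rewrite /hdiag /=.
by have [_ /(congr1 (fun F => F (f i)))] := svalP (cid (h i)).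
Qed.

End DiagonalOperators.

Section DiagonalMatrices.
Context {R : realType} (J : finType) (d : nat).
Local Notation C := R[i].
Local Notation LJ := (hsum (fun _ : J => (C : hilbertType R))).

Definition dmx (b : 'I_d -> J -> C) (i : 'I_d) : LJ -> LJ :=
  hdiag (fun l (z : (C : hilbertType R)) => b i l * z).

Lemma dmx_normal b : normal_tuple (dmx b).
Proof.
apply: hdiag_normal_tuple => l; split => [i|i j]; last first.
  by apply/funext => z /=; rewrite mulrCA.
split.
  apply/bounded_opP; split.
    by move=> a x y; rewrite mulrDr; congr (_ + _); exact: mulrCA.
  by exists (nm (b i l)) => [|z]; rewrite ?nm_ge0// nmM.
exists (fun z : (C : hilbertType R) => Num.conj (b i l) * z).
  move=> x y; rewrite -[LHS]/(b i l * x * Num.conj y) -[RHS]/(x * Num.conj (Num.conj (b i l) * y)).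
  by rewrite rmorphM /= conjCK mulrA [b i l * x]mulrC.
by apply/funext => z /=; rewrite mulrCA.
Qed.

Lemma dmx_tb b i : tb (dmx b i).
Proof.
apply: hdiag_tb => l.
apply: (@tb_comp R (C : hilbertType R) (C : hilbertType R) C (C : hilbertType R)
  (fun z : C => b i l * z) (fun z => z) (fun z => z)) => //.
- by move=> a x y; rewrite mulrDr; congr (_ + _); exact: mulrCA.
- by exists (nm (b i l)) => [|z]; rewrite ?nm_ge0// nmM.
- exact: bnd_id.
- exact: tb_scalar.
Qed.

(* If [l] differs from every diagonal point, a product of differences
   [N_i - b i q] vanishes although every character gives it a nonzero value. *)
Lemma dmx_spectrum b (l : 'rV[C]_d) : joint_spectrum (dmx b) l ->
  exists q, forall i, l 0 i = b i q.
Proof.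
move=> [chi [chi1 chiL chiM] chiN]; apply: contrapT => /forallNP h.
have /choice[ii hii] : forall q, exists i, l 0 i != b i q.
  by move=> q; have /existsNP[i /eqP hi] := h q; exists i.
have gen_id : cstar_gen (dmx b) id by move=> M [[[_ ?]]].
have gen_lin a A B : cstar_gen (dmx b) A -> cstar_gen (dmx b) B -> cstar_gen (dmx b) (a *: A + B).
  move=> hA hB M hM; have [[_ hl _ _ _] _] := hM; apply: hl; [exact: hA|exact: hB].
have gen_comp A B : cstar_gen (dmx b) A -> cstar_gen (dmx b) B -> cstar_gen (dmx b) (A \o B).
  move=> hA hB M hM; have [[_ _ hl _ _] _] := hM; apply: hl; [exact: hA|exact: hB].
have gen_N i : cstar_gen (dmx b) (dmx b i) by move=> M [_ hM]; apply: hM; exists i.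
have [A [gA cA zA]] : exists A, [/\ cstar_gen (dmx b) A, chi A != 0 &
    exists2 a : J -> C, (forall q, q \in enum J -> a q = 0) & forall f q, A f q = a q * f q].
  elim: (enum J) => [|q s [A [gA cA [a as0 aA]]]].
    exists id; split => //; first by rewrite chi1 oner_neq0.
    by exists (fun=> 1) => // f q; rewrite mul1r.
  (* This factor vanishes at the coordinate [q], while the character takes on it the nonzero value
     [l 0 (ii q) - b (ii q) q]. *)
  pose D := - b (ii q) q *: id + dmx b (ii q).
  have gD : cstar_gen (dmx b) D by exact: gen_lin.
  exists (A \o D); split; first exact: gen_comp.
    rewrite chiM// mulf_neq0// chiL// chi1 mulr1 -chiN addrC subr_eq0.
    exact: hii.
  exists (fun p => a p * (b (ii q) p - b (ii q) q)).
    move=> p; rewrite inE => /orP[/eqP ->|ps]; first by rewrite subrr mulr0.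
    by rewrite as0// mul0r.
  move=> f p; rewrite /= aA -mulrA; congr (_ * _).
  by rewrite /D mulrBl addrC -mulNr.
(* The zero operator in the shape on which linearity of the character can be applied. *)
have A0 : A = -1 *: id + id.
  case: zA => a a0 aA; apply/funext => f; apply: hsum_eq => q.
  by rewrite aA a0 ?mem_enum// mul0r -[RHS]/((-1 *: f + f) q) scaleN1r addNr.
by move: cA; rewrite A0 chiL// chi1 mulr1 addNr eqxx.
Qed.

End DiagonalMatrices.

Lemma big_opt (V : nmodType) (T : finType) (F : option T -> V) :
  \sum_q F q = F None + \sum_t F (Some t).
Proof.
rewrite (bigD1 None)//=; congr (_ + _).
rewrite (reindex_omap Some id) /=; last by case.
by apply: eq_bigl => t; rewrite eqxx.
Qed.

(** * The dilation *)

Section PairDecomposition.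
Context {R : realType}.
Local Notation C := R[i].

Definition pair_family (LA LB : hilbertType R) (b : bool) : hilbertType R :=
  if b then LA else LB.

Definition in_pair (LA LB : hilbertType R) (p : LA * LB) : hsum (pair_family LA LB) :=
  fun b => match b return pair_family LA LB b with true => p.1 | false => p.2 end.

Definition pair_op (LA LB : hilbertType R) (A : LA -> LA) (B : LB -> LB) (b : bool) :
    pair_family LA LB b -> pair_family LA LB b :=
  match b return pair_family LA LB b -> pair_family LA LB b with true => A | false => B end.

Lemma in_pair_inner (LA LB : hilbertType R) (p q : LA * LB) :
  inner (in_pair p) (in_pair q) = inner p.1 q.1 + inner p.2 q.2.
Proof. by rewrite ip_hsum big_bool. Qed.

Lemma direct_sum_pair (LA LB : hilbertType R) d (A : 'I_d -> LA -> LA) (B : 'I_d -> LB -> LB) :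
  direct_sum A B (fun i => hdiag (pair_op (A i) (B i))).
Proof.
exists (@in_pair LA LB); split.
- by move=> a p q; apply: hsum_eq => -[].
- exact: in_pair_inner.
- by move=> y; exists (y true, y false); apply: hsum_eq => -[].
- by move=> i p; apply: hsum_eq => -[].
Qed.

(** A tuple with a single nonzero entry commutes for free; this is what a separate copy of [H] for
    each part of the error achieves. *)
Lemma normal_tuple_single (H : hilbertType R) d (W : H -> H) (i0 : 'I_d) :
  normal_op W -> normal_tuple (fun i x => if i == i0 then W x else 0).
Proof.
move=> nW; have [[Wl _] [W' WW' cW]] := nW.
have W'l := op_adjoint_linear WW'.
split=> [i|i j].
  have [_|_] := eqVneq i i0; first by [].
  split.
    by apply/bounded_opP; split; [exact: linear_zerof|exact: bnd_zero].
  exists (fun=> 0) => // x y; by rewrite ip0l ip0r.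
apply/funext => x /=; have [_|_] := eqVneq i i0; have [_|_] := eqVneq j i0 => //.
  by rewrite (lin0 Wl).
by rewrite (lin0 Wl).
Qed.

Lemma normal_tuple_zero (H : hilbertType R) d :
  normal_tuple (fun (i : 'I_d) (x : H) => (0 : H)).
Proof.
split=> [i|i j]; last by [].
split; first by apply/bounded_opP; split; [exact: linear_zerof|exact: bnd_zero].
by exists (fun=> 0) => // x y; rewrite ip0l ip0r.
Qed.

End PairDecomposition.

Section DilationConstruction.
Context {R : realType} {H : hilbertType R}.
Local Notation C := R[i].
Variables (d : nat) (T : 'I_d -> H -> H) (eps : R) (eps0 : 0 < eps).
Variables (J : finType) (mu : J -> 'rV[C]_d) (g : J -> H) (e : seq H).
Hypotheses (oe : onb e) (ge : forall x, \sum_l inner x (g l) *: g l = pr e x).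

Definition compression_error i x := T i x - \sum_l mu l 0 i *: (inner x (g l) *: g l).

(** The additional copy [None], on which the dilation acts as 0, keeps this positive when d = 0. *)
Definition copies : R := #|{: option ('I_d * bool)}|%:R.
Definition weight : R := eps / (1 + eps).

Variable Es : 'I_d -> H -> H.
Hypotheses (Eb : forall i, bounded_op (compression_error i)).
Hypotheses (Et : forall i, tb (compression_error i)).
Hypotheses (EEs : forall i, op_adjoint (compression_error i) (Es i)).
Hypothesis Esmall : forall i x,
  nm (compression_error i x) <= eps * weight / (2 * copies) * nm x.

(* The real part, and the imaginary part times ['i], of the error, rescaled to make up
   for the weight [weight / copies] that [embed] gives to each copy of [H]. *)
Definition part_op (i : 'I_d) (b : bool) x : H :=
  (copies / weight / 2)%:C *:
    (compression_error i x + (if b then Es i x else - Es i x)).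

(** The outer [None] is the copy receiving the complement of [pr e], [Some None] is the additional
    copy, and [Some (Some (j, b))] holds one part of the error of [T j]. *)
Definition small_op (i : 'I_d) (q : option (option ('I_d * bool))) (x : H) : H :=
  match q with
  | Some (Some (j, b)) => if i == j then part_op j b x else 0
  | _ => 0
  end.

Definition small_space : hilbertType R :=
  hsum (fun _ : option (option ('I_d * bool)) => H).
Definition small_tuple i : small_space -> small_space := hdiag (small_op i).

Definition matrix_space : hilbertType R := hsum (fun _ : J => (C : hilbertType R)).
Definition matrix_tuple : 'I_d -> matrix_space -> matrix_space :=
  dmx (fun i l => (1 + eps)%:C * mu l 0 i).

Definition total_space := hsum (pair_family small_space matrix_space).
Definition total_tuple i : total_space -> total_space :=
  hdiag (pair_op (small_tuple i) (matrix_tuple i)).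

Lemma copies_gt0 : 0 < copies.
Proof. by rewrite ltr0n card_option. Qed.

Lemma weight_gt0 : 0 < weight.
Proof. by rewrite divr_gt0// addr_gt0. Qed.

Let copies0 := copies_gt0.
Let weight0 := weight_gt0.
Let eps1 : 1 + eps != 0. Proof. by rewrite gt_eqF// addr_gt0. Qed.
Let weight1 : 1 - weight = (1 + eps)^-1.
Proof. by rewrite /weight; field. Qed.
Let weight1_gt0 : 0 < 1 - weight.
Proof. by rewrite weight1 invr_gt0 addr_gt0. Qed.

Lemma Es_bounded i : bounded_op (Es i).
Proof. exact: op_adjoint_bounded (Eb i) (EEs i). Qed.

Lemma part_op_normal i b : normal_op (part_op i b).
Proof.
have [El Ebd] := (bounded_opP _).1 (Eb i).
have [Esl Esbd] := (bounded_opP _).1 (Es_bounded i).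
have pl : linear (part_op i b).
  apply: linear_scalef; apply: linear_addf => //; case: b => // a x y.
  by rewrite Esl opprD scalerN.
have adj : op_adjoint (part_op i b) (fun x => if b then part_op i b x else - part_op i b x).
  move=> x y; rewrite /part_op; case: b {pl} => /=.
    by rewrite ipZl ipZr conjc_real ipDl ipDr EEs (op_adjoint_sym (EEs i)) addrC.
  rewrite ipNr ipZl ipZr conjc_real ipBl ipBr EEs (op_adjoint_sym (EEs i)).
  by rewrite -mulrN opprB.
split.
  apply/bounded_opP; split => //; apply: bnd_scale; apply: bnd_add => //.
  by case: b {pl adj} => //; exact: bnd_opp.
eexists; first exact: adj.
by apply/funext => x /=; case: b pl {adj} => // pl; rewrite (linN pl).
Qed.

Lemma part_op_tb i b : tb (part_op i b).
Proof.
have [El Ebd] := (bounded_opP _).1 (Eb i).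
have [Esl Esbd] := (bounded_opP _).1 (Es_bounded i).
have zl (a : C) : linear (fun x : H => a *: x) by exact: linear_scalef.
have zb (a : C) : bnd (fun x : H => a *: x) by apply: bnd_scale; exact: bnd_id.
have Est := tb_adjoint (Eb i) (EEs i) (Et i).
have tN : tb (fun x => - Es i x).
  have -> : (fun x => - Es i x) = (fun x => -1 *: Es i x).
    by apply/funext => x; rewrite scaleN1r.
  exact: (tb_comp (zl (-1)) (zb (-1)) Esl (@bnd_id _ H) Est).
have tE : tb (fun x => compression_error i x + (if b then Es i x else - Es i x)).
  by apply: tb_add; [exact: Et | case: b].
have tl : linear (fun x => compression_error i x + (if b then Es i x else - Es i x)).
  apply: linear_addf => //; case: b {tE} => // a x y.
  by rewrite Esl opprD scalerN.
exact: (tb_comp (zl _) (zb _) tl (@bnd_id _ H) tE).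
Qed.

(** The constant in [Esmall] is made for this: the error and its adjoint together, times copies /
    weight / 2, come to eps / 2, which leaves room for the strict bound on the operator norm. *)
Lemma part_op_small i b x : nm (part_op i b x) <= eps / 2 * nm x.
Proof.
have s0 : 0 <= eps * weight / (2 * copies).
  by rewrite divr_ge0// mulr_ge0// ltW.
have Ess y : nm (Es i y) <= eps * weight / (2 * copies) * nm y.
  apply: (op_adjoint_bound s0 _ (EEs i)); exact: Esmall.
have cw : 0 <= copies / weight / 2 by rewrite (divr_ge0 (divr_ge0 (ltW copies0) (ltW weight0))).
rewrite nmZ nmC ger0_norm//.
have -> : eps / 2 * nm x = copies / weight / 2 *
   (eps * weight / (2 * copies) * nm x + eps * weight / (2 * copies) * nm x).
  by field; rewrite !gt_eqF.
rewrite ler_wpM2l// (le_trans (nm_triangle _ _))// lerD//.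
by case: b => //; rewrite nmN.
Qed.

Lemma small_op_normal q : normal_tuple (fun i => small_op i q).
Proof.
case: q => [[[j b]|]|]; try exact: normal_tuple_zero.
by apply: (@normal_tuple_single _ H d (part_op j b) j); exact: part_op_normal.
Qed.

Lemma small_op_tb i q : tb (small_op i q).
Proof.
case: q => [[[j b]|]|]; try exact: tb_zero.
rewrite /small_op; have [_|_] := eqVneq i j; first exact: part_op_tb.
exact: tb_zero.
Qed.

Lemma small_tuple_norm i : op_norm (small_tuple i) < eps.
Proof.
have e2 : 0 <= eps / 2 by rewrite divr_ge0// ltW.
apply: (@le_lt_trans _ _ (eps / 2)); last first.
  by rewrite ltr_pdivrMr// mulr_natr mulr2n ltrDl.
apply: op_norm_le => f f1.
apply: le_trans (ler_piMr e2 f1).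
apply: hdiag_bound => // q x.
case: q => [[[j b]|]|] /=; rewrite ?nm0 ?(mulr_ge0 e2) ?nm_ge0//.
have [_|_] := eqVneq i j; first exact: part_op_small.
by rewrite nm0 (mulr_ge0 e2) ?nm_ge0.
Qed.

Lemma total_normal : normal_tuple total_tuple.
Proof.
apply: (@hdiag_normal_tuple _ _ _ d (fun i => pair_op (small_tuple i) (matrix_tuple i))) => -[].
  exact: (hdiag_normal_tuple (G := small_op) small_op_normal).
exact: dmx_normal.
Qed.

Lemma total_compact i : compact_op (total_tuple i).
Proof.
have [tn _] := total_normal.
apply: tb_compact_op; first by case: (tn i).
apply: hdiag_tb => -[]; last exact: dmx_tb.
by apply: hdiag_tb => q; exact: small_op_tb.
Qed.

(** Square roots, since the embedding enters twice in the compression V^* N V. *)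
Definition rest_weight : R := Num.sqrt (1 - weight).
Definition copy_weight : R := Num.sqrt (weight / copies).

Let rest2 : rest_weight%:C * rest_weight%:C = (1 - weight)%:C.
Proof. by rewrite -RCM -expr2 sqr_sqrtr// ltW. Qed.
Let copy2 : copy_weight%:C * copy_weight%:C = (weight / copies)%:C.
Proof. by rewrite -RCM -expr2 sqr_sqrtr// divr_ge0// ltW. Qed.

Definition embed_small (u : H) : small_space := fun q =>
  if q is Some _ then copy_weight%:C *: u else rest_weight%:C *: (u - pr e u).
Definition embed_matrix (u : H) : matrix_space := fun l => rest_weight%:C * inner u (g l).
Definition embed (u : H) : total_space := in_pair (embed_small u, embed_matrix u).

Definition project_small (y : small_space) : H :=
  rest_weight%:C *: (y None - pr e (y None)) + \sum_q copy_weight%:C *: y (Some q).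
Definition project_matrix (y : matrix_space) : H :=
  \sum_l (rest_weight%:C * (y l : C)) *: g l.
Definition project (y : total_space) : H :=
  project_small (y true) + project_matrix (y false).

Lemma embed_adjoint : adjoint (@inner R H) (@inner R total_space) embed project.
Proof.
move=> u y; rewrite ip_hsum big_bool /= /project ipDr; congr (_ + _).
  rewrite ip_hsum big_opt ipDr /=; congr (_ + _).
    by rewrite ipZl ipZr conjc_real ipBl ipBr pr_sym.
  by rewrite ip_sumr; apply: eq_bigr => q _; rewrite ipZl ipZr conjc_real.
rewrite ip_hsum ip_sumr; apply: eq_bigr => l _.
rewrite ipZr -[LHS]/(rest_weight%:C * inner u (g l) * Num.conj (y false l)).
by rewrite conjM conjc_real conjE mulrAC.
Qed.

(** With w = [weight] and P = [pr e], the three blocks add up to (1 - w) (u - P u) + w u + (1 - w) P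
    u = u. *)
Lemma embed_isometry u : inner (embed u) (embed u) = inner u u.
Proof.
rewrite embed_adjoint; congr (inner u _).
rewrite /project /project_small /project_matrix /= !(linZ (pr_linear e)) !(linB (pr_linear e)).
rewrite (pr_idem _ oe) subrr scaler0 subr0 scalerA rest2.
have -> : \sum_l (rest_weight%:C * (embed_matrix u l : C)) *: g l = (1 - weight)%:C *: pr e u.
  by rewrite -ge scaler_sumr; apply: eq_bigr => l _; rewrite mulrA rest2 scalerA.
have -> : \sum_(q : option ('I_d * bool)) copy_weight%:C *: (copy_weight%:C *: u) = weight%:C *: u.
  under eq_bigr do rewrite scalerA copy2.
  rewrite sumr_const -scaler_nat scalerA -RC_nat -RCM.
  by rewrite -/copies mulrC divfK// gt_eqF.
rewrite scalerBr addrAC subrK -scalerDl -RCD subrK.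
by rewrite scale1r.
Qed.

Lemma total_dilation : dilation (@inner R H) T total_tuple.
Proof.
exists embed, project; split.
- move=> a x y; apply: hsum_eq => -[]; apply: hsum_eq => q.
    rewrite /= !hsumD !hsumZ /embed_small; case: q => [q|].
      by rewrite scalerDr !scalerA mulrC.
    rewrite pr_linear; apply: ip_inj => w.
    rewrite !(ipDl, ipNl, ipZl); ring.
  rewrite /= !hsumD !hsumZ /embed_matrix ipDl ipZl mulrDr; congr (_ + _).
  by rewrite mulrCA.
- exact: embed_isometry.
- exact: embed_adjoint.
- move=> i; apply/funext => u.
  rewrite -[RHS]/(project (total_tuple i (embed u))) /project /total_tuple /hdiag /=.
  rewrite /project_small /small_tuple /hdiag /= (lin0 (pr_linear e)) subr0 scaler0 add0r.
  rewrite /project_matrix.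
  have -> : \sum_l (rest_weight%:C * (matrix_tuple i (embed_matrix u) l : C)) *: g l =
      \sum_l mu l 0 i *: (inner u (g l) *: g l).
    apply: eq_bigr => l _; rewrite scalerA; congr (_ *: _).
    rewrite -[matrix_tuple _ _ _]/((1 + eps)%:C * mu l 0 i * (rest_weight%:C * inner u (g l))).
    (* Compression multiplies the diagonal part by 1 - weight, which the factor 1 + eps on the
       entries exactly undoes. *)
    have e1 : (1 - weight)%:C * (1 + eps)%:C = 1 by rewrite -RCM weight1 mulVf.
    have -> : rest_weight%:C * ((1 + eps)%:C * mu l 0 i * (rest_weight%:C * inner u (g l))) =
      rest_weight%:C * rest_weight%:C * (1 + eps)%:C * (mu l 0 i * inner u (g l)) by ring.
    by rewrite rest2 e1 mul1r.
  have -> : \sum_q copy_weight%:C *: small_op i (Some q) (embed_small u (Some q)) =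
      compression_error i u.
    rewrite big_opt /= scaler0 add0r.
    rewrite (eq_bigr (fun q => (fun j b => copy_weight%:C *:
      (if i == j then part_op j b (copy_weight%:C *: u) else 0)) q.1 q.2)); last by case.
    rewrite -(pair_bigA _ (fun j b => copy_weight%:C *:
      (if i == j then part_op j b (copy_weight%:C *: u) else 0))) /=.
    rewrite (bigD1 i)//= [X in _ + X]big1 ?addr0 => [|j ji]; last first.
      by rewrite big1// => b _; rewrite eq_sym (negbTE ji) scaler0.
    have pl b : linear (part_op i b) by have [[]] := part_op_normal i b.
    rewrite big_bool /= eqxx !(linZ (pl _)) !scalerA copy2 /part_op -scalerDr.
    (* The two parts recombine to the error: the adjoint cancels, and the factor 2 meets the 1/2 in
       [part_op]. *)
    have -> : compression_error i u + Es i u + (compression_error i u - Es i u) =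
        2%:C *: compression_error i u.
      by rewrite addrACA subrr addr0 RCD scalerDl scale1r.
    rewrite scalerA -!RCM.
    have -> : weight / copies * (copies / weight / 2) * 2 = 1.
      by field; rewrite !gt_eqF.
    by rewrite scale1r.
  by rewrite /compression_error subrK.
Qed.

Lemma total_spectrum l : joint_spectrum matrix_tuple l ->
  exists q, l = (1 + eps)%:C *: mu q.
Proof.
move=> /dmx_spectrum[q hq]; exists q; apply/rowP => i; rewrite hq mxE.
by [].
Qed.

End DilationConstruction.

Theorem proposition3p1 (R : realType) (d : nat) (K : set 'rV[R[i]]_d)
    (H : hilbertType R) (T : 'I_d -> H -> H) :
  compact K -> convex_set K ->
  infinite_dimensional H ->
  (forall i, compact_op (T i)) ->
  (forall n, (0 < n)%N -> matrix_range T n `<=` Wmin K n) ->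
  forall eps : R, 0 < eps ->
  exists (L LA LB : hilbertType R) (N : 'I_d -> L -> L)
         (A : 'I_d -> LA -> LA) (B : 'I_d -> LB -> LB),
    [/\ normal_tuple N /\ dilation (@inner R H) T N,
        forall i, compact_op (N i),
        direct_sum A B N,
        forall i, op_norm (A i) < eps &
        joint_spectrum B `<=` [set (1 + eps)%:C *: x | x in K]].
Proof.
move=> _ _ infH Tc TK eps eps0.
have Tb i : bounded_op (T i) by case: (Tc i).
have tT i := compact_op_tb (Tc i).
(* If all vectors were zero, the empty family would span [H]. *)
have [x0 x00] : exists x0 : H, x0 != 0.
  apply: contrapT => /forallNP h; apply: infH.
  exists 0, (fun=> 0) => x; exists (fun=> 0); rewrite big_ord0.
  by apply/eqP; have := h x; move/negP; rewrite negbK.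
have c0 : 0 < eps * weight eps / (2 * @copies R d).
  by rewrite divr_gt0// mulr_gt0// ?copies_gt0 ?weight_gt0.
have [J [mu [g [e [oe Kmu ge Tsmall]]]]] := finite_dilation x00 Tb tT TK c0.
pose E := compression_error T mu g.
have Eb i : bounded_op (E i).
  have [Tl Tbd] := (bounded_opP _).1 (Tb i).
  apply/bounded_opP; split.
    apply: linear_subf => //; apply: linear_sumf => l; apply: linear_scalef.
    exact: rank_one_linear.
  apply: bnd_add => //; apply: bnd_opp; apply: bnd_sum => l; apply: bnd_scale.
  exact: rank_one_bnd.
have Et i : tb (E i).
  have -> : E i = fun x => T i x + \sum_l inner x (g l) *: (- mu l 0 i *: g l).
    apply/funext => x; rewrite /E /compression_error -sumrN; congr (_ + _).
    by apply: eq_bigr => l _; rewrite scaleNr scalerN !scalerA mulrC.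
  by apply: tb_add => //; apply: tb_sum => l; exact: tb_rank_one.
have /choice[Es EEs] : forall i, exists S, op_adjoint (E i) S.
  by move=> i; exact: adjoint_exists.
exists (@total_space R H d J), (@small_space R H d), (@matrix_space R J).
exists (total_tuple T eps mu g Es), (small_tuple T eps mu g Es), (matrix_tuple eps mu).
split.
- split; first exact: total_normal _ Eb EEs.
  exact (total_dilation eps0 oe ge Eb EEs).
- by move=> i; apply: total_compact.
- exact: direct_sum_pair.
- by move=> i; apply: small_tuple_norm.
- by move=> l /total_spectrum[q ->]; exists (mu q).
Qed.
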